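(* Let $-\infty\le a<b\le\infty$. The set $\mathcal{P}^{(k)}(a,b)$ of all operator $k$-tone functions on $(a,b)$ is a closed convex cone in $\mathcal{F}(a,b)$ for every $k\in\mathbb{N}$, and $$\mathcal{P}^{(1)}(a,b)\subsetneqq\mathcal{P}^{(3)}(a,b)\subsetneqq\mathcal{P}^{(5)}(a,b)\subsetneqq\cdots,$$ $$\mathcal{P}^{(2)}(a,b)\subsetneqq\mathcal{P}^{(4)}(a,b)\subsetneqq\mathcal{P}^{(6)}(a,b)\subsetneqq\cdots.$$
   Context: $\mathcal{F}(a,b)$ is the space of all real functions on $(a,b)$ with the topology of pointwise convergence. $\mathcal{H}$ is a fixed infinite-dimensional separable Hilbert space and $B(\mathcal{H})^{sa}(a,b)$ is the set of bounded self-adjoint operators on $\mathcal{H}$ with spectrum in $(a,b)$. For $A,B\in B(\mathcal{H})^{sa}(a,b)$, continuous $f$, and distinct $t_0,t_1,\dots\in[0,1]$, put $X_l=(1-t_l)A+t_lB$, $f^{[1]}(A,B;t_0,t_1)=\frac{f(X_0)-f(X_1)}{t_0-t_1}$, and recursively $f^{[k]}(A,B;t_0,\dots,t_k)=\frac{f^{[k-1]}(A,B;t_0,\dots,t_{k-1})-f^{[k-1]}(A,B;t_1,\dots,t_k)}{t_0-t_k}$. A real continuous function $f$ on $(a,b)$ is operator $k$-tone if $f^{[k]}(A,B;t_0,\dots,t_k)\ge0$ for every $A,B\in B(\mathcal{H})^{sa}(a,b)$ with $A\le B$ and every $0=t_0<t_1<\dots<t_k=1$. *)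

(* Defs.v *)
From HB Require Import structures.
From mathcomp Require Import all_boot all_order all_algebra.
From mathcomp Require Import complex.
From mathcomp Require Import all_classical all_reals all_analysis.
Set Implicit Arguments.
Unset Strict Implicit.
Unset Printing Implicit Defensive.
Import Order.TTheory GRing.Theory Num.Theory.
Import numFieldNormedType.Exports.
Local Open Scope classical_set_scope.
Local Open Scope ring_scope.
Local Open Scope complex_scope.

(* A complex Hilbert space is a complete normed R[i]-module H together with a
   positive definite Hermitian form [dot] (linear in its first argument) that
   induces the norm of H, in the sense of [norm_of_dot]. *)
Definition norm_of_dot (R : realType) (H : normedModType R[i])
    (dot : {dot H for (@Num.conj R[i])}) : Prop :=
  forall x : H, `|x| ^+ 2 = dot x x.

Definition separable_space (T : topologicalType) : Prop :=
  exists2 D : set T, countable D & dense D.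

Definition finite_dimensional (K : pzRingType) (V : lmodType K) : Prop :=
  exists (n : nat) (e : 'I_n -> V),
    forall x : V, exists c : 'I_n -> K, x = \sum_i c i *: e i.

Section operators.
Variables (R : realType) (H : normedModType R[i]).
Implicit Types T X Y : H -> H.

(* By [continuous_linear_bounded] and [bounded_linear_continuous], continuity
   of a linear map is boundedness. *)
Definition bounded_operator T : Prop := linear T /\ continuous T.

Definition invertible_operator T : Prop :=
  exists S : H -> H, [/\ bounded_operator S, cancel T S & cancel S T].

Definition spectrum T : set R[i] :=
  [set z | ~ invertible_operator (fun x => T x - z *: x)].

Definition op_horner (p : {poly R}) T : H -> H :=
  fun x => \sum_(i < size p) (p`_i)%:C *: iter i T x.

Variable dot : {dot H for (@Num.conj R[i])}.

Definition selfadjoint T : Prop := forall x y : H, dot (T x) y = dot x (T y).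

(* The order of R[i] is the partial one: 0 <= z means that z is real and
   nonnegative. *)
Definition positive_operator T : Prop := forall x : H, 0 <= dot (T x) x.

Definition loewner_le X Y : Prop := positive_operator (Y - X).

End operators.

Definition ointerval (R : realType) (a b : \bar R) : set R :=
  [set x | (a < x%:E < b)%E].

(* Bounded self-adjoint operators with spectrum in (a, b). *)
Definition Bsa (R : realType) (H : normedModType R[i])
    (dot : {dot H for (@Num.conj R[i])}) (a b : \bar R) : set (H -> H) :=
  [set X | [/\ bounded_operator X, selfadjoint dot X &
    spectrum X `<=` [set x%:C | x in ointerval a b]]].

Arguments Bsa {R H} dot a b.

Section functional_calculus.
Variables (R : realType) (H : normedModType R[i]) (a b : \bar R).

(* Y = f(X) in the sense of the continuous functional calculus: Y is the limit
   in operator norm of p(X) when the polynomials p tend to f uniformly on the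
   spectrum of X. *)
Definition is_fun_calculus (f : ointerval a b -> R) (X Y : H -> H) : Prop :=
  bounded_operator Y /\
  forall e : R, 0 < e -> exists p : {poly R},
    (forall s : ointerval a b, spectrum X (set_val s)%:C ->
      `|f s - p.[set_val s]| <= e) /\
    (forall x : H, `|Y x - op_horner p X x| <= e%:C * `|x|).

(* The default value 0 is irrelevant: when H is a Hilbert space, X is in
   [Bsa dot a b] and f is continuous, there is exactly one Y such that
   [is_fun_calculus f X Y]. *)
Definition fun_calculus (f : ointerval a b -> R) (X : H -> H) : H -> H :=
  xget (0 : H -> H) [set Y | is_fun_calculus f X Y].

Definition segment_operator (A B : H -> H) (t : R) : H -> H :=
  fun x => (1 - t)%:C *: A x + t%:C *: B x.

(* [op_divdiff f A B k t] is f^[k](A, B; t 0, ..., t k). *)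
Fixpoint op_divdiff (f : ointerval a b -> R) (A B : H -> H) (k : nat)
    (t : nat -> R) : H -> H :=
  match k with
  | 0%N => fun_calculus f (segment_operator A B (t 0%N))
  | k'.+1 => fun x => ((t 0%N - t k'.+1)^-1)%:C *:
      (op_divdiff f A B k' t x - op_divdiff f A B k' (fun i => t i.+1) x)
  end.

Definition operator_tone (dot : {dot H for (@Num.conj R[i])}) (k : nat)
    (f : ointerval a b -> R) : Prop :=
  continuous f /\
  forall A B : H -> H, Bsa dot a b A -> Bsa dot a b B -> loewner_le dot A B ->
  forall t : nat -> R,
    t 0%N = 0 -> t k = 1 -> (forall i, (i < k)%N -> t i < t i.+1) ->
    positive_operator dot (op_divdiff f A B k t).

End functional_calculus.

(* The set P^(k)(a, b), as a subset of F(a, b). *)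
Definition tone_set (R : realType) (H : normedModType R[i])
    (dot : {dot H for (@Num.conj R[i])}) (a b : \bar R) (k : nat) :
    set {ptws ointerval a b -> R} :=
  [set f | operator_tone dot k f].
Arguments tone_set {R H} dot a b k.

Definition convex_cone (R : numDomainType) (V : lmodType R) (P : set V) : Prop :=
  [/\ P !=set0, convex_set P &
      forall (c : R) (f : V), 0 <= c -> P f -> P (c *: f)].

(* Main.v *)
(* Idea. Compressing operators to finite-dimensional subspaces, and conversely
   lifting Hermitian matrices along orthonormal families, one sees that a
   continuous [f] is operator k-tone iff the k-th divided differences in t of
   <f(A + t D) v, v> are nonnegative for all matrix pencils with D >= 0.

   Suppose this holds for k+1. Testing it on rank-one perturbations of diagonal
   matrices shows that certain Hermitian kernels built from the k-th order
   remainder of [f] are positive semidefinite. A resolvent identity for a pair of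
   such kernels then gives, on every finite set of points,
     f(y) = p(y) + (y - s_0)...(y - s_k) * sum_m mu_m / w_m(y)
   with deg p <= k, mu_m >= 0 and w_m affine and positive. Each summand passes
   the test of order k+3, which gives the inclusions. The summands also satisfy a
   Harnack inequality, hence so does the remainder of [f]; this is a family of
   linear inequalities between values of [f] which forces continuity, so that
   k-tonicity is characterized by closed homogeneous linear conditions on
   finitely many values. The inclusions are strict because the k-th divided
   difference of -x^k is negative and those of higher order vanish. *)
Require Import Defs.
From HB Require Import structures.
From mathcomp Require Import all_boot all_order all_algebra.
From mathcomp Require Import complex ring lra zify.
From mathcomp Require Import all_classical all_reals all_analysis.
Set Implicit Arguments.
Unset Strict Implicit.
Unset Printing Implicit Defensive.
Import Order.TTheory GRing.Theory Num.Theory.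
Import numFieldNormedType.Exports.
Local Open Scope classical_set_scope.
Local Open Scope ring_scope.
Local Open Scope complex_scope.
Local Open Scope sesquilinear_scope.

(** * Divided differences *)

(** Why the order rises by two: dividing the nodal polynomial of n nodes by a + b x leaves a
    polynomial of degree below n plus its value at the pole -a/b over a + b x. That value has the
    sign of (-b)^-n, and the difference of order n + 2 of the form of (a + b X)^-1 has the sign of
    (-b)^(n+2); the signs cancel.

    The kernels are limits. A diagonal matrix is bordered by an entry c and perturbed along (1, e,
    ..., e), so that for small e essentially one eigenvalue moves, close to the node t; testing on
    (0, xi/e) keeps a finite form in xi. The entry c is free: with c the first node lo or the last
    node hi, the factor t - c absorbs one order and yields kernels r(x_l) + (x_i - c) M_il with the
    same r and M. In the combination with weights hi - x_i and x_i - lo, M cancels: this is the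
    resolvent identity.

    The obstacle is regularity: the diagonals contain f' and the limit needs bounded second
    differences, while f is only continuous. Tonicity survives averaging over translates, so the
    representation is proved for doubly averaged functions; what passes to the limit is its two
    consequences, tonicity of order k + 3 and the Harnack inequality. *)

Section divided_differences.
Variable K : fieldType.
Implicit Types (t g h : nat -> K) (k : nat).

Definition shift (T : Type) (t : nat -> T) : nat -> T := fun i => t i.+1.

Fixpoint dd k t g : K :=
  match k with
  | 0%N => g 0%N
  | k'.+1 => (t 0%N - t k'.+1)^-1 * (dd k' t g - dd k' (shift t) (shift g))
  end.

Lemma ddS k t g : dd k.+1 t g =
  (t 0%N - t k.+1)^-1 * (dd k t g - dd k (shift t) (shift g)).
Proof. by []. Qed.

Definition distinct_upto k t := forall i j, (i < j <= k)%N -> t i != t j.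

Lemma distinct_upto_shift k t :
  distinct_upto k.+1 t -> distinct_upto k (shift t).
Proof. by move=> tN i j ij; apply: tN; lia. Qed.

Lemma distinct_uptoW k t : distinct_upto k.+1 t -> distinct_upto k t.
Proof. by move=> tN i j ij; apply: tN; lia. Qed.

Lemma eq_dd k t t' g g' : (forall i, (i <= k)%N -> t i = t' i) ->
  (forall i, (i <= k)%N -> g i = g' i) -> dd k t g = dd k t' g'.
Proof.
elim: k t t' g g' => [|k IH] t t' g g' tt' gg' /=; first exact: gg'.
by rewrite !tt' //; congr (_ * (_ - _)); apply: IH => i ik;
  rewrite ?/shift; (apply: tt' || apply: gg'); lia.
Qed.

Lemma ddD k t g h : dd k t (fun i => g i + h i) = dd k t g + dd k t h.
Proof.
elim: k t g h => [|k IH] t g h //=.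
by rewrite IH (IH (shift t) (shift g) (shift h)); ring.
Qed.

Lemma ddZ k t a g : dd k t (fun i => a * g i) = a * dd k t g.
Proof.
elim: k t g => [|k IH] t g //=.
by rewrite IH (IH (shift t) (shift g)); ring.
Qed.

Lemma ddB k t g h : dd k t (fun i => g i - h i) = dd k t g - dd k t h.
Proof.
rewrite -[- dd k t h]mulN1r -ddZ -ddD; apply: eq_dd => // i _.
by rewrite mulN1r.
Qed.

Lemma dd_cst k t a : dd k.+1 t (fun=> a) = 0.
Proof.
elim: k t => [|k IH] t; first by rewrite /= /shift subrr mulr0.
by rewrite ddS IH (IH (shift t)) subrr mulr0.
Qed.

Lemma dd0 k t : dd k t (fun=> 0) = 0.
Proof. by case: k => [|k] //; exact: dd_cst. Qed.

Lemma dd_sum (I : Type) (r : seq I) (P : pred I) k t (g : I -> nat -> K) :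
  dd k t (fun l => \sum_(i <- r | P i) g i l) = \sum_(i <- r | P i) dd k t (g i).
Proof.
elim: r => [|i r IH].
  rewrite big_nil (@eq_dd k t t _ (fun=> 0)) ?dd0 // => l _.
  by rewrite big_nil.
rewrite big_cons -IH; case: ifP => Pi.
  by rewrite -ddD; apply: eq_dd => // l _; rewrite big_cons Pi.
by apply: eq_dd => // l _; rewrite big_cons Pi.
Qed.

(** Leibniz rule for the factor t - t_0, which removes the first node. With [dd_mullast] it trades
    one order for an end node; this is how the kernels of [smooth_representation] lose their extra
    node. *)
Lemma dd_mulfirst k t g : distinct_upto k.+1 t ->
  dd k.+1 t (fun i => (t i - t 0%N) * g i) = dd k (shift t) (shift g).
Proof.
elim: k t g => [|k IH] t g tN.
  rewrite /= /shift subrr mul0r sub0r -mulNr opprB mulrA mulVf ?mul1r //.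
  by rewrite subr_eq0 tN ?ltnSn ?leqnn ?andbT; lia.
have n1 : t 0%N - t k.+2 != 0 by rewrite subr_eq0 tN ?ltnSn ?leqnn ?andbT; lia.
have n2 : t 1%N - t k.+2 != 0 by rewrite subr_eq0 tN ?ltnSn ?leqnn ?andbT; lia.
rewrite ddS.
rewrite IH; last exact: distinct_uptoW.
rewrite (@eq_dd k.+1 (shift t) (shift t) _ (fun i => (shift t i - shift t 0%N) *
   shift g i + (t 1%N - t 0%N) * shift g i)) //; last first.
  by move=> i _; rewrite /shift; ring.
rewrite ddD ddZ IH; last exact: distinct_upto_shift.
rewrite /= /shift.
by field; apply/andP.
Qed.

Lemma dd_mullast k t g : distinct_upto k.+1 t ->
  dd k.+1 t (fun i => (t i - t k.+1) * g i) = dd k t g.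
Proof.
move=> tN; have n1 : t 0%N - t k.+1 != 0 by rewrite subr_eq0 tN ?ltnSn ?leqnn ?andbT; lia.
rewrite (@eq_dd k.+1 t t _ (fun i => (t i - t 0%N) * g i +
  (t 0%N - t k.+1) * g i)) //; last by move=> i _; ring.
by rewrite ddD dd_mulfirst // ddZ /=; field.
Qed.

(** Serves to normalize arbitrary increasing nodes to nodes running from 0 to 1. *)
Lemma dd_affine k t (a b : K) g : b != 0 ->
  dd k (fun i => a + b * t i) g = b ^- k * dd k t g.
Proof.
move=> b0; elim: k t g => [|k IH] t g; first by rewrite expr0 invr1 mul1r.
rewrite /= IH (IH (shift t) (shift g)).
rewrite opprD addrACA subrr add0r -mulrBr invfM exprS invfM.
by rewrite -mulrBr; ring.
Qed.

Lemma dd_horner k t (p : {poly K}) : distinct_upto k t -> (size p <= k.+1)%N ->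
  dd k t (fun i => p.[t i]) = p`_k.
Proof.
elim: k t p => [|k IH] t p tN sp.
  by rewrite /= (size1_polyC sp) hornerC coefC.
(* Write p = (X - t_0) q + c: the constant disappears at positive order and [dd_mulfirst] lowers the
   order of the other term. *)
pose q := p %/ ('X - (t 0%N)%:P).
pose c := (p %% ('X - (t 0%N)%:P))`_0.
have pE : p = q * ('X - (t 0%N)%:P) + c%:P.
  rewrite {1}(divp_eq p ('X - (t 0%N)%:P)); congr (_ + _).
  apply: size1_polyC; rewrite -ltnS.
  by rewrite -[X in (_ < X)%N](size_XsubC (t 0%N)) ltn_modp polyXsubC_eq0.
have sq : (size q <= k.+1)%N.
  by rewrite size_divp ?polyXsubC_eq0 // size_XsubC leq_subLR.
rewrite (@eq_dd k.+1 t t _ (fun i => (t i - t 0%N) * q.[t i] + c)) //; last first.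
  by move=> i _; rewrite pE !hornerE; ring.
rewrite ddD dd_cst addr0 dd_mulfirst // IH //; last exact: distinct_upto_shift.
rewrite pE coefD coefC /= addr0 mulrBr coefB coefMX /= coefMC.
by rewrite [q`_k.+1]nth_default // mul0r subr0.
Qed.

Lemma dd_inv k t (u v : K) : distinct_upto k t ->
  (forall i, (i <= k)%N -> u + t i * v != 0) ->
  dd k t (fun i => (u + t i * v)^-1) =
  (- v) ^+ k / \prod_(i < k.+1) (u + t i * v).
Proof.
elim: k t => [|k IH] t tN nz.
  by rewrite /= big_ord1 expr0 mul1r.
have n1 : t 0%N - t k.+1 != 0 by rewrite subr_eq0 tN ?ltnSn ?leqnn ?andbT; lia.
rewrite /= IH; [|exact: distinct_uptoW|by move=> i ik; apply: nz; lia].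
rewrite (IH (shift t));
  [|exact: distinct_upto_shift|by move=> i ik; apply: nz; lia].
rewrite [in RHS]big_ord_recl [in RHS]big_ord_recr big_ord_recl big_ord_recr.
pose P := \prod_(i < k) (u + t i.+1 * v).
change ((t 0%N - t k.+1)^-1 *
  ((- v) ^+ k / ((u + t 0%N * v) * P) - (- v) ^+ k / (P * (u + t k.+1 * v))) =
  (- v) ^+ k.+1 / ((u + t 0%N * v) * (P * (u + t k.+1 * v)))).
rewrite exprS.
have P0 : P != 0 by apply/prodf_neq0 => i _; apply: nz; have := ltn_ord i; lia.
have a0 := nz 0%N isT.
have ak : u + t k.+1 * v != 0 by apply: nz.
by field; rewrite ak P0 a0 n1.
Qed.

(** Expanding the divided difference gives the barycentric form of the interpolant q. Building q by
    the Neville-Aitken recursion yields both properties in one induction. *)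
Lemma dd_cauchy k t g : distinct_upto k t ->
  exists q : {poly K}, [/\ (size q <= k.+1)%N,
    forall j, (j <= k)%N -> q.[t j] = g j &
    forall y, (forall i, (i <= k)%N -> y != t i) ->
    dd k t (fun i => g i / (y - t i)) = q.[y] / \prod_(i < k.+1) (y - t i)].
Proof.
elim: k t g => [|k IH] t g tN.
  exists (g 0%N)%:P; split; first exact: size_polyC_leq1.
    by case=> // _; rewrite hornerC.
  by move=> y _; rewrite /= big_ord1 hornerC.
have n1 : t 0%N - t k.+1 != 0 by rewrite subr_eq0 tN ?ltnSn ?leqnn ?andbT; lia.
have [q1 [s1 i1 q1E]] := IH t g (distinct_uptoW tN).
have [q2 [s2 i2 q2E]] := IH (shift t) (shift g) (distinct_upto_shift tN).
exists ((t 0%N - t k.+1)^-1 *: (q1 * ('X - (t k.+1)%:P) - q2 * ('X - (t 0%N)%:P))).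
split.
- apply: leq_trans (size_scale_leq _ _) _.
  apply: leq_trans (size_polyD _ _) _; rewrite size_polyN geq_max.
  by apply/andP; split; apply: leq_trans (size_polyMleq _ _) _;
    rewrite size_XsubC addn2.
- move=> j jk; rewrite hornerZ hornerD hornerN !hornerM !hornerXsubC.
  case: j jk => [|j] jk; first by rewrite i1 //; field.
  rewrite [q2.[_]](i2 j) // /shift; move: jk; rewrite ltnS leq_eqVlt.
  by case/orP => [/eqP ->|jk]; [field|rewrite i1 //; field].
move=> y yN; rewrite /= q1E; last by move=> i ik; apply: yN; lia.
rewrite [dd k (shift t) _]q2E; last by move=> i ik; apply: yN; lia.
rewrite [in RHS]big_ord_recl [in RHS]big_ord_recr big_ord_recl big_ord_recr.
pose P := \prod_(i < k) (y - t i.+1).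
change ((t 0%N - t k.+1)^-1 *
  (q1.[y] / ((y - t 0%N) * P) - q2.[y] / (P * (y - t k.+1))) =
  ((t 0%N - t k.+1)^-1 *: (q1 * ('X - (t k.+1)%:P) - q2 * ('X - (t 0%N)%:P))).[y]
   / ((y - t 0%N) * (P * (y - t k.+1)))).
rewrite hornerZ hornerD hornerN !hornerM !hornerXsubC.
have P0 : P != 0.
  apply/prodf_neq0 => i _; rewrite subr_eq0; apply: yN; have := ltn_ord i; lia.
have a0 : y - t 0%N != 0 by rewrite subr_eq0 yN.
have ak : y - t k.+1 != 0 by rewrite subr_eq0 yN.
by field; rewrite ak P0 a0 n1.
Qed.

End divided_differences.

(** * Positive semidefinite matrices and matrix pencils *)

Section psd.
Variable C : numClosedFieldType.

Fact dC_key : unit. Proof. by []. Qed.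

(* Locked: unification of matrix products would otherwise unfold it. *)
Definition dC n (d : 'I_n -> C) : 'M[C]_n :=
  locked_with dC_key (diag_mx (\row_i d i)).

Lemma dC_diag n (d : 'I_n -> C) : dC d = diag_mx (\row_i d i).
Proof. by rewrite /dC unlock. Qed.

Lemma dCE n (d : 'I_n -> C) i j : dC d i j = d i *+ (i == j).
Proof. by rewrite dC_diag !mxE. Qed.

Lemma adjM m n p (A : 'M[C]_(m, n)) (B : 'M[C]_(n, p)) :
  (A *m B)^t* = B^t* *m A^t*.
Proof. by rewrite trmx_mul map_mxM. Qed.

Lemma dC_mull n m (d : 'I_n -> C) (A : 'M[C]_(n, m)) i j :
  (dC d *m A) i j = d i * A i j.
Proof. by rewrite dC_diag mul_diag_mx !mxE. Qed.

Lemma dC_mulr n m (d : 'I_n -> C) (A : 'M[C]_(m, n)) i j :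
  (A *m dC d) i j = A i j * d j.
Proof. by rewrite dC_diag mul_mx_diag !mxE. Qed.

Lemma dCM n (d e : 'I_n -> C) : dC d *m dC e = dC (fun i => d i * e i).
Proof.
apply/matrixP => i j; rewrite dC_mull !dCE.
by case: eqP => _; rewrite ?mulr1n ?mulr0n ?mulr0.
Qed.

Lemma dCD n (d e : 'I_n -> C) : dC d + dC e = dC (fun i => d i + e i).
Proof. by apply/matrixP => i j; rewrite mxE !dCE mulrnDl. Qed.

Lemma dCN n (d : 'I_n -> C) : - dC d = dC (fun i => - d i).
Proof. by apply/matrixP => i j; rewrite mxE !dCE mulNrn. Qed.

Lemma dCZ n a (d : 'I_n -> C) : a *: dC d = dC (fun i => a * d i).
Proof. by apply/matrixP => i j; rewrite mxE !dCE mulrnAr. Qed.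

Lemma dC1 n : dC (fun=> 1) = 1%:M :> 'M[C]_n.
Proof. by apply/matrixP => i j; rewrite dCE !mxE. Qed.

Lemma dC_adj n (d : 'I_n -> C) : (forall i, d i \is Num.real) ->
  (dC d)^t* = dC d.
Proof.
move=> dr; apply/matrixP => i j; rewrite !mxE !dCE eq_sym.
by case: eqP => [->|_]; rewrite ?mulr1n ?mulr0n ?rmorph0 // (CrealP (dr _)).
Qed.

Definition psd n (A : 'M[C]_n) :=
  A^t* = A /\ forall v : 'cV[C]_n, 0 <= (v^t* *m A *m v) 0 0.

Lemma psdD n (A B : 'M[C]_n) : psd A -> psd B -> psd (A + B).
Proof.
move=> [Ah Ap] [Bh Bp]; split; first by rewrite linearD /= map_mxD Ah Bh.
by move=> v; rewrite mulmxDr mulmxDl mxE addr_ge0.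
Qed.

Lemma psd_congr m n (A : 'M[C]_n) (W : 'M[C]_(n, m)) :
  psd A -> psd (W^t* *m A *m W).
Proof.
move=> [Ah Ap]; split; first by rewrite !adjM trmxCK Ah mulmxA.
by move=> v; rewrite !mulmxA -adjM -mulmxA.
Qed.

Lemma quad_dC n (d : 'I_n -> C) (v : 'cV[C]_n) :
  (v^t* *m dC d *m v) 0 0 = \sum_i d i * `|v i 0| ^+ 2.
Proof.
rewrite -mulmxA mxE; apply: eq_bigr => i _.
by rewrite dC_mull !mxE normCK mulrCA [_ * v i 0]mulrC.
Qed.

Lemma psd_dC n (d : 'I_n -> C) : psd (dC d) <-> forall i, 0 <= d i.
Proof.
split=> [[_ dp] i|d0].
  have := dp (delta_mx i 0); rewrite quad_dC (bigD1 i) //= big1.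
    by rewrite mxE !eqxx addr0 normr1 expr1n mulr1.
  by move=> j /negPf ji; rewrite mxE ji normr0 expr0n mulr0.
split=> [|v]; first by apply: dC_adj => i; exact: ger0_real.
by rewrite quad_dC sumr_ge0 // => i _; rewrite mulr_ge0 ?exprn_ge0.
Qed.

Lemma hermitian_spectral n (A : 'M[C]_n) : A^t* = A ->
  exists U (d : 'I_n -> C), [/\ U \is unitarymx, A = U^t* *m dC d *m U &
    forall i, d i \is Num.real].
Proof.
move=> Ah; have Aherm : A \is hermsymmx.
  by apply/is_hermitianmxP; rewrite expr0 scale1r Ah.
have /orthomx_spectralP AE := hermitian_normalmx Aherm.
exists (spectralmx A), (fun i => spectral_diag A 0 i); split.
- exact: spectral_unitarymx.
- rewrite dC_diag (_ : \row_i _ = spectral_diag A).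
    by rewrite -invmx_unitary ?spectral_unitarymx.
  by apply/rowP => i; rewrite mxE.
by move=> i; have /mxOverP/(_ 0 i) := hermitian_spectral_diag_real Aherm.
Qed.

Lemma unitary_Kt n (U : 'M[C]_n) : U \is unitarymx -> U *m U^t* = 1%:M.
Proof. by move/unitarymxP. Qed.

Lemma unitary_tK n (U : 'M[C]_n) : U \is unitarymx -> U^t* *m U = 1%:M.
Proof.
move=> Uu; rewrite -invmx_unitary //.
by rewrite mulVmx // unitarymx_unit.
Qed.

Lemma psd_spectral n (A : 'M[C]_n) : psd A ->
  exists U (d : 'I_n -> C), [/\ U \is unitarymx, A = U^t* *m dC d *m U &
    forall i, 0 <= d i].
Proof.
move=> Apsd; have [U [d [Uu AE _]]] := hermitian_spectral Apsd.1.
exists U, d; split => //; apply/psd_dC.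
have -> : dC d = (U^t*)^t* *m A *m U^t*.
  by rewrite AE trmxCK !mulmxA (unitary_Kt Uu) mul1mx -mulmxA
     (unitary_Kt Uu) mulmx1.
exact: psd_congr.
Qed.

Lemma psd_null n (A : 'M[C]_n) (v : 'cV[C]_n) : psd A ->
  (v^t* *m A *m v) 0 0 = 0 -> A *m v = 0.
Proof.
move=> /psd_spectral [U [d [Uu -> d0]]].
rewrite -!mulmxA [v^t* *m _]mulmxA -adjM mulmxA quad_dC => /eqP.
rewrite psumr_eq0; last by move=> i _; rewrite mulr_ge0 ?exprn_ge0.
move=> /allP z0; suff -> : dC d *m (U *m v) = 0 by rewrite mulmx0.
apply/matrixP => i j; rewrite dC_mull ord1 [RHS]mxE; apply/eqP.
have /implyP/(_ isT) := z0 i (mem_index_enum i).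
by rewrite !mulf_eq0 normr_eq0 orbb.
Qed.

Lemma psd_diag_ge0 n (A : 'M[C]_n) i : psd A -> 0 <= A i i.
Proof.
move=> /psd_spectral [U [d [Uu -> d0]]].
rewrite -mulmxA mxE sumr_ge0 // => j _; rewrite dC_mull !mxE mulrCA.
by rewrite [_ * U j i]mulrC -normCK mulr_ge0 ?exprn_ge0.
Qed.

Lemma psd_zero_diag n (A : 'M[C]_n) i j : psd A -> A i i = 0 ->
  A i j = 0 /\ A j i = 0.
Proof.
move=> Ap Aii; have Aji : A j i = 0.
  have q : ((delta_mx i 0 : 'cV[C]_n)^t* *m A *m (delta_mx i 0 : 'cV[C]_n)) 0 0 = 0.
    rewrite -mulmxA -colE mxE (bigD1 i) //= big1 ?addr0.
      by rewrite !mxE Aii mulr0.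
    by move=> l /negPf li; rewrite !mxE li /= rmorph0 mul0r.
  by have := psd_null Ap q; rewrite -colE => /matrixP/(_ j 0); rewrite !mxE.
by split => //; rewrite -Ap.1 !mxE Aji rmorph0.
Qed.

(** With Q = S + T, the matrix Q^(-1/2) S Q^(-1/2) has spectrum in [0, 1] and its eigenbasis serves
    both matrices. Q may be singular, so W need not be invertible; the identity with [Y], which says
    that the range of W is invariant under diag s, replaces invertibility in
    [kernel_representation]. *)
Lemma simultaneous_diag n (S T : 'M[C]_n) : psd S -> psd T ->
  exists (W Y : 'M[C]_n) (s : 'I_n -> C),
    [/\ S = W^t* *m dC s *m W, T = W^t* *m dC (fun i => 1 - s i) *m W,
       dC s *m W = W *m Y & forall i, 0 <= s i <= 1].
Proof.
move=> Sp Tp; have [U [d [Uu STE d0]]] := psd_spectral (psdD Sp Tp).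
have UUt := unitary_Kt Uu; have UtU := unitary_tK Uu.
(* [h] is the diagonal of the square root of S + T; as the inverse of 0 is 0, [e] is its
   pseudo-inverse. *)
pose h i := sqrtC (d i); pose e i := (h i)^-1.
have h0 i : 0 <= h i by rewrite sqrtC_ge0.
have hr i : h i \is Num.real by exact: ger0_real.
have er i : e i \is Num.real by apply: ger0_real; rewrite invr_ge0.
have hh i : h i * h i = d i by rewrite -expr2 sqrtCK.
have ehe i : h i * e i * e i = e i.
  by rewrite /e; have [->|hn] := eqVneq (h i) 0; rewrite ?invr0 ?mulr0 ?divff ?mul1r.
have [S' S'd] : exists S', S' = (U^t*)^t* *m S *m U^t*.
  by exists ((U^t*)^t* *m S *m U^t*).
have [T' T'd] : exists T', T' = (U^t*)^t* *m T *m U^t*.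
  by exists ((U^t*)^t* *m T *m U^t*).
have S'p : psd S' by rewrite S'd; exact: psd_congr.
have T'p : psd T' by rewrite T'd; exact: psd_congr.
have S'E : S = U^t* *m S' *m U.
  by rewrite S'd trmxCK !mulmxA UtU mul1mx -!mulmxA UtU mulmx1.
have ST' : S' + T' = dC d.
  rewrite S'd T'd -mulmxDl -mulmxDr STE trmxCK !mulmxA UUt mul1mx.
  by rewrite -mulmxA UUt mulmx1.
(* S is dominated by S + T, hence vanishes on the kernel of S + T. *)
have S'0 i j : h i = 0 -> S' i j = 0 /\ S' j i = 0.
  move=> hi; apply: psd_zero_diag => //; apply/eqP; rewrite eq_le.
  rewrite psd_diag_ge0 // andbT.
  have := congr1 (fun M : 'M[C]_n => M i i) ST'.
  rewrite mxE dCE eqxx mulr1n -hh hi mul0r => /eqP; rewrite addr_eq0 => /eqP ->.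
  by rewrite oppr_le0 psd_diag_ge0.
have hS'h : dC (fun i => h i * e i) *m S' *m dC (fun i => h i * e i) = S'.
  apply/matrixP => i j; rewrite dC_mulr dC_mull.
  have [hi|hi] := eqVneq (h i) 0; first by rewrite (S'0 i j hi).1 mulr0 mul0r.
  have [hj|hj] := eqVneq (h j) 0; first by rewrite (S'0 j i hj).2 mulr0 mul0r.
  by rewrite /e !divff // mul1r mulr1.
have [H1 H1d] : exists H1, H1 = (dC e)^t* *m S' *m dC e.
  by exists ((dC e)^t* *m S' *m dC e).
have H1p : psd H1 by rewrite H1d; exact: psd_congr.
have [V [s [Vu H1E s0]]] := psd_spectral H1p.
have VVt := unitary_Kt Vu; have VtV := unitary_tK Vu.
exists (V *m dC h *m U), (U^t* *m dC e *m H1 *m dC h *m U), s.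
have WE : (V *m dC h *m U)^t* *m (V *m dC h *m U) = S + T.
  rewrite !adjM (dC_adj hr) !mulmxA -[X in X *m dC h *m U]mulmxA VtV mulmx1.
  rewrite -[X in X *m U]mulmxA dCM STE; congr (_ *m dC _ *m _).
  exact/funext.
have SE : S = (V *m dC h *m U)^t* *m dC s *m (V *m dC h *m U).
  rewrite [LHS]S'E -[in LHS]hS'h -!dCM !adjM (dC_adj hr).
  transitivity (U^t* *m (dC h *m H1 *m dC h) *m U).
    have ehC : dC h *m dC e = dC e *m dC h.
      by rewrite !dCM; congr dC; apply/funext => i; rewrite mulrC.
    by rewrite H1d (dC_adj er) {2}ehC !mulmxA.
  by rewrite H1E !mulmxA.
split; first exact: SE.
- have -> : T = (S + T) - S by rewrite addrC addKr.
  have -> : dC (fun i => 1 - s i) = 1%:M - dC s by rewrite -dC1 dCN dCD.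
  by rewrite mulmxBr mulmxBl mulmx1 WE -SE.
- have -> : dC s *m (V *m dC h *m U) = V *m H1 *m dC h *m U.
    by rewrite H1E !mulmxA VVt mul1mx.
  transitivity (V *m (dC h *m (U *m U^t*) *m dC e *m H1) *m dC h *m U);
    last by rewrite !mulmxA.
  rewrite UUt mulmx1 dCM; congr (V *m _ *m _ *m _).
  rewrite H1d (dC_adj er) !mulmxA dCM; congr (dC _ *m _ *m _).
  by apply/funext => i; rewrite ehe.
move=> i; rewrite s0 /=.
suff : psd (dC (fun i => 1 - s i)) by move/psd_dC => /(_ i); rewrite subr_ge0.
have -> : dC (fun i => 1 - s i) = (V^t*)^t* *m (1%:M - H1) *m V^t*.
  rewrite trmxCK mulmxBr mulmxBl mulmx1 VVt H1E !mulmxA VVt mul1mx.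
  by rewrite -mulmxA VVt mulmx1 -dC1 dCN dCD.
apply: psd_congr.
(* The first term is the projection onto the kernel of S + T; both terms are positive, so [H1] is at
   most 1. *)
have -> : 1%:M - H1 = dC (fun i => 1 - h i * e i) + (dC e)^t* *m T' *m dC e.
  have -> : T' = dC d - S' by rewrite -ST' addrC addKr.
  rewrite mulmxBr mulmxBl -H1d addrA; congr (_ - _).
  rewrite (dC_adj er) !dCM dCD -dC1; congr dC; apply/funext => j.
  rewrite -hh -[h j * h j]mulrC; have := ehe j; set x := h j; set y := e j => xy.
  have -> : y * (x * x) * y = x * (x * y * y) by ring.
  by rewrite xy subrK.
apply: psdD; last exact: psd_congr.
apply/psd_dC => j; rewrite /e.
by have [->|hj] := eqVneq (h j) 0; rewrite ?mul0r ?subr0 // divff // subrr.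
Qed.

End psd.

(** * Spectral decompositions and resolvents of matrix pencils *)

Section pencils.
Variable C : numClosedFieldType.

Definition spec_dec n (X U : 'M[C]_n) (d : 'I_n -> C) :=
  U \is unitarymx /\ X = U^t* *m dC d *m U.

Lemma spec_dec_quad n (U : 'M[C]_n) (d : 'I_n -> C) (v : 'cV[C]_n) :
  (v^t* *m (U^t* *m dC d *m U) *m v) 0 0 =
  \sum_i d i * `|(U *m v) i 0| ^+ 2.
Proof. by rewrite !mulmxA -adjM -mulmxA quad_dC. Qed.

Lemma spec_dec_iter n (X U : 'M[C]_n) d (v : 'cV[C]_n) j : spec_dec X U d ->
  iter j (mulmx X) v = U^t* *m dC (fun i => d i ^+ j) *m U *m v.
Proof.
move=> [Uu XE]; have UUt := unitary_Kt Uu; elim: j => [|j IH].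
  rewrite (_ : dC _ = 1%:M) ?mulmx1 ?unitary_tK ?mul1mx //.
  by rewrite -dC1; congr dC; apply/funext => i; rewrite expr0.
rewrite iterS IH {1}XE !mulmxA -[U^t* *m dC d *m U *m _]mulmxA UUt mulmx1.
rewrite -[U^t* *m dC d *m _]mulmxA dCM; congr (_ *m dC _ *m _ *m _).
by apply/funext => i; rewrite exprS.
Qed.

Lemma spec_dec_affine n (X U : 'M[C]_n) d a b : spec_dec X U d ->
  a%:M + b *: X = U^t* *m dC (fun i => a + b * d i) *m U.
Proof.
move=> [Uu ->].
rewrite -dCD mulmxDr mulmxDl -dCZ -scalemxAr -scalemxAl; congr (_ + _).
rewrite (_ : dC _ = a *: 1%:M); last first.
  by rewrite -dC1 dCZ; congr dC; apply/funext => i; rewrite mulr1.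
by rewrite -scalemxAr -scalemxAl mulmx1 unitary_tK // -scalemx1.
Qed.

Lemma spec_dec_inv n (X U : 'M[C]_n) d (v : 'cV[C]_n) : spec_dec X U d ->
  (forall i, d i != 0) -> X \in unitmx /\
  X *m (U^t* *m dC (fun i => (d i)^-1) *m U *m v) = v.
Proof.
move=> [Uu XE] d0; have UUt := unitary_Kt Uu.
have XX : X *m (U^t* *m dC (fun i => (d i)^-1) *m U) = 1%:M.
  rewrite XE !mulmxA -[U^t* *m dC d *m U *m _]mulmxA UUt mulmx1.
  rewrite -[U^t* *m dC d *m _]mulmxA dCM (_ : dC _ = 1%:M).
    by rewrite mulmx1 unitary_tK.
  by rewrite -dC1; congr dC; apply/funext => i; rewrite divff.
by split; [case: (mulmx1_unit XX)|rewrite mulmxA XX mul1mx].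
Qed.

Lemma mx_iter_poly n (A D : 'M[C]_n) (v : 'cV[C]_n) j :
  exists V : nat -> 'cV[C]_n, (forall i, (j < i)%N -> V i = 0) /\
  forall t, iter j (mulmx (A + t *: D)) v = \sum_(i < j.+1) t ^+ i *: V i.
Proof.
elim: j => [|j [V [V0 VE]]].
  exists (fun i => if i == 0%N then v else 0); split; first by case.
  by move=> t; rewrite big_ord1 expr0 scale1r.
exists (fun i => A *m V i + if i is i'.+1 then D *m V i' else 0); split.
  by case=> // i ij; rewrite !V0 ?mulmx0 ?addr0 //; lia.
move=> t; rewrite iterS VE mulmxDl.
under [RHS]eq_bigr do rewrite scalerDr.
rewrite big_split /=; congr (_ + _).
  rewrite [in RHS]big_ord_recr /= (V0 j.+1) // mulmx0 scaler0 addr0 mulmx_sumr.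
  by apply: eq_bigr => i _; rewrite -scalemxAr.
rewrite [in RHS]big_ord_recl /= scaler0 add0r -scalemxAl mulmx_sumr scaler_sumr.
by apply: eq_bigr => i _; rewrite -scalemxAr scalerA exprS.
Qed.

(** Simultaneous diagonalization of X and D diagonalizes X + t D for all t at once, in a basis
    independent of t. The form of the inverse is thus a positive sum of inverses of affine functions
    of t, whose divided differences are explicit. *)
Lemma pencil_resolvent n (X D : 'M[C]_n) (v : 'cV[C]_n) :
  psd X -> psd D -> X \in unitmx ->
  exists s w : 'I_n -> C, [/\ forall i, 0 <= s i <= 1, forall i, 0 <= w i &
    forall t, psd (X + t *: D) -> X + t *: D \in unitmx ->
    (forall i, 0 < s i + t * (1 - s i)) /\
    forall y, (X + t *: D) *m y = v ->
      (v^t* *m y) 0 0 = \sum_i w i / (s i + t * (1 - s i))].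
Proof.
move=> Xp Dp Xu; have [W [Y [s [XE DE _ s01]]]] := simultaneous_diag Xp Dp.
have Wu : W \in unitmx by move: Xu; rewrite XE unitmx_mul => /andP[].
have WW : invmx W *m W = 1%:M by rewrite mulVmx.
have WW' : W *m invmx W = 1%:M by rewrite mulmxV.
have WWt : (invmx W)^t* *m W^t* = 1%:M.
  by rewrite -adjM WW' tr_scalar_mx map_scalar_mx rmorph1.
pose w := (invmx W)^t* *m v.
exists s, (fun i => `|w i 0| ^+ 2); split;
  [exact: s01|by move=> i; exact: exprn_ge0|move=> t tp tu].
pose c i := s i + t * (1 - s i).
have tE : X + t *: D = W^t* *m dC c *m W.
  by rewrite [in LHS]XE [in LHS]DE scalemxAl scalemxAr dCZ -mulmxDl -mulmxDr dCD.
have cE : dC c = (invmx W)^t* *m (X + t *: D) *m invmx W.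
  by rewrite tE !mulmxA WWt mul1mx -mulmxA WW' mulmx1.
have c0 i : 0 < c i.
  rewrite lt0r; apply/andP; split; last first.
    by move: i; apply/psd_dC; rewrite cE; exact: psd_congr.
  have : dC c \in unitmx.
    by rewrite cE !unitmx_mul tu unitmx_inv Wu; case: (mulmx1_unit WWt) => ->.
  rewrite unitmxE dC_diag det_diag unitfE prodf_seq_neq0 => /allP/(_ i).
  by rewrite mxE => /(_ (mem_index_enum i)).
split=> // y yE.
have : dC c *m (W *m y) = w.
  by rewrite /w -yE tE !mulmxA WWt mul1mx.
move=> /matrixP Ez.
have -> : v^t* *m y = w^t* *m (W *m y).
  by rewrite /w adjM trmxCK mulmxA -[_ *m invmx W *m W]mulmxA WW mulmx1.
rewrite mxE; apply: eq_bigr => i _; have := Ez i 0; rewrite dC_mull => wE.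
have ci := c0 i; rewrite -/(c i).
have -> : (W *m y) i 0 = w i 0 / c i by rewrite -wE mulrAC divff ?mul1r ?gt_eqF.
have -> : (w^t*) 0 i = Num.conj (w i 0) by rewrite mxE mxE.
by rewrite normCK; ring.
Qed.

End pencils.

(** * Tonicity tested on matrix pencils *)

Section matrix_tone.
Variable R : realType.
Local Notation C := R[i].

Definition nsq (z : C) : R := complex.Re z ^+ 2 + complex.Im z ^+ 2.

Lemma nsqE (z : C) : (nsq z)%:C = `|z| ^+ 2.
Proof. exact: add_Re2_Im2. Qed.

Lemma nsq_ge0 z : 0 <= nsq z.
Proof. by rewrite addr_ge0 ?sqr_ge0. Qed.

Lemma nsq0 : nsq 0 = 0. Proof. by rewrite /nsq /= expr0n addr0. Qed.

Lemma nsq_real (r : R) : nsq r%:C = r ^+ 2.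
Proof. by rewrite /nsq /= [0 ^+ 2]expr0n addr0. Qed.

Lemma Re_nonneg (z : C) : 0 <= z -> (complex.Re z)%:C = z.
Proof. by move=> z0; apply/RRe_real/ger0_real. Qed.

Lemma Re_ge0 (z : C) : 0 <= z -> 0 <= complex.Re z.
Proof. by move=> z0; rewrite -ler0c Re_nonneg. Qed.

Definition sdec n (X U : 'M[C]_n) (d : 'I_n -> R) :=
  spec_dec X U (fun i => (d i)%:C).

Definition qf n (f : R -> R) (U : 'M[C]_n) (d : 'I_n -> R) (v : 'cV[C]_n) : R :=
  \sum_i f (d i) * nsq ((U *m v) i 0).

(* Operator [k]-tonicity on [I] tested on matrix pencils [A + t D]: the k-th
   divided difference of <f(A + t D) v, v> is nonnegative. For fixed data this
   is a linear inequality between finitely many values of [f]. *)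
Definition mtone k (f : R -> R) (I : set R) := forall n (A D : 'M[C]_n)
  (U : nat -> 'M[C]_n) (d : nat -> 'I_n -> R) (v : 'cV[C]_n) (t : nat -> R),
  psd D -> (forall i, (i < k)%N -> t i < t i.+1) ->
  (forall l, (l <= k)%N -> sdec (A + (t l)%:C *: D) (U l) (d l)) ->
  (forall l i, (l <= k)%N -> I (d l i)) ->
  0 <= dd k t (fun l => qf f (U l) (d l) v).

Lemma incr_lt k (t : nat -> R) : (forall i, (i < k)%N -> t i < t i.+1) ->
  forall i j, (i < j <= k)%N -> t i < t j.
Proof.
move=> tS i; elim=> [|j IH] // /andP[ij jk].
move: ij; rewrite ltnS leq_eqVlt => /orP[/eqP ->|ij]; first exact: tS.
by apply: lt_trans (IH _) (tS _ jk); rewrite ij ltnW.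
Qed.

Lemma incr_distinct k (t : nat -> R) : (forall i, (i < k)%N -> t i < t i.+1) ->
  distinct_upto k t.
Proof. by move=> tS i j ij; rewrite lt_eqF // (incr_lt tS). Qed.

Lemma eq_qf n f g (U : 'M[C]_n) d v : (forall i, f (d i) = g (d i)) ->
  qf f U d v = qf g U d v.
Proof. by move=> fg; apply: eq_bigr => i _; rewrite fg. Qed.

Lemma qfD n f g (U : 'M[C]_n) d v :
  qf (fun x => f x + g x) U d v = qf f U d v + qf g U d v.
Proof. by rewrite -big_split; apply: eq_bigr => i _; rewrite mulrDl. Qed.

Lemma qfZ n a f (U : 'M[C]_n) d v :
  qf (fun x => a * f x) U d v = a * qf f U d v.
Proof. by rewrite mulr_sumr; apply: eq_bigr => i _; rewrite mulrA. Qed.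

Lemma qf_sum (T : Type) (r : seq T) n (f : T -> R -> R) (U : 'M[C]_n) d v :
  qf (fun x => \sum_(j <- r) f j x) U d v = \sum_(j <- r) qf (f j) U d v.
Proof.
by rewrite exchange_big; apply: eq_bigr => i _; rewrite mulr_suml.
Qed.

Lemma qfE n f (U : 'M[C]_n) d v :
  (qf f U d v)%:C = (v^t* *m (U^t* *m dC (fun i => (f (d i))%:C) *m U) *m v) 0 0.
Proof.
rewrite spec_dec_quad rmorph_sum; apply: eq_bigr => i _.
by rewrite rmorphM /= nsqE.
Qed.

(** Expanding (A + t D)^j v in powers of t gives complex coefficients; the form is real, so their
    real parts give the same values. *)
Lemma qf_exp_poly n (A D : 'M[C]_n) (v : 'cV[C]_n) j :
  exists2 p : {poly R}, (size p <= j.+1)%N &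
  forall (t : R) U d, sdec (A + t%:C *: D) U d ->
    qf (fun x => x ^+ j) U d v = p.[t].
Proof.
have [V [V0 VE]] := mx_iter_poly A D v j.
exists (\poly_(i < j.+1) complex.Re ((v^t* *m V i) 0 0)); first exact: size_poly.
move=> t U d Xd.
have E : (qf (fun x => x ^+ j) U d v)%:C =
    \sum_(i < j.+1) (t ^+ i)%:C * (v^t* *m V i) 0 0.
  rewrite qfE -mulmxA (_ : dC _ = dC (fun i => (d i)%:C ^+ j)); last first.
    by congr dC; apply/funext => i; rewrite rmorphXn.
  rewrite -(spec_dec_iter _ _ Xd) VE mulmx_sumr summxE.
  by apply: eq_bigr => i _; rewrite -scalemxAr mxE rmorphXn.
rewrite -[LHS]/(complex.Re (qf (fun x => x ^+ j) U d v)%:C) E horner_poly.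
rewrite raddf_sum; apply: eq_bigr => i _.
by case: (_ 0 0) => a b /=; rewrite mul0r subr0 mulrC.
Qed.

Lemma qf_horner n (A D : 'M[C]_n) (v : 'cV[C]_n) (q : {poly R}) :
  exists2 p : {poly R}, (size p <= size q)%N &
  forall (t : R) U d, sdec (A + t%:C *: D) U d -> qf (horner q) U d v = p.[t].
Proof.
have H j : exists p : {poly R}, (size p <= j.+1)%N /\
  forall (t : R) U d, sdec (A + t%:C *: D) U d ->
    qf (fun x => x ^+ j) U d v = p.[t].
  by have [p] := qf_exp_poly A D v j; exists p.
have [P PE] := choice H.
exists (\sum_(j < size q) q`_j *: P j).
  apply: (big_ind (fun p : {poly R} => (size p <= size q)%N)).
  - by rewrite size_poly0.
  - move=> p1 p2 s1 s2; apply: leq_trans (size_polyD _ _) _.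
    by rewrite geq_max s1.
  move=> j _; apply: leq_trans (size_scale_leq _ _) _.
  by apply: leq_trans (PE j).1 _.
move=> t U d Xd; rewrite horner_sum.
transitivity (qf (fun x => \sum_(j < size q) q`_j * x ^+ j) U d v).
  by apply: eq_qf => i; rewrite horner_coef.
rewrite qf_sum; apply: eq_bigr => j _.
by rewrite qfZ ((PE j).2 t U d Xd) hornerZ.
Qed.

Section data.
Variables (k n : nat) (A D : 'M[C]_n) (U : nat -> 'M[C]_n)
  (d : nat -> 'I_n -> R) (v : 'cV[C]_n) (t : nat -> R).
Hypothesis Dp : psd D.
Hypothesis tN : distinct_upto k t.
Hypothesis Xd : forall l, (l <= k)%N -> sdec (A + (t l)%:C *: D) (U l) (d l).

(** Along the pencil the form of p is again a polynomial in t, of degree below k. *)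
Lemma dd_qf_poly (p : {poly R}) : (size p <= k)%N ->
  dd k t (fun l => qf (horner p) (U l) (d l) v) = 0.
Proof.
move=> sp; have [q sq qE] := qf_horner A D v p.
rewrite (@eq_dd _ k t t _ (fun l => q.[t l])) //; last first.
  by move=> l lk; rewrite (qE (t l)) //; exact: Xd.
rewrite dd_horner //; last by apply: leq_trans sq _; apply: leqW.
by rewrite nth_default //; apply: leq_trans sq _.
Qed.

(** By [pencil_resolvent] the form is a positive combination of inverses of positive affine
    functions of t with slopes b (1 - s_i), where 0 <= s_i <= 1. By [dd_inv] each of them
    contributes (-b)^k times a nonnegative number. *)
Lemma dd_qf_inv (a b : R) : (forall l i, (l <= k)%N -> 0 < a + b * d l i) ->
  exists2 z, 0 <= z &
  dd k t (fun l => qf (fun x => (a + b * x)^-1) (U l) (d l) v) = (- b) ^+ k * z.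
Proof.
move=> pos; pose X l : 'M[C]_n := a%:C%:M + b%:C *: (A + (t l)%:C *: D).
have XE l : (l <= k)%N -> spec_dec (X l) (U l) (fun i => (a + b * d l i)%:C).
  move=> lk; split; first exact: (Xd lk).1.
  rewrite /X (spec_dec_affine _ _ (Xd lk)); congr (_ *m dC _ *m _).
  by apply/funext => i; rewrite rmorphD rmorphM.
have Xp l : (l <= k)%N -> psd (X l).
  move=> lk; rewrite (XE l lk).2; apply: psd_congr; apply/psd_dC => i.
  by rewrite ler0c; exact/ltW/pos.
have Xi l : (l <= k)%N -> X l \in unitmx /\ X l *m ((U l)^t* *m
    dC (fun i => ((a + b * d l i)%:C)^-1) *m U l *m v) = v.
  move=> lk; apply: (spec_dec_inv _ (XE l lk)) => i.
  by apply/eqP => /complexI/eqP; rewrite gt_eqF // pos.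
have [s [w [s01 w0 sw]]] := pencil_resolvent v (Xp 0%N isT) Dp (Xi 0%N isT).1.
pose s' i := complex.Re (s i); pose w' i := complex.Re (w i).
have sE i : s i = (s' i)%:C by rewrite Re_nonneg //; case/andP: (s01 i).
have wE i : w i = (w' i)%:C by rewrite Re_nonneg.
pose c l i := s' i - t 0%N * (b * (1 - s' i)) + t l * (b * (1 - s' i)).
(* The pencil is re-based at node 0, where it is positive and invertible; its parameter becomes b
   (t_l - t_0). *)
have XX l : X l = X 0%N + (b * (t l - t 0%N))%:C *: D.
  rewrite /X -addrA; congr (_ + _); rewrite !scalerDr !scalerA.
  rewrite -addrA; congr (_ + _); rewrite -scalerDl; congr (_ *: _).
  by rewrite -!rmorphM -rmorphD; congr _%:C; ring.
have cE l i : s i + (b * (t l - t 0%N))%:C * (1 - s i) = (c l i)%:C.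
  rewrite sE -(rmorph1 (real_complex R)) -rmorphB -rmorphM -rmorphD.
  by congr _%:C; rewrite /c; ring.
have c_gt0 l i : (l <= k)%N -> 0 < c l i.
  move=> lk; have [] := sw (b * (t l - t 0%N))%:C.
  - by rewrite -XX; exact: Xp.
  - by rewrite -XX; exact: (Xi l lk).1.
  by move=> /(_ i); rewrite cE ltcR.
have qE l : (l <= k)%N -> qf (fun x => (a + b * x)^-1) (U l) (d l) v =
    \sum_i w' i * (c l i)^-1.
  move=> lk; have [] := sw (b * (t l - t 0%N))%:C.
  - by rewrite -XX; exact: Xp.
  - by rewrite -XX; exact: (Xi l lk).1.
  move=> _ /(_ ((U l)^t* *m dC (fun i => ((a + b * d l i)%:C)^-1) *m U l *m v)).
  rewrite -XX => /(_ (Xi l lk).2) E; apply: complexI.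
  rewrite qfE -mulmxA (_ : dC _ = dC (fun i => ((a + b * d l i)%:C)^-1)).
    rewrite E rmorph_sum; apply: eq_bigr => i _.
    by rewrite cE wE rmorphM fmorphV.
  by congr dC; apply/funext => i; rewrite fmorphV.
exists (\sum_i w' i * ((1 - s' i) ^+ k / \prod_(l < k.+1) c l i)).
  apply: sumr_ge0 => i _; rewrite mulr_ge0 ?Re_ge0 // divr_ge0 //.
    rewrite exprn_ge0 // subr_ge0 -lecR -sE; by case/andP: (s01 i).
  by apply: prodr_ge0 => l _; apply/ltW/c_gt0; rewrite -ltnS.
rewrite (eq_dd (fun _ _ => erefl) qE) dd_sum mulr_sumr; apply: eq_bigr => i _.
rewrite ddZ mulrCA; congr (_ * _); rewrite mulrA.
rewrite (dd_inv tN); last by move=> l lk; rewrite gt_eqF // (c_gt0 l i).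
by rewrite -mulNr exprMn.
Qed.

End data.
End matrix_tone.

(** * Integral representations on finite sets of points *)

Section kernels.
Variable C : numClosedFieldType.

Lemma psd1 n : psd (1%:M : 'M[C]_n).
Proof. by rewrite -dC1; apply/psd_dC => i; exact: ler01. Qed.

(** Diagonalize S and T simultaneously and let L_j = a_j s + b_j (1 - s), a positive diagonal. The
    hypothesis says that the adjoint of W sends L_j W e_j to r for every j. These vectors turn out
    to be one vector z, so W e_i = z / L_i, and r_i is the inner product of z with W e_i. *)
Lemma kernel_representation n (S T : 'M[C]_n) (a b r : 'I_n -> C) :
  psd S -> psd T -> (forall j, 0 < a j) -> (forall j, 0 < b j) ->
  (forall i j, a j * S i j + b j * T i j = r i) ->
  exists s z : 'I_n -> C, (forall m, 0 <= s m <= 1) /\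
    forall i, r i = \sum_m `|z m| ^+ 2 / (a i * s m + b i * (1 - s m)).
Proof.
case: n S T a b r => [|n] S T a b r Sp Tp a0 b0 rE.
  by exists (fun=> 0), (fun=> 0); split; case.
have [W [Y [s [SE TE WY s01]]]] := simultaneous_diag Sp Tp.
pose L j m := a j * s m + b j * (1 - s m).
have L0 j m : 0 < L j m.
  have [s0 s1] := andP (s01 m); rewrite -subr_ge0 in s1.
  move: s0; rewrite le_eqVlt => /orP[/eqP s0|s0].
    by rewrite /L -s0 mulr0 add0r subr0 mulr1.
  by rewrite /L ltr_wpDr ?mulr_gt0 // mulr_ge0 // ltW.
pose zz j := dC (L j) *m W *m (delta_mx j 0 : 'cV[C]_n.+1).
have WzE j i : (W^t* *m zz j) i 0 = r i.
  rewrite /zz !mulmxA -colE mxE.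
  have -> : dC (L j) = a j *: dC s + b j *: dC (fun m => 1 - s m).
    by rewrite !dCZ dCD.
  rewrite mulmxDr mulmxDl -!scalemxAr -!scalemxAl -SE -TE.
  by rewrite mxE [X in X + _]mxE [X in _ + X]mxE rE.
have zzW j : exists y, zz j = W *m y.
  exists ((a j *: Y + b j *: (1%:M - Y)) *m delta_mx j 0).
  rewrite /zz mulmxA; congr (_ *m _).
  have -> : dC (L j) = a j *: dC s + b j *: (1%:M - dC s).
    by rewrite -dC1 dCN dCD !dCZ dCD.
  rewrite mulmxDl mulmxDr -!scalemxAl -!scalemxAr mulmxBl mulmxBr.
  by rewrite mul1mx mulmx1 WY.
have zz0 j : zz j = zz 0.
  have [y1 y1E] := zzW j; have [y2 y2E] := zzW 0.
  (* The difference lies in the range of W and in the kernel of the adjoint of W, so its norm is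
     0. *)
  apply/eqP; rewrite -subr_eq0; apply/eqP; set u := zz j - zz 0.
  rewrite -[u]mul1mx; apply: psd_null; first exact: psd1.
  have uE : u = W *m (y1 - y2) by rewrite mulmxBr -y1E -y2E.
  have Wu : W^t* *m u = 0.
    apply/matrixP => i l; rewrite ord1 mulmxBr.
    have -> (M N : 'cV[C]_n.+1) : (M - N) i 0 = M i 0 - N i 0 by rewrite !mxE.
    by rewrite !WzE subrr mxE.
  by rewrite mulmx1 {1}uE adjM -mulmxA Wu mulmx0 mxE.
exists s, (fun m => zz 0 m 0); split=> // i.
rewrite -(WzE i i) mxE; apply: eq_bigr => m _.
have zE : zz i m 0 = L i m * W m i.
  by rewrite /zz -mulmxA dC_mull -colE mxE.
have LL : Num.conj (L i m) = L i m by apply: CrealP; exact/ger0_real/ltW.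
rewrite -(zz0 i) zE !mxE normCK rmorphM /= LL -/(L i m).
by have := L0 i m; move: (L i m) => x x0; field; rewrite gt_eqF.
Qed.
End kernels.

(** * Tonicity of functions given by the representation *)

Section representation.
Variable R : realType.
Local Notation C := R[i].

Lemma real_kernel_representation n (S T : 'I_n -> 'I_n -> R) (a b r : 'I_n -> R) :
  psd (\matrix_(i, j) (S i j)%:C : 'M[C]_n) ->
  psd (\matrix_(i, j) (T i j)%:C : 'M[C]_n) ->
  (forall j, 0 < a j) -> (forall j, 0 < b j) ->
  (forall i j, a j * S i j + b j * T i j = r i) ->
  exists s mu : 'I_n -> R, [/\ forall m, 0 <= s m <= 1, forall m, 0 <= mu m &
    forall i, r i = \sum_m mu m / (a i * s m + b i * (1 - s m))].
Proof.
move=> Sp Tp a0 b0 rE.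
have [|||s [z [s01 zE]]] := @kernel_representation _ n _ _ (fun j => (a j)%:C)
    (fun j => (b j)%:C) (fun j => (r j)%:C) Sp Tp.
- by move=> j; rewrite ltcR.
- by move=> j; rewrite ltcR.
- by move=> i j; rewrite !mxE -!rmorphM -rmorphD rE.
have sE m : s m = (complex.Re (s m))%:C.
  by rewrite Re_nonneg //; case/andP: (s01 m).
exists (fun m => complex.Re (s m)), (fun m => nsq (z m)); split.
- by move=> m; rewrite -!lecR -sE.
- by move=> m; exact: nsq_ge0.
move=> i; apply: complexI; rewrite zE rmorph_sum; apply: eq_bigr => m _.
rewrite -nsqE {1 2}sE -(rmorph1 (real_complex R)) -rmorphB -!rmorphM -rmorphD.
by rewrite -fmorphV -rmorphM.
Qed.

Definition nodal k (s : nat -> R) : {poly R} := \prod_(i < k) ('X - (s i)%:P).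

Lemma nodalE k s x : (nodal k s).[x] = \prod_(i < k) (x - s i).
Proof. by rewrite horner_prod; apply: eq_bigr => i _; rewrite hornerXsubC. Qed.

Lemma size_nodal k s : size (nodal k s) = k.+1.
Proof.
rewrite /nodal -(big_mkord xpredT (fun i => 'X - (s i)%:P)).
by rewrite size_prod_XsubC size_iota subn0.
Qed.

Section data.
Variables (k n : nat) (A D : 'M[C]_n) (U : nat -> 'M[C]_n)
  (d : nat -> 'I_n -> R) (v : 'cV[C]_n) (t : nat -> R).
Hypothesis Dp : psd D.
Hypothesis tN : distinct_upto k.+2 t.
Hypothesis Xd : forall l, (l <= k.+2)%N -> sdec (A + (t l)%:C *: D) (U l) (d l).

(** With y = -a/b, the function is a polynomial of degree below k plus nodal(y) / (a + b x). The
    factor (-b)^-k in nodal(y) meets (-b)^(k+2) from [dd_qf_inv], and b^2 remains. *)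
Lemma dd_qf_nodal_inv (s : nat -> R) (a b : R) :
  (forall i, (i < k)%N -> 0 < a + b * s i) ->
  (forall l i, (l <= k.+2)%N -> 0 < a + b * d l i) ->
  0 <= dd k.+2 t (fun l => qf (fun x => (nodal k s).[x] / (a + b * x)) (U l) (d l) v).
Proof.
move=> s0 d0; have [b0|b0] := eqVneq b 0.
  rewrite (@eq_dd _ _ t t _ (fun l => qf (horner (a^-1 *: nodal k s)) (U l) (d l) v)) //.
    rewrite (dd_qf_poly v tN Xd) //.
    by apply: leq_trans (size_scale_leq _ _) _; rewrite size_nodal.
  by move=> l _; apply: eq_qf => i; rewrite hornerZ b0 mul0r addr0 mulrC.
pose y := - a / b; pose q := nodal k s %/ ('X - y%:P).
have wE : nodal k s = q * ('X - y%:P) + ((nodal k s).[y])%:P.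
  by rewrite {1}(divp_eq (nodal k s) ('X - y%:P)) modp_XsubC.
have yE : (nodal k s).[y] = (- b) ^- k * \prod_(i < k) (a + b * s i).
  rewrite nodalE -exprVn -[X in _ ^+ X](card_ord k) -prodr_const -big_split /=.
  by apply: eq_bigr => i _; rewrite /y; field.
have [z z0 zE] := dd_qf_inv v Dp tN Xd d0.
rewrite (@eq_dd _ _ t t _ (fun l => qf (horner (b^-1 *: q)) (U l) (d l) v +
   (nodal k s).[y] * qf (fun x => (a + b * x)^-1) (U l) (d l) v)) //; last first.
  move=> l lk; rewrite -qfZ -qfD; apply: eq_qf => i.
  have := d0 l i lk; rewrite hornerZ {1}wE !hornerE => dl.
  rewrite mulrDl; congr (_ + _); rewrite /y; field.
  by rewrite ?b0 ?gt_eqF // ?b0.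
rewrite ddD ddZ zE (dd_qf_poly v tN Xd) ?add0r; last first.
  apply: leq_trans (size_scale_leq _ _) _.
  by rewrite size_divp ?polyXsubC_eq0 // size_nodal size_XsubC leq_subLR; lia.
rewrite yE mulrA; apply: mulr_ge0 => //.
rewrite mulrAC; apply: mulr_ge0; last first.
  by apply: prodr_ge0 => i _; exact/ltW/s0.
rewrite -addn2 exprD mulrA mulVf ?mul1r ?sqr_ge0 //.
by rewrite expf_neq0 // oppr_eq0.
Qed.

Lemma representation_tone (f : R -> R) (p : {poly R}) (s : nat -> R) (r : nat)
    (mu a b : 'I_r -> R) :
  (size p <= k)%N -> (forall m, 0 <= mu m) ->
  (forall m i, (i < k)%N -> 0 < a m + b m * s i) ->
  (forall m l i, (l <= k.+2)%N -> 0 < a m + b m * d l i) ->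
  (forall l i, (l <= k.+2)%N -> f (d l i) = p.[d l i] +
     (nodal k s).[d l i] * \sum_m mu m / (a m + b m * d l i)) ->
  0 <= dd k.+2 t (fun l => qf f (U l) (d l) v).
Proof.
move=> sp mu0 s0 d0 fE.
rewrite (@eq_dd _ _ t t _ (fun l => qf (horner p) (U l) (d l) v +
   \sum_m mu m * qf (fun x => (nodal k s).[x] / (a m + b m * x)) (U l) (d l) v)) //;
  last first.
  move=> l lk; under eq_bigr do rewrite -qfZ.
  rewrite -qf_sum -qfD; apply: eq_qf => i; rewrite fE // mulr_sumr.
  by congr (_ + _); apply: eq_bigr => m _; rewrite mulrCA.
rewrite ddD (dd_qf_poly v tN Xd) ?add0r; last by lia.
rewrite dd_sum; apply: sumr_ge0 => m _; rewrite ddZ mulr_ge0 //.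
by apply: dd_qf_nodal_inv => [i ik|l i lk]; [exact: s0|exact: d0].
Qed.
End data.
End representation.

(** * Rank-one perturbations *)

Section rank_one.
Variable R : realType.
Local Notation C := R[i].

Lemma conj_conjc (z : C) : Num.conj z = conjc z.
Proof.
have [->|z0] := eqVneq z 0; first by rewrite rmorph0 conjc0.
by apply: (mulfI z0); rewrite -normCK sqr_normc.
Qed.

Lemma Re_mul_real (a : R) (z : C) : complex.Re (a%:C * z) = a * complex.Re z.
Proof. by case: z => x y /=; rewrite mul0r subr0. Qed.

Lemma Im_mul_real (a : R) (z : C) : complex.Im (a%:C * z) = a * complex.Im z.
Proof. by case: z => x y /=; rewrite mul0r addr0. Qed.

Lemma Re_mul_conj (z w : C) : complex.Re (z * Num.conj w) =
  complex.Re z * complex.Re w + complex.Im z * complex.Im w.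
Proof. by rewrite conj_conjc; case: z w => a b [c e] /=; ring. Qed.

Lemma sdec_ex n (X : 'M[C]_n) : X^t* = X -> exists U d, sdec X U d.
Proof.
move=> /hermitian_spectral [U [d [Uu XE dr]]].
exists U, (fun i => complex.Re (d i)); split => //; rewrite XE.
by congr (_ *m dC _ *m _); apply/funext => i; rewrite RRe_real.
Qed.

Lemma sdec_exf (T : Type) n (X : T -> 'M[C]_n) : (forall x, (X x)^t* = X x) ->
  exists U d, forall x, sdec (X x) (U x) (d x).
Proof.
move=> Xh; have H x : exists Ud : 'M[C]_n * ('I_n -> R), sdec (X x) Ud.1 Ud.2.
  by have [U [d Ud]] := sdec_ex (Xh x); exists (U, d).
have [Ud UdE] := choice H.
by exists (fun x => (Ud x).1), (fun x => (Ud x).2).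
Qed.

Definition rcol n (v : 'I_n -> R) : 'cV[C]_n := \col_i (v i)%:C.

Definition outer n (v : 'I_n -> R) : 'M[C]_n := \matrix_(i, j) (v i * v j)%:C.

Lemma outer_psd n (v : 'I_n -> R) : psd (outer v).
Proof.
have -> : outer v = (\row_i (v i)%:C)^t* *m 1%:M *m (\row_i (v i)%:C).
  apply/matrixP => i j; rewrite mulmx1 !mxE big_ord1 !mxE rmorphM.
  by congr (_ * _); rewrite (CrealP _) // complex_real.
by apply: psd_congr; rewrite -dC1; apply/psd_dC => i; exact: ler01.
Qed.

Section fixed.
Variables (n : nat) (x v : 'I_n -> R) (tau : R) (X U : 'M[C]_n) (d : 'I_n -> R).
Hypothesis XE : forall i j, X i j = (x i *+ (i == j) + tau * (v i * v j))%:C.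
Hypothesis Xd : sdec X U d.

(** Entry (i, l) of the real part of the spectral projection on the j-th eigenvector. *)
Let P j i l : R := complex.Re (U j i) * complex.Re (U j l) +
  complex.Im (U j i) * complex.Im (U j l).
Let s j : C := (U *m rcol v) j 0.

(** Entry (j, i) of U X = diag(d) U: the rank-one term sees row j of U only through [s j]. *)
Lemma spec_eq j i : (d j - x i)%:C * U j i = (tau * v i)%:C * s j.
Proof.
have [Uu XE'] := Xd.
have : (U *m X) j i = (dC (fun i => (d i)%:C) *m U) j i.
  by rewrite XE' !mulmxA unitary_Kt // mul1mx.
rewrite dC_mull mxE.
have -> : \sum_m U j m * X m i =
    \sum_m (U j m * (x m *+ (m == i))%:C + (tau * v i)%:C * (U j m * (v m)%:C)).
  apply: eq_bigr => m _; rewrite XE rmorphD mulrDr; congr (_ + _).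
  by rewrite !rmorphM /=; ring.
rewrite big_split /= -mulr_sumr (bigD1 i) //= eqxx mulr1n big1 ?addr0; last first.
  by move=> m /negPf ->; rewrite mulr0n mulr0.
have -> : \sum_m U j m * (v m)%:C = s j.
  by rewrite /s mxE; apply: eq_bigr => m _; rewrite mxE.
by move=> E; rewrite rmorphB /= mulrBl -E; ring.
Qed.

Lemma sum_P i l : \sum_j P j i l = (i == l)%:R.
Proof.
have [Uu _] := Xd; have := unitary_tK Uu => /matrixP/(_ l i).
rewrite !mxE => /(congr1 (@complex.Re R)); rewrite raddf_sum => E.
have -> : (i == l)%:R = complex.Re ((l == i)%:R : C) by rewrite eq_sym; case: eqP.
by rewrite -E; apply: eq_bigr => j _; rewrite !mxE /= mulrC Re_mul_conj.
Qed.

Lemma sum_dP i l : \sum_j d j * P j i l = x i *+ (i == l) + tau * (v i * v l).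
Proof.
have [Uu XE'] := Xd; have := XE l i.
rewrite XE' -mulmxA mxE => /(congr1 (@complex.Re R)) /=.
rewrite raddf_sum eq_sym [v l * _]mulrC => E.
have -> : x i *+ (i == l) = x l *+ (i == l) by case: eqP => [->|].
rewrite -E; apply: eq_bigr => j _; rewrite dC_mull !mxE /= mulrCA Re_mul_real.
by rewrite [_ * U j i]mulrC Re_mul_conj.
Qed.

Lemma P_spec j i l :
  (d j - x i) * (d j - x l) * P j i l = tau ^+ 2 * (v i * v l) * nsq (s j).
Proof.
have Re_eq m : (d j - x m) * complex.Re (U j m) = tau * v m * complex.Re (s j).
  by rewrite -!Re_mul_real spec_eq.
have Im_eq m : (d j - x m) * complex.Im (U j m) = tau * v m * complex.Im (s j).
  by rewrite -!Im_mul_real spec_eq.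
rewrite /P mulrDr mulrACA Re_eq Re_eq [X in _ + X]mulrACA Im_eq Im_eq /nsq.
by ring.
Qed.

Lemma nsq_rcol (y : 'I_n -> R) j :
  nsq ((U *m rcol y) j 0) = \sum_i \sum_l y i * y l * P j i l.
Proof.
rewrite /nsq mxE !raddf_sum /= !expr2 !mulr_suml -big_split /=.
apply: eq_bigr => i _; rewrite !mulr_sumr -big_split /=.
apply: eq_bigr => l _; rewrite !mxE ![U _ _ * _]mulrC !Re_mul_real !Im_mul_real.
by rewrite /P; ring.
Qed.

Lemma qf_cst_rcol (y : 'I_n -> R) : \sum_j nsq ((U *m rcol y) j 0) = \sum_i y i ^+ 2.
Proof.
under eq_bigr do rewrite nsq_rcol.
rewrite exchange_big /=; apply: eq_bigr => i _.
rewrite exchange_big /= (bigD1 i) //= -mulr_sumr sum_P eqxx mulr1 -expr2.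
rewrite big1 ?addr0 // => l /negPf li.
by rewrite -mulr_sumr sum_P eq_sym li mulr0.
Qed.

(** Both sides are |(X - c) v|^2, the second moment about c of the spectral measure of v; it feeds
    the Chebyshev estimate below. *)
Lemma qf_sqr_rcol (c : R) :
  qf (fun y => (y - c) ^+ 2) U d (rcol v) =
  \sum_i (tau * (\sum_m v m ^+ 2) * v i + (x i - c) * v i) ^+ 2.
Proof.
set S := \sum_m v m ^+ 2.
rewrite -(qf_cst_rcol (fun i => tau * S * v i + (x i - c) * v i)).
apply: eq_bigr => j _.
suff -> : (U *m rcol (fun i => tau * S * v i + (x i - c) * v i)) j 0 =
    (d j - c)%:C * s j.
  by rewrite /nsq Re_mul_real Im_mul_real -/(s j); ring.
have dE : (d j - c)%:C * s j = \sum_i ((d j - x i)%:C * U j i) * (v i)%:C +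
    \sum_i U j i * ((x i - c) * v i)%:C.
  rewrite -big_split /s mxE mulr_sumr; apply: eq_bigr => i _ /=.
  by rewrite mxE rmorphM !rmorphB /=; ring.
rewrite dE; under [X in _ = X + _]eq_bigr do rewrite spec_eq.
rewrite -[X in _ = X + _](_ : \sum_i U j i * (tau * S * v i)%:C = _).
  rewrite -big_split mxE; apply: eq_bigr => i _ /=.
  by rewrite mxE -mulrDr -rmorphD.
transitivity ((tau * S)%:C * s j).
  rewrite /s mxE mulr_sumr; apply: eq_bigr => i _.
  by rewrite mxE mulrCA; congr (_ * _); rewrite -rmorphM.
rewrite [in LHS]rmorphM /= /S rmorph_sum mulr_sumr mulr_suml; apply: eq_bigr => i _ /=.
by rewrite !rmorphM /=; ring.
Qed.

(** The Rayleigh quotient of the normalized j-th eigenvector, from which the eigenvalues are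
    located. *)
Lemma eigenvalue_rcol j : d j = \sum_i x i * nsq (U j i) + tau * nsq (s j) /\
  \sum_i nsq (U j i) = 1.
Proof.
have [Uu _] := Xd; have := unitary_Kt Uu => /matrixP/(_ j j).
rewrite !mxE eqxx => /(congr1 (@complex.Re R)); rewrite raddf_sum /= => E.
have {}E : \sum_i nsq (U j i) = 1.
  rewrite -E; apply: eq_bigr => i _.
  by rewrite !mxE Re_mul_conj /nsq !expr2.
split=> //; rewrite -[LHS]mulr1 -[X in d j * X]E mulr_sumr.
apply/eqP; rewrite addrC -subr_eq -sumrB; apply/eqP.
transitivity (\sum_i complex.Re (((d j - x i)%:C * U j i) * Num.conj (U j i))).
  apply: eq_bigr => i _; rewrite -mulrA Re_mul_real Re_mul_conj -mulrBl /nsq.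
  by rewrite !expr2.
under eq_bigr do rewrite spec_eq -mulrA Re_mul_real Re_mul_conj.
have Rs : complex.Re (s j) = \sum_i complex.Re (U j i) * v i.
  rewrite /s mxE raddf_sum; apply: eq_bigr => i _ /=.
  by rewrite mxE [LHS]/= mulrC Re_mul_real mulrC.
have Is : complex.Im (s j) = \sum_i complex.Im (U j i) * v i.
  rewrite /s mxE raddf_sum; apply: eq_bigr => i _ /=.
  by rewrite mxE [LHS]/= mulrC Im_mul_real mulrC.
rewrite /nsq !expr2 {3}Rs {3}Is !mulr_sumr -big_split mulr_sumr.
by apply: eq_bigr => i _ /=; ring.
Qed.

(* The rank-one identity: rows of [f(X) - f(x i)] are computed by factoring
   [y - x i] out of [f] twice. *)
Lemma qf_rank_one (f : R -> R) (F : 'I_n -> 'I_n -> R) (G : 'I_n -> 'I_n -> R -> R)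
    (y : 'I_n -> R) :
  (forall i l j, y i != 0 -> y l != 0 -> f (d j) = f (x i) + (d j - x i) * F i l +
     (d j - x i) * (d j - x l) * G i l (d j)) ->
  qf f U d (rcol y) = \sum_i y i ^+ 2 * f (x i) +
    \sum_i \sum_l y i * v i * (y l * v l) *
      (tau * F i l + tau ^+ 2 * qf (G i l) U d (rcol v)).
Proof.
move=> fE; rewrite /qf.
under eq_bigr do rewrite nsq_rcol mulr_sumr.
rewrite exchange_big -big_split /=; apply: eq_bigr => i _.
under eq_bigr do rewrite mulr_sumr.
rewrite exchange_big /=.
have -> : y i ^+ 2 * f (x i) = \sum_l y i * y l * f (x i) * (i == l)%:R.
  rewrite (bigD1 i) //= eqxx mulr1 expr2 big1 ?addr0 // => l /negPf li.
  by rewrite eq_sym li mulr0.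
rewrite -big_split /=; apply: eq_bigr => l _.
have [yi|yi] := eqVneq (y i) 0.
  by rewrite yi !mul0r add0r big1 // => j _; rewrite !mul0r mulr0.
have [yl|yl] := eqVneq (y l) 0.
  by rewrite yl !mul0r !mulr0 !mul0r add0r big1 // => j _; rewrite ?mulr0 ?mul0r ?mulr0.
transitivity (\sum_j (y i * y l * (f (x i) - x i * F i l) * P j i l +
   y i * y l * F i l * (d j * P j i l) +
   y i * y l * (G i l (d j) * (tau ^+ 2 * (v i * v l) * nsq (s j))))).
  by apply: eq_bigr => j _; rewrite (fE i l j yi yl) -P_spec; ring.
rewrite !big_split /= -!mulr_sumr sum_P sum_dP.
have -> : \sum_j G i l (d j) * (tau ^+ 2 * (v i * v l) * nsq (s j)) =
    tau ^+ 2 * (v i * v l) * \sum_j G i l (d j) * nsq (s j).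
  by rewrite mulr_sumr; apply: eq_bigr => j _; rewrite mulrCA.
rewrite -/(s _); set q := \sum_j _.
by case: eqP => [<-|_]; rewrite ?mulr1n ?mulr0n ?mulr1 ?mulr0; ring.
Qed.

End fixed.
End rank_one.

(** * Small couplings: eigenvalues and spectral measures *)

Section limit.
Variable R : realType.
Local Notation C := R[i].

Lemma dd_bound k (t : nat -> R) : exists2 K, 0 <= K &
  forall (g : nat -> R) eta, (forall l, (l <= k)%N -> `|g l| <= eta) ->
  `|dd k t g| <= K * eta.
Proof.
elim: k t => [|k IH] t.
  by exists 1 => // g eta H; rewrite mul1r /=; exact: H.
have [K1 K10 H1] := IH t; have [K2 K20 H2] := IH (shift t).
exists (`|(t 0%N - t k.+1)^-1| * (K1 + K2)).
  by rewrite mulr_ge0 // addr_ge0.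
move=> g eta H; rewrite ddS normrM -mulrA ler_wpM2l //.
apply: le_trans (ler_normB _ _) _; rewrite mulrDl lerD //.
  by apply: H1 => l lk; apply: H; lia.
by apply: H2 => l lk; apply: H.
Qed.

Lemma nsq_le_norm (z : C) (b : R) : `|z| <= b%:C ->
  `|complex.Re z| <= b /\ `|complex.Im z| <= b.
Proof.
move=> zb; have b0 : 0 <= b by rewrite -ler0c; apply: le_trans zb.
have zb2 : nsq z <= b ^+ 2.
  by rewrite -lecR nsqE rmorphXn /= ler_pXn2r // nnegrE ler0c.
split; rewrite -(@ler_pXn2r _ 2) ?nnegrE // real_normK ?num_real //;
  apply: le_trans zb2; rewrite /nsq ?lerDl ?lerDr; exact: sqr_ge0.
Qed.

Definition ext0 n (T : Type) (a0 : T) (a : 'I_n -> T) (i : 'I_n.+1) : T :=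
  if unlift ord0 i is Some j then a j else a0.

Lemma ext0_0 n (T : Type) (a0 : T) (a : 'I_n -> T) : ext0 a0 a ord0 = a0.
Proof. by rewrite /ext0 unlift_none. Qed.

Lemma ext0_S n (T : Type) (a0 : T) (a : 'I_n -> T) i : ext0 a0 a (lift ord0 i) = a i.
Proof. by rewrite /ext0 liftK. Qed.

Section fixed.
Variables (n : nat) (x : 'I_n -> R) (c tau e : R) (X U : 'M[C]_n.+1)
  (d : 'I_n.+1 -> R).
Let xx := ext0 c x.
Let vv := ext0 1 (fun=> e) : 'I_n.+1 -> R.
Hypothesis XE : forall i j, X i j = (xx i *+ (i == j) + tau * (vv i * vv j))%:C.
Hypothesis Xd : sdec X U d.
Hypothesis e01 : 0 < e <= 1.

(** At e = 0 the matrix would be diagonal with entries c + tau and x_i. The Rayleigh quotient is a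
    convex combination of these up to tau q, where q = O(e) is what the coordinates of size e add to
    the squared modulus of the j-th component of U v. *)
Lemma eigenvalue_location lo hi j :
  (forall i, lo <= x i <= hi) -> lo <= c + tau <= hi ->
  lo - `|tau| * (e * (4 * n%:R + 2 * n%:R ^+ 2)) <= d j <=
  hi + `|tau| * (e * (4 * n%:R + 2 * n%:R ^+ 2)).
Proof.
move=> xb tb; have [dE U1] := eigenvalue_rcol XE Xd j.
have sE : (U *m rcol vv) j 0 = U j ord0 + e%:C * \sum_(i < n) U j (lift ord0 i).
  rewrite mxE big_ord_recl; congr (_ + _).
    by rewrite mxE /vv ext0_0 mulr1.
  rewrite mulr_sumr; apply: eq_bigr => i _.
  by rewrite mxE /vv ext0_S mulrC.
rewrite sE big_ord_recl /xx ext0_0 in dE.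
set a := U j ord0 in dE *; set b := \sum_(i < n) U j _ in dE.
have Ule i : nsq (U j i) <= 1.
  rewrite -U1 (bigD1 i) //= lerDl; apply: sumr_ge0 => l _; exact: nsq_ge0.
have Un i : `|U j i| <= 1%:C.
  rewrite -(@ler_pXn2r _ 2) ?nnegrE // -nsqE expr1n lecR; exact: Ule.
have [a1 a2] := nsq_le_norm (Un ord0).
have [b1 b2] : `|complex.Re b| <= n%:R /\ `|complex.Im b| <= n%:R.
  apply: nsq_le_norm; apply: le_trans (ler_norm_sum _ _ _) _.
  apply: le_trans (_ : \sum_(i < n) (1%:C : C) <= _).
    by apply: ler_sum => i _; exact: Un.
  by rewrite sumr_const card_ord rmorph_nat.
pose q := nsq (a + e%:C * b) - nsq a.
have qE : q = e * (2 * (complex.Re a * complex.Re b + complex.Im a * complex.Im b)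
    + e * nsq b).
  rewrite /q /nsq; move: a b {dE sE a1 a2 b1 b2 q} => [a1 a2] [b1 b2] /=; ring.
have n0 : 0 <= n%:R :> R by exact: ler0n.
have qb : `|q| <= e * (4 * n%:R + 2 * n%:R ^+ 2).
  have [e0 e1] := andP e01.
  rewrite qE normrM (gtr0_norm e0) ler_wpM2l ?(ltW e0) //.
  apply: le_trans (ler_normD _ _) _; apply: lerD.
    rewrite normrM ger0_norm // -[4]/((2 * 2)%:R) natrM -mulrA ler_wpM2l //.
    apply: le_trans (ler_normD _ _) _; rewrite !normrM mulr_natl mulr2n.
    by apply: lerD; rewrite -[leRHS]mul1r; apply: ler_pM.
  rewrite normrM (gtr0_norm e0) -[leRHS]mul1r ler_pM ?(ltW e0) //.
  rewrite ger0_norm ?nsq_ge0 // /nsq mulr_natl mulr2n.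
  rewrite -(real_normK (num_real (complex.Re b))) -(real_normK (num_real (complex.Im b))).
  by apply: lerD; rewrite ler_pXn2r ?nnegrE.
have {}dE : d j = (c + tau) * nsq a +
    \sum_(i < n) x i * nsq (U j (lift ord0 i)) + tau * q.
  rewrite dE /q; under eq_bigr do rewrite ext0_S.
  by ring.
have U1' : nsq a + \sum_(i < n) nsq (U j (lift ord0 i)) = 1.
  by rewrite -U1 big_ord_recl.
have tq : `|tau * q| <= `|tau| * (e * (4 * n%:R + 2 * n%:R ^+ 2)).
  by rewrite normrM ler_wpM2l.
have cl : lo <= (c + tau) * nsq a + \sum_(i < n) x i * nsq (U j (lift ord0 i)).
  rewrite -[lo]mulr1 -U1' mulrDr mulr_sumr; apply: lerD.
    by rewrite ler_wpM2r ?nsq_ge0 //; case/andP: tb.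
  by apply: ler_sum => i _; rewrite ler_wpM2r ?nsq_ge0 //; case/andP: (xb i).
have ch : (c + tau) * nsq a + \sum_(i < n) x i * nsq (U j (lift ord0 i)) <= hi.
  rewrite -[hi]mulr1 -U1' [hi * _]mulrDr mulr_sumr; apply: lerD.
    by rewrite ler_wpM2r ?nsq_ge0 //; case/andP: tb.
  by apply: ler_sum => i _; rewrite ler_wpM2r ?nsq_ge0 //; case/andP: (xb i).
move: tq; rewrite ler_norml => /andP[tq1 tq2]; rewrite dE.
by apply/andP; split; lra.
Qed.

(* Chebyshev: the spectral measure of [rcol vv] concentrates at [c + tau]. *)
Lemma qf_concentration (g : R -> R) (eta delta B : R) :
  0 <= eta -> 0 < delta -> (forall j, `|g (d j)| <= B) -> `|g (c + tau)| <= B ->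
  (forall y, `|y - (c + tau)| < delta -> `|g y - g (c + tau)| <= eta) ->
  `|qf g U d (rcol vv) - g (c + tau)| <= eta * (1 + n%:R) + e *
     (2 * B / delta ^+ 2 * ((tau * n%:R) ^+ 2 +
        \sum_i (`|tau| * (1 + n%:R) + `|x i - (c + tau)|) ^+ 2) + B * n%:R).
Proof.
move=> eta0 delta0 gB gB0 gc; have [e0 e1] := andP e01.
have B0 : 0 <= B by apply: le_trans gB0.
have n0 : 0 <= n%:R :> R by exact: ler0n.
set t := c + tau.
have mass : \sum_j nsq ((U *m rcol vv) j 0) = 1 + n%:R * e ^+ 2.
  rewrite (qf_cst_rcol Xd) big_ord_recl /vv ext0_0 expr1n; congr (_ + _).
  under eq_bigr do rewrite ext0_S.
  by rewrite sumr_const card_ord mulr_natl.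
have v2 : \sum_m vv m ^+ 2 = 1 + n%:R * e ^+ 2 by rewrite -mass (qf_cst_rcol Xd).
have ee : e ^+ 2 <= e by rewrite expr2 ler_piMr // ltW.
have e2 : 0 <= e ^+ 2 by exact: sqr_ge0.
have e21 : e ^+ 2 <= 1 by exact: le_trans ee e1.
pose K := (tau * n%:R) ^+ 2 + \sum_i (`|tau| * (1 + n%:R) + `|x i - t|) ^+ 2.
(* The first coordinate of (X - t) v is of order e^2 and the others are of order e, so the second
   moment is O(e). *)
have second : qf (fun y => (y - t) ^+ 2) U d (rcol vv) <= e * K.
  rewrite (qf_sqr_rcol XE Xd) v2 big_ord_recl /K [e * _]mulrDr; apply: lerD.
    rewrite /xx /vv !ext0_0 !mulr1.
    have -> : tau * (1 + n%:R * e ^+ 2) + (c - t) = tau * n%:R * e ^+ 2.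
      by rewrite /t; ring.
    rewrite [_ * e ^+ 2]mulrC exprMn ler_wpM2r ?sqr_ge0 //.
    by apply: le_trans (_ : e ^+ 2 <= _) => //; rewrite [leLHS]expr2 ler_piMr.
  rewrite mulr_sumr; apply: ler_sum => i _; rewrite /xx /vv !ext0_S.
  rewrite -mulrDl exprMn mulrC.
  apply: le_trans (ler_wpM2r (sqr_ge0 _) ee) _; rewrite ler_wpM2l ?(ltW e0) //.
  rewrite -[leLHS](real_normK (num_real _)) ler_pXn2r ?nnegrE //.
  apply: le_trans (ler_normD _ _) _; rewrite lerD2r normrM ler_wpM2l //.
  rewrite ger0_norm; last by rewrite addr_ge0 // mulr_ge0.
  by rewrite lerD2l ler_piMr.
(* Near t this is the continuity of g; at distance at least delta the quadratic term already exceeds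
   2 B. *)
have gy j : `|g (d j) - g t| <= eta + 2 * B / delta ^+ 2 * (d j - t) ^+ 2.
  have d2 : 0 < delta ^+ 2 by rewrite exprn_gt0.
  have [dl|dl] := ltP `|d j - t| delta.
    apply: le_trans (gc _ dl) _; rewrite lerDl mulr_ge0 ?sqr_ge0 //.
    by rewrite divr_ge0 ?mulr_ge0 // ltW.
  apply: le_trans (ler_normB _ _) _; apply: le_trans (lerD (gB j) gB0) _.
  rewrite -[leLHS]add0r; apply: lerD => //.
  have -> : B + B = 2 * B / delta ^+ 2 * delta ^+ 2.
    by field; rewrite gt_eqF.
  apply: ler_wpM2l; first by rewrite divr_ge0 ?mulr_ge0 // ltW.
  by rewrite -[leRHS](real_normK (num_real _)) ler_pXn2r ?nnegrE // ltW.
have -> : qf g U d (rcol vv) - g t =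
    \sum_j (g (d j) - g t) * nsq ((U *m rcol vv) j 0) + g t * (n%:R * e ^+ 2).
  have -> : g t * (n%:R * e ^+ 2) = g t * (1 + n%:R * e ^+ 2) - g t by ring.
  rewrite -mass addrA mulr_sumr -big_split /=; congr (_ - _).
  by apply: eq_bigr => j _; ring.
apply: le_trans (ler_normD _ _) _.
have h1 : `|\sum_j (g (d j) - g t) * nsq ((U *m rcol vv) j 0)| <=
    eta * (1 + n%:R * e ^+ 2) + 2 * B / delta ^+ 2 * (e * K).
  apply: le_trans (ler_norm_sum _ _ _) _.
  apply: le_trans (_ : \sum_j (eta + 2 * B / delta ^+ 2 * (d j - t) ^+ 2) *
    nsq ((U *m rcol vv) j 0) <= _).
    apply: ler_sum => j _; rewrite normrM (ger0_norm (nsq_ge0 _)).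
    by rewrite ler_wpM2r ?nsq_ge0.
  under eq_bigr do rewrite mulrDl -mulrA.
  rewrite big_split /= -!mulr_sumr mass lerD2l; apply: ler_wpM2l; last exact: second.
  by rewrite divr_ge0 ?mulr_ge0 // ltW.
have h2 : `|g t * (n%:R * e ^+ 2)| <= B * n%:R * e.
  rewrite normrM -mulrA; apply: ler_pM => //.
  by rewrite ger0_norm; [exact: ler_wpM2l|exact: mulr_ge0].
have h3 : eta * (1 + n%:R * e ^+ 2) <= eta * (1 + n%:R).
  by apply: ler_wpM2l => //; rewrite lerD2l ler_piMr.
rewrite -/K; apply: le_trans (lerD h1 h2) _.
move: (2 * B / _) => Q in h1 *; nra.
Qed.

End fixed.
End limit.

(** * The limit of vanishing coupling *)

Section kernel_limit.
Variable R : realType.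
Local Notation C := R[i].
Variables (k n : nat) (f : R -> R) (u w lo hi : R) (x : 'I_n -> R) (t : nat -> R)
  (c B : R) (F : 'I_n -> 'I_n -> R) (G : 'I_n -> 'I_n -> R -> R).
Hypotheses (ulo : u < lo) (hiw : hi < w).
Hypothesis xb : forall i, lo <= x i <= hi.
Hypothesis tb : forall l, (l <= k.+1)%N -> lo <= t l <= hi.
Hypothesis tS : forall i, (i < k.+1)%N -> t i < t i.+1.
Hypothesis ft : mtone k.+1 f [set y | u < y < w].
Hypothesis fE : forall i l y, u < y < w ->
  f y = f (x i) + (y - x i) * F i l + (y - x i) * (y - x l) * G i l y.
Hypothesis GB : forall i l y, u < y < w -> `|G i l y| <= B.
Hypothesis Gc : forall i l m, (m <= k.+1)%N -> forall eta : R, 0 < eta ->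
  exists2 delta : R, 0 < delta &
    forall y, `|y - t m| < delta -> `|G i l y - G i l (t m)| <= eta.

Let form (xi : 'I_n -> R) (g : 'I_n -> 'I_n -> R) m :=
  \sum_i \sum_l xi i * xi l * ((t m - c) * F i l + (t m - c) ^+ 2 * g i l).

(** On the test vector (0, xi/e) the products y_i v_i in the rank-one identity are xi_i, free of e.
    What remains is the limit form with G replaced by a spectral average, which concentrates at
    t_m. *)
Lemma kernel_approx (xi : 'I_n -> R) (eta : R) : 0 < eta ->
  exists g : nat -> 'I_n -> 'I_n -> R,
    (forall m i l, (m <= k.+1)%N -> `|g m i l - G i l (t m)| <= eta) /\
    0 <= dd k.+1 t (fun m => form xi (g m) m).
Proof.
move=> eta0.
have n1 : 0 < 1 + n%:R :> R by rewrite ltr_pwDl.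
pose eta' := eta / 2 / (1 + n%:R).
have eta'0 : 0 < eta' by rewrite !divr_gt0.
have /choice [del delE] (q : 'I_n * 'I_n * 'I_k.+2) : exists delta : R, 0 < delta /\
    forall y, `|y - t q.2| < delta ->
      `|G q.1.1 q.1.2 y - G q.1.1 q.1.2 (t q.2)| <= eta'.
  have [|delta d0 dE] := @Gc q.1.1 q.1.2 q.2 _ _ eta'0; last by exists delta.
  by rewrite -ltnS ltn_ord.
pose K (q : 'I_n * 'I_n * 'I_k.+2) := let tau := t q.2 - c in
   2 * B / del q ^+ 2 * ((tau * n%:R) ^+ 2 +
        \sum_i (`|tau| * (1 + n%:R) + `|x i - (c + tau)|) ^+ 2) + B * n%:R.
pose E (m : 'I_k.+2) := `|t m - c| * (4 * n%:R + 2 * n%:R ^+ 2).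
pose Z := 1 + \sum_q `|K q| + \sum_m `|E m|.
have Z1 : 1 <= Z.
  by rewrite /Z -addrA lerDl addr_ge0 // sumr_ge0.
have Z0 : 0 < Z by exact: lt_le_trans Z1.
have KZ q : K q <= Z.
  apply: le_trans (ler_norm _) _; rewrite /Z (bigD1 q) //=.
  have : 0 <= \sum_(i | i != q) `|K i| by exact: sumr_ge0.
  have : 0 <= \sum_m `|E m| by exact: sumr_ge0.
  by lra.
have EZ m : E m <= Z.
  apply: le_trans (ler_norm _) _; rewrite /Z [X in _ + X](bigD1 m) //=.
  have : 0 <= \sum_(i | i != m) `|E i| by exact: sumr_ge0.
  have : 0 <= \sum_q `|K q| by exact: sumr_ge0.
  by lra.
pose rho := Num.min (eta / 2) (Num.min (lo - u) (w - hi)).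
have rho0 : 0 < rho by rewrite !lt_min !subr_gt0 ulo hiw divr_gt0.
have rho1 : rho <= eta / 2 by rewrite ge_min lexx.
have rho2 : rho <= lo - u by rewrite !ge_min lexx orbT.
have rho3 : rho <= w - hi by rewrite !ge_min lexx !orbT.
(* [Z] dominates the constants of [eigenvalue_location] and [qf_concentration] for all nodes and all
   pairs, so e Z < rho keeps the eigenvalues in ]u, w[ and the averages within eta. *)
pose e := Num.min 1 (rho / 2 / Z).
have e0 : 0 < e by rewrite lt_min ltr01 !divr_gt0.
have e1 : e <= 1 by rewrite ge_min lexx.
have eZ : e * Z < rho.
  apply: le_lt_trans (_ : rho / 2 < _); last by lra.
  by rewrite -ler_pdivlMr // ge_min lexx orbT.
have e01 : 0 < e <= 1 by rewrite e0.
pose vv : 'I_n.+1 -> R := ext0 1 (fun=> e).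
pose xx := ext0 c x.
(* Subtracting c times the rank-one matrix makes tau = t_m - c at node m, so the moving entry c +
   tau is t_m itself. *)
pose A : 'M[C]_n.+1 := \matrix_(i, j) (xx i *+ (i == j) - c * (vv i * vv j))%:C.
pose D : 'M[C]_n.+1 := outer vv.
have XE m i j : (A + (t m)%:C *: D) i j =
    (xx i *+ (i == j) + (t m - c) * (vv i * vv j))%:C.
  by rewrite !mxE -rmorphM -rmorphD; congr _%:C; ring.
have Xh m : (A + (t m)%:C *: D)^t* = A + (t m)%:C *: D.
  apply/matrixP => i j; rewrite [LHS]mxE [X in Num.conj X]mxE !XE.
  rewrite (CrealP _) ?complex_real //; congr _%:C.
  by rewrite eq_sym [vv j * _]mulrC; case: eqP => [->|].
have [U [d Ud]] := sdec_exf Xh.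
have dI m j : (m <= k.+1)%N -> u < d m j < w.
  move=> mk; have := eigenvalue_location (XE m) (Ud m) e01 j xb.
  rewrite addrC subrK => /(_ (tb mk)).
  have : `|t m - c| * (e * (4 * n%:R + 2 * n%:R ^+ 2)) < rho.
    apply: le_lt_trans eZ; rewrite mulrCA; apply: ler_wpM2l; first exact: ltW.
    by have := EZ (Ordinal (mk : (m < k.+2)%N)).
  by move=> h /andP[h1 h2]; apply/andP; split; lra.
exists (fun m i l => qf (G i l) (U m) (d m) (rcol vv)); split.
  move=> m i l mk; pose q := (i, l, Ordinal (mk : (m < k.+2)%N)).
  have [dq0 dqE] := delE q.
  have tE : t m = c + (t m - c) by ring.
  have [uw1 uw2] : u < t m < w /\ true.
    split=> //; have /andP[h1 h2] := tb mk; apply/andP; split; lra.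
  have := @qf_concentration _ _ _ _ _ _ _ _ _ (XE m) (Ud m) e01 (G i l) eta' (del q) B
    (ltW eta'0) dq0.
  rewrite -tE => /(_ _ _ _)/le_trans; apply.
  - by move=> j; apply: GB; exact: dI.
  - exact: GB.
  - exact: dqE.
  have -> : eta' * (1 + n%:R) = eta / 2 by rewrite divfK // gt_eqF.
  have := ler_wpM2l (ltW e0) (KZ q); rewrite /K /= -tE.
  by move=> h; lra.
pose yy : 'I_n.+1 -> R := ext0 0 (fun i => xi i / e).
pose F' (i l : 'I_n.+1) : R := ext0 0 (fun i => ext0 0 (F i) l) i.
pose G' (i l : 'I_n.+1) (z : R) : R := ext0 0 (fun i => ext0 0 (fun l => G i l z) l) i.
have := ft (rcol yy) (outer_psd vv) tS (fun m _ => Ud m) dI.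
rewrite (@eq_dd _ k.+1 t t _ (fun m => \sum_i yy i ^+ 2 * f (xx i) +
   form xi (fun i l => qf (G i l) (U m) (d m) (rcol vv)) m)) //.
  (* The diagonal part is independent of m, and the order is positive. *)
  by rewrite ddD dd_cst add0r.
move=> m mk.
rewrite (@qf_rank_one _ _ _ _ _ _ _ _ (XE m) (Ud m) f F' G' yy).
  congr (_ + _); rewrite big_ord_recl big1 ?add0r; last first.
    by move=> l _; rewrite /yy ext0_0 !mul0r.
  apply: eq_bigr => i _; rewrite big_ord_recl.
  rewrite [X in X + _](_ : _ = 0) ?add0r; last first.
    by rewrite [yy ord0]ext0_0 !(mul0r, mulr0).
  apply: eq_bigr => l _; rewrite /yy /F' /vv !ext0_S.
  rewrite -!/vv !divfK ?gt_eqF //; congr (_ * (_ + _ * _)).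
  by apply: eq_qf => j; rewrite /G' !ext0_S.
move=> i l j; rewrite /yy /xx /F' /G'.
case: (unliftP ord0 i) => [i' ->|->]; last by rewrite !ext0_0 eqxx.
case: (unliftP ord0 l) => [l' ->|->]; last by rewrite !ext0_0 eqxx.
by rewrite !ext0_S => _ _; apply: fE; exact: dI.
Qed.

(** For fixed nodes a divided difference is Lipschitz in the values ([dd_bound]), so the error of
    [kernel_approx] can be sent to 0. *)
Lemma kernel_limit (xi : 'I_n -> R) :
  0 <= dd k.+1 t (fun m => form xi (fun i l => G i l (t m)) m).
Proof.
have [K K0 KE] := dd_bound k.+1 t.
pose M m := \sum_i \sum_l `|xi i * xi l| * (t m - c) ^+ 2.
have M0 m : 0 <= M m.
  by apply: sumr_ge0 => i _; apply: sumr_ge0 => l _; rewrite mulr_ge0 ?sqr_ge0.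
pose MM := \sum_(m < k.+2) M m.
have MM0 : 0 <= MM by apply: sumr_ge0.
apply/ler_addgt0Pr => eps eps0; rewrite -lerBlDr sub0r.
pose eta := eps / (1 + K * MM).
have KM : 0 < 1 + K * MM by rewrite ltr_pwDl // mulr_ge0.
have eta0 : 0 < eta by rewrite divr_gt0.
have [g [gE g0]] := kernel_approx xi eta0.
have : `|dd k.+1 t (fun m => form xi (fun i l => G i l (t m)) m) -
    dd k.+1 t (fun m => form xi (g m) m)| <= K * (MM * eta).
  rewrite -ddB; apply: KE => m mk; rewrite /form -sumrB.
  apply: le_trans (_ : M m * eta <= _); last first.
    rewrite ler_wpM2r ?(ltW eta0) // /MM (bigD1 (Ordinal (mk : (m < k.+2)%N))) //=.
    by rewrite lerDl sumr_ge0.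
  rewrite /M mulr_suml; apply: le_trans (ler_norm_sum _ _ _) _.
  apply: ler_sum => i _; rewrite -sumrB mulr_suml.
  apply: le_trans (ler_norm_sum _ _ _) _; apply: ler_sum => l _.
  set X := (X in `|X|).
  have -> : X = xi i * xi l * ((t m - c) ^+ 2 * (G i l (t m) - g m i l)).
    by rewrite /X; ring.
  rewrite normrM -[leRHS]mulrA ler_wpM2l // normrM (ger0_norm (sqr_ge0 _)).
  by rewrite ler_wpM2l ?sqr_ge0 // distrC gE.
have : K * (MM * eta) <= eps.
  rewrite mulrA /eta mulrA ler_pdivrMr // mulrC; apply: ler_wpM2l; [exact: ltW|lra].
rewrite ler_norml => h /andP[h1 h2]; lra.
Qed.

End kernel_limit.

(** * Functions of class C^{1,1} *)

Section smooth.
Variable R : realType.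
Local Notation C := R[i].

(** The real and imaginary parts of a complex vector contribute separately; the cross terms cancel
    by symmetry. *)
Lemma psd_real n (S : 'I_n -> 'I_n -> R) : (forall i j, S i j = S j i) ->
  (forall xi, 0 <= \sum_i \sum_j xi i * xi j * S i j) ->
  psd (\matrix_(i, j) (S i j)%:C : 'M[C]_n).
Proof.
move=> Ss Sp; split.
  apply/matrixP => i j; rewrite !mxE Ss; apply: (CrealP _).
  by rewrite complex_real.
move=> v; set M := \matrix_(i, j) _.
have E : (v^t* *m M *m v) 0 0 =
    \sum_i \sum_j (S i j)%:C * (v j 0 * Num.conj (v i 0)).
  rewrite mxE exchange_big; apply: eq_bigr => j _.
  rewrite mxE mulr_suml; apply: eq_bigr => i _; by rewrite !mxE; ring.
have conjE (z w : C) : complex.Im (z * Num.conj w) =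
    complex.Im z * complex.Re w - complex.Re z * complex.Im w.
  by rewrite conj_conjc; case: z w => a b [c e] /=; ring.
rewrite E lecE; apply/andP; split.
  rewrite [complex.Im 0]/= raddf_sum /=; apply/eqP.
  pose T i j := S i j * (complex.Im (v j 0) * complex.Re (v i 0)).
  transitivity (\sum_i \sum_j (T i j - T j i)).
    apply: eq_bigr => i _; rewrite raddf_sum /=; apply: eq_bigr => j _.
    by rewrite Im_mul_real conjE /T [S j i]Ss; ring.
  under eq_bigr do rewrite sumrB.
  by rewrite sumrB [X in _ - X]exchange_big subrr.
rewrite [complex.Re 0]/= raddf_sum /=.
have -> : \sum_i complex.Re (\sum_j (S i j)%:C * (v j 0 * Num.conj (v i 0))) =
   \sum_i \sum_j complex.Re (v i 0) * complex.Re (v j 0) * S i j +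
   \sum_i \sum_j complex.Im (v i 0) * complex.Im (v j 0) * S i j.
  rewrite -big_split; apply: eq_bigr => i _ /=; rewrite raddf_sum -big_split.
  by apply: eq_bigr => j _ /=; rewrite Re_mul_real Re_mul_conj; ring.
by rewrite addr_ge0 // Sp.
Qed.

(** A quantitative C^{1,1} condition with derivative [f1]; the quadratic clause is what bounds
    second divided differences with a repeated point. *)
Definition smooth_on (f f1 : R -> R) (u w L : R) :=
  forall y z, u < y < w -> u < z < w ->
    [/\ `|f y - f z| <= L * `|y - z|, `|f1 z| <= L &
        `|f y - f z - (y - z) * f1 z| <= L * (y - z) ^+ 2].

Section kernels.
Variables (n : nat) (f f1 : R -> R) (u w L : R) (x : 'I_n -> R).
Hypothesis fs : smooth_on f f1 u w L.
Hypothesis xb : forall i, u < x i < w.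
Hypothesis xI : injective x.

Definition slope i l := if i == l then f1 (x i) else (f (x i) - f (x l)) / (x i - x l).

(** The second divided difference f[x_i, x_l, y]. At y = x_i or y = x_l it is 0 by the convention on
    division; this is harmless in [slope2E], where its coefficient vanishes there. *)
Definition slope2 i l y :=
  (f y - f (x i) - (y - x i) * slope i l) / ((y - x i) * (y - x l)).

Lemma x_neq i l : i != l -> x i - x l != 0.
Proof. by rewrite subr_eq0; apply: contra => /eqP/xI ->. Qed.

Lemma slope_sym i l : slope i l = slope l i.
Proof.
rewrite /slope eq_sym; case: eqP => [->//|/eqP li].
by rewrite -[RHS]mulrNN -invrN !opprB.
Qed.

Lemma slopeE i l : (x i - x l) * slope i l = f (x i) - f (x l).
Proof.
rewrite /slope; case: eqP => [->|/eqP il]; first by rewrite !subrr mul0r.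
by rewrite mulrC divfK // x_neq.
Qed.

Lemma slope2_sym i l y : slope2 i l y = slope2 l i y.
Proof.
rewrite /slope2 [(y - x i) * (y - x l)]mulrC; congr (_ / _).
rewrite [slope l i]slope_sym.
have := slopeE i l => h.
have -> : (y - x i) * slope i l = (y - x l) * slope i l - (x i - x l) * slope i l.
  by ring.
by rewrite h; ring.
Qed.

Lemma slope2E i l y : u < y < w ->
  f y = f (x i) + (y - x i) * slope i l + (y - x i) * (y - x l) * slope2 i l y.
Proof.
move=> yb; have [->|yi] := eqVneq y (x i).
  by rewrite subrr !mul0r !addr0.
have [->|yl] := eqVneq y (x l).
  rewrite subrr mulr0 mul0r addr0 slope_sym slopeE; ring.
have yi' : y - x i != 0 by rewrite subr_eq0.
have yl' : y - x l != 0 by rewrite subr_eq0.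
by rewrite /slope2; field; rewrite yi' yl'.
Qed.

Lemma slope_bound i l : `|slope i l| <= L.
Proof.
have [h1 h2 h3] := fs (xb i) (xb l).
rewrite /slope; case: eqP => [->//|/eqP il].
have xil : 0 < `|x i - x l| by rewrite normr_gt0 x_neq.
by rewrite normrM normfV ler_pdivrMr.
Qed.

(** If y is at least as close to x_l as to x_i, then |x_i - x_l| <= 2 |y - x_i|. This handles one
    factor of the denominator, and the Lipschitz bound at x_l cancels the other. *)
Lemma slope2_bound1 i l y : i != l -> u < y < w ->
  `|y - x l| <= `|y - x i| -> `|slope2 l i y| <= 4 * L / `|x i - x l|.
Proof.
move=> il yb yil; have xil : 0 < `|x i - x l| by rewrite normr_gt0 x_neq.
have [h1 h2 h3] := fs yb (xb l).
have L0 : 0 <= L by apply: le_trans h2.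
have d0 : `|x i - x l| <= 2 * `|y - x i|.
  have -> : x i - x l = (y - x l) - (y - x i) by ring.
  by apply: le_trans (ler_normB _ _) _; lra.
have [yl|yl] := eqVneq (y - x l) 0.
  by rewrite /slope2 yl !mul0r invr0 mulr0 normr0 divr_ge0 ?mulr_ge0.
have yi : 0 < `|y - x i| by lra.
have yl0 : 0 < `|y - x l| by rewrite normr_gt0.
rewrite /slope2 normrM normfV normrM ler_pdivrMr ?mulr_gt0 //.
apply: le_trans (ler_normB _ _) _; rewrite normrM.
apply: le_trans (lerD h1 (ler_wpM2l (normr_ge0 _) (slope_bound l i))) _.
have -> : 4 * L / `|x i - x l| * (`|y - x l| * `|y - x i|) =
   (2 * L * `|y - x l|) * (2 * `|y - x i| / `|x i - x l|).
  by field; rewrite gt_eqF.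
apply: le_trans (_ : 2 * L * `|y - x l| * 1 <= _); first by lra.
rewrite ler_wpM2l ?mulr_ge0 // ler_pdivlMr //; lra.
Qed.

Lemma slope2_bound : exists B, forall i l y, u < y < w -> `|slope2 i l y| <= B.
Proof.
have b1 i l y : u < y < w -> `|slope2 i l y| <= L + 4 * L / `|x i - x l|.
  move=> yb; have [h1 h2 h3] := fs yb (xb i).
  have L0 : 0 <= L by apply: le_trans h2.
  have [<-|il] := eqVneq i l.
    rewrite subrr normr0 invr0 mulr0 addr0 /slope2 /slope eqxx.
    have [yi|yi] := eqVneq (y - x i) 0; first by rewrite yi !mul0r invr0 mulr0 normr0.
    rewrite normrM normfV ler_pdivrMr ?normr_gt0 ?mulf_neq0 //.
    by rewrite -expr2 normrX real_normK ?num_real.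
  rewrite -[leLHS]add0r; apply: lerD => //.
  have [yil|yil] := leP `|y - x l| `|y - x i|.
    by rewrite slope2_sym slope2_bound1.
  by rewrite distrC slope2_bound1 // 1?eq_sym // ltW.
exists (\sum_i \sum_l `|L + 4 * L / `|x i - x l| |) => i l y yb.
apply: le_trans (b1 i l y yb) _; apply: le_trans (ler_norm _) _.
rewrite (bigD1 i) //= (bigD1 l) //= -addrA lerDl addr_ge0 //.
  exact: sumr_ge0.
by apply: sumr_ge0 => a _; apply: sumr_ge0.
Qed.

Lemma slope2_cont i l y0 : u < y0 < w -> y0 != x i -> y0 != x l ->
  forall eta : R, 0 < eta -> exists2 delta : R, 0 < delta &
    forall y, `|y - y0| < delta -> `|slope2 i l y - slope2 i l y0| <= eta.
Proof.
move=> yb yi yl eta eta0.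
have fc : f y @[y --> y0] --> f y0.
  apply/cvgrPdist_le => e e0.
  have [h1 h2 h3] := fs yb yb; have L0 : 0 <= L by apply: le_trans h2.
  have L1 : 0 < L + 1 by lra.
  have /andP[uy0 y0w] := yb.
  near=> y; have yb' : u < y < w.
    apply/andP; split; near: y.
      by apply: cvgr_gt uy0; exact: cvg_id.
    by apply: cvgr_lt y0w; exact: cvg_id.
  have [+ _ _] := fs yb yb'; move=> /le_trans; apply.
  apply: le_trans (_ : (L + 1) * `|y0 - y| <= _).
    by rewrite ler_wpM2r //; lra.
  rewrite -ler_pdivlMl // mulrC.
  near: y; apply: cvgr_dist_le; last by rewrite divr_gt0.
  exact: cvg_id.
have sc : slope2 i l y @[y --> y0] --> slope2 i l y0.
  have c1 z : (y - z) @[y --> y0] --> y0 - z by apply: cvgB; [exact: cvg_id|exact: cvg_cst].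
  apply: cvgM.
    apply: cvgB; first by apply: cvgB => //; exact: cvg_cst.
    by apply: cvgM => //; exact: cvg_cst.
  by apply: cvgV; [rewrite mulf_neq0 // subr_eq0|exact: cvgM].
move/cvgrPdist_le/(_ _ eta0)/nbhs_ballP : sc => [delta /= d0 dE].
exists delta => // y yd; rewrite distrC; apply: dE.
by rewrite /ball /= distrC.
Unshelve. all: by end_near.
Qed.

End kernels.
End smooth.

(** * The two kernels and the representation for smooth functions *)

Section smooth_representation.
Variable R : realType.
Local Notation C := R[i].

(** The divided difference f[s_0, ..., s_k, y]; [remainderE] is Newton's interpolation formula with
    this remainder. *)
Definition remainder k (s : nat -> R) (f : R -> R) (y : R) : R :=
  dd k s (fun j => (f y - f (s j)) / (y - s j)).

Lemma remainderE k (s : nat -> R) (f : R -> R) : distinct_upto k s ->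
  exists p : {poly R}, [/\ (size p <= k.+1)%N,
    forall j, (j <= k)%N -> p.[s j] = f (s j) &
    forall y, (forall j, (j <= k)%N -> y != s j) ->
    f y = p.[y] + (nodal k.+1 s).[y] * remainder k s f y].
Proof.
move=> sN; have [p [sp ip pE]] := dd_cauchy (fun j => f (s j)) sN.
exists p; split=> // y yN.
have y0 i : (i <= k)%N -> y - s i != 0 by move=> ik; rewrite subr_eq0 yN.
rewrite /remainder (@eq_dd _ k s s _ (fun j => f y * (y + s j * -1)^-1 -
    f (s j) / (y - s j))) //; last first.
  by move=> i ik; rewrite mulrN1 mulrBl.
rewrite ddB ddZ pE // dd_inv //; last by move=> i ik; rewrite mulrN1 y0.
rewrite opprK expr1n nodalE.
have -> : \prod_(i < k.+1) (y + s i * -1) = \prod_(i < k.+1) (y - s i).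
  by apply: eq_bigr => i _; rewrite mulrN1.
have : \prod_(i < k.+1) (y - s i) != 0.
  by apply/prodf_neq0 => i _; rewrite y0 // -ltnS.
by move=> P0; field.
Qed.

Variables (k n : nat) (f f1 : R -> R) (u w lo hi L : R) (x : 'I_n -> R)
  (s : nat -> R).
Hypothesis fs : smooth_on f f1 u w L.
Hypothesis ft : mtone k.+1 f [set y | u < y < w].
Hypotheses (ulo : u < lo) (hiw : hi < w).
Hypothesis xb : forall i, lo < x i < hi.
Hypothesis xI : injective x.
Hypothesis sb : forall j, (j <= k)%N -> lo < s j < hi.
Hypothesis sS : forall j, (j < k)%N -> s j < s j.+1.
Hypothesis xs : forall i j, (j <= k)%N -> x i != s j.

Let xb' i : u < x i < w.
Proof.
by have /andP[h1 h2] := xb i; rewrite (lt_trans ulo h1) (lt_trans h2 hiw).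
Qed.

(** The divided difference f[x_i, x_l, s_0, ..., s_k]. *)
Let Mx i l : R := dd k s (fun j => slope2 f f1 x i l (s j)).

(** [SxE] shows that this is the kernel obtained from [kernel_limit]. In the present form c enters
    only through the coefficient of [Mx], which prepares the cancellation between c = lo and c =
    hi. *)
Let Sx c i l : R := remainder k s f (x l) + (x i - c) * Mx i l.

Let SxE c i l : Sx c i l =
  dd k s (fun j => slope f f1 x i l + (s j - c) * slope2 f f1 x i l (s j)).
Proof.
rewrite /Sx /remainder /Mx -ddZ -ddD; apply: eq_dd => // j jk.
have si : s j - x i != 0 by rewrite subr_eq0 eq_sym xs.
have sl : s j - x l != 0 by rewrite subr_eq0 eq_sym xs.
have ls : x l - s j != 0 by rewrite subr_eq0 xs.
have := slopeE f f1 xI i l; rewrite /slope2.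
move: (slope f f1 x i l) => F FE.
have -> : f (x i) = f (x l) + (x i - x l) * F by rewrite FE addrC subrK.
by field; rewrite si ls sl.
Qed.

Let Sx_sym c i l : Sx c i l = Sx c l i.
Proof.
rewrite !SxE; apply: eq_dd => // j jk.
by rewrite (slope_sym f f1 x) (slope2_sym f f1 xI).
Qed.

Let form_S c (t : nat -> R) (xi : 'I_n -> R) m :
  \sum_i \sum_l xi i * xi l *
    ((t m - c) * slope f f1 x i l + (t m - c) ^+ 2 * slope2 f f1 x i l (t m)) =
  (t m - c) * \sum_i \sum_l xi i * xi l *
    (slope f f1 x i l + (t m - c) * slope2 f f1 x i l (t m)).
Proof.
rewrite mulr_sumr; apply: eq_bigr => i _; rewrite mulr_sumr.
by apply: eq_bigr => l _; ring.
Qed.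

Let dd_form c (t : nat -> R) (xi : 'I_n -> R) :
  (forall j, (j <= k)%N -> t j = s j) ->
  dd k t (fun m => \sum_i \sum_l xi i * xi l *
    (slope f f1 x i l + (t m - c) * slope2 f f1 x i l (t m))) =
  \sum_i \sum_l xi i * xi l * Sx c i l.
Proof.
move=> ts; rewrite dd_sum; apply: eq_bigr => i _.
rewrite dd_sum; apply: eq_bigr => l _; rewrite ddZ SxE; congr (_ * _).
by apply: eq_dd => j jk; rewrite ts.
Qed.

(** The nodes avoid the points x because [slope2] is shown continuous only away from them. *)
Let kernel_psd (t : nat -> R) c (xi : 'I_n -> R) :
  (forall l, (l <= k.+1)%N -> lo <= t l <= hi) ->
  (forall i, (i < k.+1)%N -> t i < t i.+1) ->
  (forall m i, (m <= k.+1)%N -> t m != x i) ->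
  0 <= dd k.+1 t (fun m => (t m - c) * \sum_i \sum_l xi i * xi l *
    (slope f f1 x i l + (t m - c) * slope2 f f1 x i l (t m))).
Proof.
move=> tb tS tx; have [B BE] := slope2_bound fs xb' xI.
have := @kernel_limit R k n f u w lo hi x t c B (slope f f1 x) (slope2 f f1 x)
  ulo hiw _ tb tS ft _ BE _ xi.
rewrite (@eq_dd _ k.+1 t t _ (fun m => (t m - c) * \sum_i \sum_l xi i * xi l *
    (slope f f1 x i l + (t m - c) * slope2 f f1 x i l (t m)))) //.
apply.
- by move=> i; have /andP[h1 h2] := xb i; rewrite !ltW.
- by move=> i l y yb; exact: slope2E yb.
move=> i l m mk eta eta0; apply: (slope2_cont fs) => //; try exact: tx.
by have /andP[h1 h2] := tb m mk; rewrite (lt_le_trans ulo h1) (le_lt_trans h2 hiw).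
Qed.

Lemma smooth_representation : exists s' mu : 'I_n -> R,
  [/\ forall m, 0 <= s' m <= 1, forall m, 0 <= mu m &
    forall i, remainder k s f (x i) =
      \sum_m mu m / ((hi - x i) * s' m + (x i - lo) * (1 - s' m))].
Proof.
have s_lt i j : (i < j <= k)%N -> s i < s j by exact: incr_lt.
have [l0 h0] : lo < s 0%N /\ s k < hi.
  by split; [case/andP: (sb (leq0n k))|case/andP: (sb (leqnn k))].
have lohi : lo < hi by have /andP[h1 h2] := sb (leq0n k); exact: lt_trans h2.
have Sp : psd (\matrix_(i, j) (Sx lo i j)%:C : 'M[C]_n).
  apply: psd_real => [i j|xi]; first exact: Sx_sym.
  (* The node lo is put in front of s; the factor t - lo vanishes there, and [dd_mulfirst] removes
     the node together with one order. *)
  pose t m := if m is m'.+1 then s m' else lo.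
  have tS i : (i < k.+1)%N -> t i < t i.+1 by case: i => [|i] //= ik; exact: sS.
  rewrite -(@dd_form lo s xi) // -[dd k s _]/(dd k (shift t) (shift
    (fun m => \sum_i \sum_l xi i * xi l *
       (slope f f1 x i l + (t m - lo) * slope2 f f1 x i l (t m))))).
  rewrite -dd_mulfirst; last exact: incr_distinct.
  apply: (@kernel_psd t lo xi _ tS).
    case=> [|l] lk /=; first by rewrite lexx ltW.
    by have /andP[h1 h2] := sb lk; rewrite !ltW.
  case=> [|m] i mk /=; last by rewrite eq_sym xs.
  by have /andP[h1 h2] := xb i; rewrite lt_eqF.
have Tp : psd (\matrix_(i, j) (Sx hi i j)%:C : 'M[C]_n).
  apply: psd_real => [i j|xi]; first exact: Sx_sym.
  (* Symmetrically, hi is appended after s and removed by [dd_mullast]. *)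
  pose t m := if (m <= k)%N then s m else hi.
  have ts j : (j <= k)%N -> t j = s j by rewrite /t => ->.
  have tk : t k.+1 = hi by rewrite /t ltnn.
  have tS i : (i < k.+1)%N -> t i < t i.+1.
    rewrite ltnS leq_eqVlt => /orP[/eqP ->|ik]; first by rewrite tk ts.
    by rewrite !ts ?sS // ltnW.
  have tcase m : (m <= k.+1)%N -> (m <= k)%N \/ m = k.+1 by lia.
  rewrite -(@dd_form hi t xi) // -dd_mullast; last exact: incr_distinct.
  rewrite tk; apply: (@kernel_psd t hi xi _ tS).
    move=> l /tcase[lk|->]; last by rewrite tk lexx ltW.
    by have /andP[h1 h2] := sb lk; rewrite ts // !ltW.
  move=> m i /tcase[mk|->]; first by rewrite ts // eq_sym xs.
  by rewrite tk; have /andP[h1 h2] := xb i; rewrite gt_eqF.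
have [j|j|i j|s' [mu [s'01 mu0 rE]]] := @real_kernel_representation R n (Sx lo) (Sx hi)
  (fun j => hi - x j) (fun j => x j - lo)
  (fun i => (hi - lo) * remainder k s f (x i)) Sp Tp.
- by rewrite subr_gt0; case/andP: (xb j).
- by rewrite subr_gt0; case/andP: (xb j).
(* The multiples (hi - x_j) (x_j - lo) of [Mx] have opposite signs; (hi - lo) times the remainder at
   x_i is left, independently of j. *)
- by rewrite [Sx lo i j]Sx_sym [Sx hi i j]Sx_sym /Sx; ring.
have lh : 0 < hi - lo by rewrite subr_gt0.
exists s', (fun m => mu m / (hi - lo)); split => // [m|i].
  by rewrite divr_ge0 // ltW.
apply: (@mulfI _ (hi - lo)); first by rewrite gt_eqF.
rewrite rE mulr_sumr; apply: eq_bigr => m _.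
by rewrite mulrA mulrCA divff ?mulr1 // gt_eqF.
Qed.
End smooth_representation.

(** * Harnack inequality and gain of two orders for smooth functions *)

Section consequences.
Variable R : realType.

Lemma seq_lower (u : R) (E : seq R) : (forall y, y \in E -> u < y) ->
  exists2 lo, u < lo & forall y, y \in E -> lo < y.
Proof.
elim: E => [|e E IH] H; first by exists (u + 1) => //; rewrite ltrDl.
have [|lo ulo loE] := IH; first by move=> y yE; apply: H; rewrite inE yE orbT.
have ue : u < e by apply: H; rewrite inE eqxx.
exists (Num.min lo ((u + e) / 2)).
  by rewrite lt_min ulo /=; lra.
move=> y; rewrite inE => /orP[/eqP ->|/loE loy].
  by rewrite gt_min; apply/orP; right; lra.
by rewrite gt_min loy.
Qed.

Lemma seq_upper (w : R) (E : seq R) : (forall y, y \in E -> y < w) ->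
  exists2 hi, hi < w & forall y, y \in E -> y < hi.
Proof.
move=> H; have [y|lo h1 h2] := @seq_lower (- w) (map -%R E).
  by case/mapP => z zE ->; rewrite ltrN2 H.
exists (- lo) => [|y yE]; first by rewrite ltrNl.
by rewrite ltrNr; apply: h2; apply: map_f.
Qed.

Lemma free_interval (lo hi : R) (E : seq R) : lo < hi ->
  exists l h, [/\ lo <= l, l < h, h <= hi & forall y, l < y < h -> y \notin E].
Proof.
move=> lohi; elim: E => [|e E [l [h [lol lh hhi lE]]]]; first by exists lo, hi.
pose m := (l + h) / 2.
have lm : l < m by rewrite /m; lra.
have mh : m < h by rewrite /m; lra.
have [em|em] := leP e m.
  exists m, h; split=> //; first by apply: le_trans lol (ltW lm).
  move=> y /andP[my yh]; rewrite inE negb_or gt_eqF ?(le_lt_trans em) //=.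
  by apply: lE; rewrite yh (lt_trans lm).
exists l, m; split=> //; first by apply: le_trans (ltW mh) hhi.
move=> y /andP[ly ym]; rewrite inE negb_or lt_eqF ?(lt_trans ym) //=.
by apply: lE; rewrite ly (lt_trans ym).
Qed.

(** The representation needs interpolation nodes off the points where f is evaluated: equally spaced
    ones in a subinterval free of E. *)
Lemma nodes_avoiding k (lo hi : R) (E : seq R) : lo < hi ->
  exists s : nat -> R, [/\ forall j, (j <= k)%N -> lo < s j < hi,
    forall j, (j < k)%N -> s j < s j.+1 & forall j, (j <= k)%N -> s j \notin E].
Proof.
move=> /(free_interval E) [l [h [lol lh hhi lE]]].
pose s j := l + (h - l) * (j.+1%:R / k.+2%:R).
have k0 : 0 < k.+2%:R :> R by rewrite ltr0n.
have hl : 0 < h - l by rewrite subr_gt0.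
have sb j : (j <= k)%N -> l < s j < h.
  move=> jk; apply/andP; split; first by rewrite ltrDl mulr_gt0 // divr_gt0 // ltr0n.
  rewrite /s -ltrBrDl gtr_pMr // ltr_pdivrMr // mul1r ltr_nat; lia.
exists s; split=> [j jk|j jk|j jk].
- have /andP[h1 h2] := sb j jk.
  by rewrite (le_lt_trans lol h1) (lt_le_trans h2 hhi).
- by rewrite ltrD2l ltr_pM2l // ltr_pM2r ?invr_gt0 // ltr_nat.
- by apply: lE; exact: sb.
Qed.

Lemma weight_gt0 (lo hi y q : R) : lo < y < hi -> 0 <= q <= 1 ->
  0 < (hi - y) * q + (y - lo) * (1 - q).
Proof.
move=> /andP[h1 h2] /andP[q0 q1].
move: q0; rewrite le_eqVlt => /orP[/eqP <-|q0].
  by rewrite mulr0 add0r subr0 mulr1 subr_gt0.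
by rewrite ltr_wpDr ?mulr_gt0 ?mulr_ge0 ?subr_ge0 ?subr_gt0 // ltW.
Qed.

(* The inequality satisfied by the functions [sum_m mu_m / w_m(y)] with
   [mu_m >= 0] and [w_m] affine and positive on ]lo, hi[. *)
Definition harnack k (f : R -> R) (I : set R) := forall lo hi (s : nat -> R) y z,
  I lo -> I hi -> (forall j, (j <= k)%N -> lo < s j < hi) ->
  (forall j, (j < k)%N -> s j < s j.+1) ->
  lo < y < hi -> lo < z < hi -> y != z ->
  (forall j, (j <= k)%N -> y != s j) -> (forall j, (j <= k)%N -> z != s j) ->
  0 <= remainder k s f y <=
  ((hi - z) / (hi - y) + (z - lo) / (y - lo)) * remainder k s f z.

Variables (k : nat) (f f1 : R -> R) (u w L : R).
Hypothesis fs : smooth_on f f1 u w L.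
Hypothesis ft : mtone k.+1 f [set y | u < y < w].

(** Represent the remainder at the two points y and z with common weights. As w_m is a nonnegative
    combination of hi - x and x - lo, the ratio w_m(z) / w_m(y) is at most the sum of the two ratios
    in the bound. *)
Lemma smooth_harnack : harnack k f [set y | u < y < w].
Proof.
move=> lo hi s y z /andP[ulo _] /andP[_ hiw] sb sS yb zb yz ys zs.
pose x (i : 'I_2) := if i == 0 then y else z.
have xb i : lo < x i < hi by rewrite /x; case: ifP.
have xI : injective x.
  move=> i j; rewrite /x; case: i => [[|[|i]] hi'] //; case: j => [[|[|j]] hj'] //=.
  - by move=> _; apply/val_inj.
  - by move=> e; rewrite e eqxx in yz.
  - by move=> e; rewrite e eqxx in yz.
  - by move=> _; apply/val_inj.
have xs i j : (j <= k)%N -> x i != s j.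
  by move=> jk; rewrite /x; case: ifP => _; [exact: ys|exact: zs].
have [q [mu [q01 mu0 rE]]] := smooth_representation fs ft ulo hiw xb xI sb sS xs.
have := rE 0; have := rE 1; rewrite /x /= => -> ->.
have [/andP[y1 y2] /andP[z1 z2]] := (yb, zb).
apply/andP; split.
  by apply: sumr_ge0 => m _; rewrite divr_ge0 // ltW // weight_gt0.
rewrite mulr_sumr; apply: ler_sum => m _.
have wy := weight_gt0 yb (q01 m); have wz := weight_gt0 zb (q01 m).
rewrite mulrCA ler_wpM2l // ler_pdivlMr // ler_pdivrMl //.
set A := (hi - z) / (hi - y); set B := (z - lo) / (y - lo).
have A0 : 0 <= A by rewrite divr_ge0 // subr_ge0 ltW.
have B0 : 0 <= B by rewrite divr_ge0 // subr_ge0 ltW.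
have AE : hi - z = A * (hi - y) by rewrite divfK // subr_eq0 gt_eqF.
have BE : z - lo = B * (y - lo) by rewrite divfK // subr_eq0 gt_eqF.
rewrite AE BE; have /andP[q0 q1] := q01 m.
rewrite -subr_ge0.
have -> : ((hi - y) * q m + (y - lo) * (1 - q m)) * (A + B) -
  (A * (hi - y) * q m + B * (y - lo) * (1 - q m)) =
  B * ((hi - y) * q m) + A * ((y - lo) * (1 - q m)) by ring.
by rewrite addr_ge0 // mulr_ge0 // mulr_ge0 // subr_ge0 // ltW.
Qed.

(** A given test pencil involves f only at its finitely many eigenvalues, so the representation on
    that finite set is enough. *)
Lemma smooth_mtone : mtone k.+3 f [set y | u < y < w].
Proof.
move=> n A D U d v t Dp tS Xd dI.
have tN := incr_distinct tS.
pose E := undup [seq d (val l) i | l <- enum 'I_k.+4, i <- enum 'I_n].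
have inE l i : (l <= k.+3)%N -> d l i \in E.
  move=> lk; rewrite mem_undup; apply/allpairsP.
  by exists (Ordinal (lk : (l < k.+4)%N), i); rewrite !mem_enum.
have EI y : y \in E -> u < y < w.
  rewrite mem_undup => /allpairsP [[l i] [_ _ ->]] /=; apply: dI.
  by rewrite -ltnS ltn_ord.
have [lo ulo loE] : exists2 lo, u < lo & forall y, y \in E -> lo < y.
  by apply: seq_lower => y /EI /andP[].
have [hi hiw hiE] : exists2 hi, hi < w & forall y, y \in E -> y < hi.
  by apply: seq_upper => y /EI /andP[].
(* E is empty exactly for matrices of size 0. *)
have [E0|[e eE]] : E = [::] \/ exists e, e \in E.
  by case: E {inE EI loE hiE} => [|e E]; [left|right; exists e; rewrite mem_head].
  have n0 l : (l <= k.+3)%N -> qf f (U l) (d l) v = 0.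
    by move=> lk; apply: big1 => i _; have := inE l i lk; rewrite E0.
  by rewrite (eq_dd (fun _ _ => erefl) n0) dd0.
have lohi : lo < hi by exact: lt_trans (loE e eE) (hiE e eE).
have [s [sb sS sE]] := nodes_avoiding k E lohi.
pose x (i : 'I_(size E)) := E`_i.
have xE i : x i \in E by rewrite mem_nth.
have xI : injective x.
  by move=> i j /eqP; rewrite nth_uniq ?undup_uniq // => /eqP /val_inj.
have xb i : lo < x i < hi by rewrite loE // hiE.
have xs i j : (j <= k)%N -> x i != s j.
  by move=> jk; apply: contraNneq (sE j jk) => <-.
have [q [mu [q01 mu0 rE]]] := smooth_representation fs ft ulo hiw xb xI sb sS xs.
have [p [sp _ pE]] := remainderE f (incr_distinct sS).
pose a m := hi * q m - lo * (1 - q m); pose b m := 1 - q m - q m.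
have abE m y : a m + b m * y = (hi - y) * q m + (y - lo) * (1 - q m).
  by rewrite /a /b; ring.
apply: (@representation_tone _ k.+1 n A D U d v t Dp tN Xd f p s _ mu a b) => //.
- by move=> m i ik; rewrite abE weight_gt0 // sb.
- by move=> m l i lk; rewrite abE weight_gt0 // loE ?hiE // inE.
move=> l i lk; have dE := inE l i lk.
have iE : (index (d l i) E < size E)%N by rewrite index_mem.
have xd : x (Ordinal iE) = d l i by rewrite /x /= nth_index.
rewrite pE; last by move=> j jk; rewrite -xd xs.
rewrite -xd rE; congr (_ + _ * _); apply: eq_bigr => m _.
by rewrite abE.
Qed.

End consequences.

(** * Regularization *)

Section smoothing.
Variable R : realType.
Implicit Types (f g F P : R -> R).

Definition clamp (A B x : R) := Num.max A (Num.min B x).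

Lemma clamp_in (A B x : R) : A <= B -> A <= clamp A B x <= B.
Proof. by move=> AB; rewrite /clamp le_max lexx /= ge_max AB ge_min lexx. Qed.

Lemma clamp_id (A B x : R) : A <= x <= B -> clamp A B x = x.
Proof. by move=> /andP[Ax xB]; rewrite /clamp (min_idPr xB) (max_idPr Ax). Qed.

Lemma continuous_clamp (A B : R) : continuous (clamp A B).
Proof.
move=> x; apply: (@continuous_max _ R (fun=> A)); first exact: cvg_cst.
apply: (@continuous_min _ R (fun=> B)); first exact: cvg_cst.
exact: cvg_id.
Qed.

Lemma antiderivative f (A B : R) : continuous f ->
  exists P, forall x, A < x < B -> is_derive x 1 P (f x).
Proof.
move=> fc; exists (fun x => (\int[lebesgue_measure]_(t in [set` `[A, x]]) (f t))%R).
move=> x /andP[Ax xB].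
have [|d1 d2] := @continuous_FTC1_closed R f A x B xB _ Ax (fc x).
  apply: continuous_compact_integrable; first exact: segment_compact.
  exact: continuous_subspaceT.
apply: DeriveDef; first exact: d1.
by rewrite -derive1E; exact: d2.
Qed.

Lemma is_derive_cont f (x l : R) : is_derive x 1 f l -> {for x, continuous f}.
Proof. by move=> fl; apply/differentiable_continuous/derivable1_diffP; case: fl. Qed.

Lemma mvt f f' (x y : R) : x < y ->
  (forall z, x <= z <= y -> is_derive z 1 f (f' z)) ->
  exists2 c, x < c < y & f y - f x = f' c * (y - x).
Proof.
move=> xy fd; have [|||c cxy cE] := @MVT R f f' x y.
- by [].
- by move=> z; rewrite in_itv /= => /andP[h1 h2]; apply: fd; rewrite !ltW.
- apply: continuous_in_subspaceT => z; rewrite inE /= in_itv /= => zxy.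
  by apply: is_derive_cont; apply: fd.
by exists c => //; rewrite in_itv in cxy.
Qed.

Lemma lipschitz_mvt f f' (u w L : R) :
  (forall z, u < z < w -> is_derive z 1 f (f' z)) ->
  (forall z, u < z < w -> `|f' z| <= L) ->
  forall y z, u < y < w -> u < z < w -> `|f y - f z| <= L * `|y - z|.
Proof.
move=> fd fL; suff H y z : u < y < w -> u < z < w -> z < y ->
    `|f y - f z| <= L * `|y - z|.
  move=> y z yb zb; have [zy|yz|->] := ltgtP z y; first exact: H.
    by rewrite distrC (distrC y); exact: H.
  by rewrite !subrr normr0 mulr0.
move=> /andP[uy yw] /andP[uz zw] zy; have [|c /andP[c1 c2] ->] := @mvt f f' z y zy.
  by move=> t /andP[t1 t2]; apply: fd; rewrite (lt_le_trans uz t1) (le_lt_trans t2 yw).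
by rewrite normrM ler_wpM2r // fL // (lt_trans uz c1) (lt_trans c2 yw).
Qed.

Lemma mtoneS k f (I J : set R) : I `<=` J -> mtone k f J -> mtone k f I.
Proof.
move=> IJ fJ n A D U d v t Dp tS Xd dI; apply: (fJ n A D) => // l i lk.
by apply: IJ; exact: dI.
Qed.

Lemma is_derive_shift1 P (x c l : R) : is_derive (x + c) 1 P l ->
  is_derive x 1 (fun y => P (y + c)) l.
Proof.
move=> Pd; rewrite -[l]mulr1; apply: (@is_derive1_comp _ P (fun y => y + c)) => //.
have -> : (fun y : R => y + c) = (id : R -> R) + cst c by [].
by rewrite -[X in is_derive _ _ _ X]addr0; apply: is_deriveD.
Qed.

Lemma is_derive_suml (I : Type) (r : seq I) (h : I -> R -> R) (dh : I -> R) (a : I -> R) (x : R) :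
  (forall i, is_derive x 1 (h i) (dh i)) ->
  is_derive x 1 (fun y => \sum_(i <- r) h i y * a i) (\sum_(i <- r) dh i * a i).
Proof.
move=> hd; elim: r => [|i r IH].
  rewrite big_nil; rewrite (_ : (fun _ => _) = cst 0); first exact: is_derive_cst.
  by apply/funext => y; rewrite big_nil.
rewrite big_cons (_ : (fun _ => _) =
    (a i \*: h i) + (fun y => \sum_(j <- r) h j y * a j)); last first.
  by apply/funext => y; rewrite big_cons mulrC.
by rewrite mulrC; apply: is_deriveD; exact: is_deriveZ.
Qed.

Lemma is_derive_dd k (t : nat -> R) (g : nat -> R -> R) (dg : nat -> R) (x : R) :
  (forall l, (l <= k)%N -> is_derive x 1 (g l) (dg l)) ->
  is_derive x 1 (fun y => dd k t (fun l => g l y)) (dd k t dg).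
Proof.
elim: k t g dg => [|k IH] t g dg gd /=; first exact: gd.
have d1 := IH t g dg (fun l lk => gd l (leqW lk)).
have d2 := IH (shift t) (shift g) (shift dg) (fun l lk => gd l.+1 lk).
exact: (is_deriveZ _ (is_deriveB d1 d2)).
Qed.

(** g(x) is the mean of f over [x - del, x + del], computed from an antiderivative. Its divided
    difference along a pencil is an increment of phi, whose derivative at y is the divided
    difference of f along the pencil translated by y; the mean value theorem then gives the sign
    without integrating an inequality. *)
Lemma steklov k f (A B del : R) : 0 < del -> A + 2 * del < B - 2 * del ->
  (forall x, A < x < B -> {for x, continuous f}) ->
  exists g,
  [/\ forall x, A + 2 * del < x < B - 2 * del ->
        is_derive x 1 g ((f (x + del) - f (x - del)) / (2 * del)),
      forall x, A + 2 * del < x < B - 2 * del ->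
        exists2 z, x - del < z < x + del & g x = f z &
      mtone k f [set x | A < x < B] ->
      mtone k g [set x | A + 2 * del < x < B - 2 * del]].
Proof.
move=> d0 AB fc.
pose A1 := A + del / 2; pose B1 := B - del / 2.
have AB1 : A1 <= B1 by rewrite /A1 /B1; lra.
(* Freezing f outside [A1, B1] makes it continuous on the whole line, without changing it where g
   needs it. *)
have ftc : continuous (f \o clamp A1 B1).
  move=> x; apply: continuous_comp; first exact: continuous_clamp.
  apply: fc; have /andP[h1 h2] := clamp_in x AB1.
  by apply/andP; split; move: h1 h2; rewrite /A1 /B1; lra.
have [P Pd'] := antiderivative A1 B1 ftc.
have Pd x : A1 < x < B1 -> is_derive x 1 P (f x).
  move=> /andP[h1 h2]; have := Pd' x; rewrite h1 h2 /= clamp_id => [|]; last by rewrite !ltW.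
  by apply.
pose g x := (2 * del)^-1 * (P (x + del) - P (x - del)).
exists g; split.
- move=> x /andP[h1 h2]; rewrite mulrC; apply: is_deriveZ; apply: is_deriveB.
    by apply/is_derive_shift1/Pd; rewrite /A1 /B1; apply/andP; split; lra.
  by apply/is_derive_shift1/Pd; rewrite /A1 /B1; apply/andP; split; lra.
- move=> x /andP[h1 h2]; have [||c cx cE] := @mvt P f (x - del) (x + del).
  + by lra.
  + by move=> z /andP[z1 z2]; apply: Pd; rewrite /A1 /B1; apply/andP; split; lra.
  exists c => //; rewrite /g cE; have -> : x + del - (x - del) = 2 * del by ring.
  by rewrite mulrCA mulVf ?mulr1 // mulf_neq0 // gt_eqF.
move=> ft n M D U d v t Dp tS Xd dI.
pose phi y := dd k t (fun l => qf (fun x => P (x + y)) (U l) (d l) v).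
have phid y : - del <= y <= del ->
    is_derive y 1 phi (dd k t (fun l => qf (fun x => f (x + y)) (U l) (d l) v)).
  move=> /andP[y1 y2]; apply: is_derive_dd => l lk.
  apply: is_derive_suml => i.
  rewrite (_ : (fun _ => _) = (fun z => P (z + d l i))); last first.
    by apply/funext => z; rewrite addrC.
  rewrite addrC; apply/is_derive_shift1/Pd; rewrite /A1 /B1.
  by have /andP[h1 h2] := dI l i lk; apply/andP; split; lra.
have -> : dd k t (fun l => qf g (U l) (d l) v) =
    (2 * del)^-1 * (phi del - phi (- del)).
  rewrite /phi -ddB -ddZ; apply: eq_dd => // l lk.
  rewrite -mulN1r -qfZ -qfD -qfZ; apply: eq_qf => i.
  by rewrite /g mulN1r.
apply: mulr_ge0; first by rewrite invr_ge0 mulr_ge0 // ltW.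
have [|c /andP[c1 c2] ->] := @mvt phi _ (- del) del _ phid; first by lra.
rewrite mulr_ge0 //; last by lra.
have -> : dd k t (fun l => qf (fun x => f (x + c)) (U l) (d l) v) =
    dd k t (fun l => qf f (U l) (fun i => d l i + c) v) by [].
apply: (ft n (M + (c%:C)%:M) D _ _ v t Dp tS).
  move=> l lk; split; first exact: (Xd l lk).1.
  have := spec_dec_affine (c%:C) 1 (Xd l lk); rewrite scale1r.
  rewrite addrA [_%:M + M]addrC => ->; congr (_ *m dC _ *m _).
  by apply/funext => i; rewrite mul1r addrC rmorphD.
move=> l i lk; have /andP[h1 h2] := dI l i lk.
by rewrite /=; apply/andP; split; lra.
Qed.

(** Two Steklov means: the first makes f Lipschitz, the second makes the derivative Lipschitz. Each
    costs a margin 2 del and moves the point of evaluation by less than del. *)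
Lemma smoothing k f (A B del : R) : 0 < del -> A + 4 * del < B - 4 * del ->
  (forall x, A < x < B -> {for x, continuous f}) ->
  mtone k f [set x | A < x < B] ->
  exists F F1 L, [/\ smooth_on F F1 (A + 4 * del) (B - 4 * del) L,
     mtone k F [set x | A + 4 * del < x < B - 4 * del] &
     forall x, A + 4 * del < x < B - 4 * del ->
        exists2 z, `|z - x| < 2 * del & F x = f z].
Proof.
move=> d0 AB fc ft.
have [|g [gd gf gt]] := @steklov k f A B del d0 _ fc; first by lra.
have [||F [Fd Fg Ft]] := @steklov k g (A + 2 * del) (B - 2 * del) del d0.
- by lra.
- by move=> x xb; apply: is_derive_cont; exact: gd.
have AE : A + 2 * del + 2 * del = A + 4 * del by ring.
have BE : B - 2 * del - 2 * del = B - 4 * del by ring.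
rewrite AE BE in Fd Fg Ft.
have [M fM] : exists M, forall x, A + del <= x <= B - del -> `|f x| <= M.
  have [||c _ cE] := @EVT_max R (fun x => `|f x|) (A + del) (B - del).
  - by lra.
  - apply: continuous_in_subspaceT => x; rewrite inE /= in_itv /= => /andP[h1 h2].
    by apply: continuous_comp; [apply: fc; apply/andP; split; lra|exact: norm_continuous].
  by exists `|f c| => x xb; apply: cE; rewrite in_itv.
have M0 : 0 <= M by apply: le_trans (fM (A + del) _) => //; apply/andP; split; lra.
pose L0 := M / del.
have L00 : 0 <= L0 by rewrite divr_ge0 // ltW.
have d2 : 0 < 2 * del by rewrite mulr_gt0.
have diff_bound (h : R -> R) x K : `|h (x + del)| <= K -> `|h (x - del)| <= K ->
    `|(h (x + del) - h (x - del)) / (2 * del)| <= K / del.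
  move=> h1 h2; rewrite normrM normfV (gtr0_norm d2) ler_pdivrMr //.
  have -> : K / del * (2 * del) = K + K by field; rewrite gt_eqF.
  by apply: le_trans (ler_normB _ _) (lerD h1 h2).
have gL : forall y z, A + 2 * del < y < B - 2 * del -> A + 2 * del < z < B - 2 * del ->
    `|g y - g z| <= L0 * `|y - z|.
  apply: (lipschitz_mvt gd) => z /andP[z1 z2].
  by apply: diff_bound; apply: fM; apply/andP; split; lra.
have gM x : A + 2 * del < x < B - 2 * del -> `|g x| <= M.
  move=> xb; have [z /andP[z1 z2] ->] := gf x xb; apply: fM.
  by move: xb => /andP[x1 x2]; apply/andP; split; lra.
pose F1 x := (g (x + del) - g (x - del)) / (2 * del).
pose L := L0 + L0 / del.
have Ldel : 0 <= L0 / del by rewrite divr_ge0 // ltW.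
have F1L x : A + 4 * del < x < B - 4 * del -> `|F1 x| <= L0.
  move=> /andP[x1 x2]; apply: diff_bound; apply: gM; apply/andP; split; lra.
exists F, F1, L; split; last 2 first.
- by apply: Ft; apply: gt.
- move=> x xb; have [z /andP[z1 z2] ->] := Fg x xb.
  have [|z' /andP[z'1 z'2] ->] := gf z.
    by move: xb => /andP[x1 x2]; apply/andP; split; lra.
  by exists z' => //; rewrite ltr_norml; apply/andP; split; lra.
move=> y z yb zb; split.
- apply: le_trans (lipschitz_mvt Fd F1L yb zb) _.
  by rewrite ler_wpM2r // /L lerDl.
- by apply: le_trans (F1L z zb) _; rewrite /L lerDl.
have F1lip c : A + 4 * del < c < B - 4 * del -> `|F1 c - F1 z| <= L0 / del * `|c - z|.
  move=> /andP[c1 c2]; move: zb => /andP[zb1 zb2].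
  have -> : F1 c - F1 z = ((g (c + del) - g (z + del)) - (g (c - del) - g (z - del)))
     / (2 * del) by rewrite /F1; ring.
  rewrite normrM normfV (gtr0_norm d2) ler_pdivrMr //.
  have -> : L0 / del * `|c - z| * (2 * del) = L0 * `|c - z| + L0 * `|c - z|.
    by field; rewrite gt_eqF.
  apply: le_trans (ler_normB _ _) _; apply: lerD.
    apply: le_trans (gL _ _ _ _) _; try (apply/andP; split; lra).
    by rewrite opprD addrACA subrr addr0.
  apply: le_trans (gL _ _ _ _) _; try (apply/andP; split; lra).
  by rewrite opprD addrACA subrr addr0.
have conv c : (y <= c <= z) || (z <= c <= y) -> A + 4 * del < c < B - 4 * del.
  move: yb zb => /andP[y1 y2] /andP[z1 z2] /orP[/andP[c1 c2]|/andP[c1 c2]];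
  by apply/andP; split; lra.
have [c cb cE] : exists2 c, (y <= c <= z) || (z <= c <= y) &
    F y - F z = F1 c * (y - z).
  have [yz|zy|->] := ltgtP y z; last by exists z; rewrite ?lexx // !subrr mulr0.
    have [|c /andP[c1 c2] cE] := @mvt F F1 y z yz.
      by move=> t tb; apply: Fd; apply: conv; rewrite tb.
    exists c; first by rewrite (ltW c1) (ltW c2).
    by rewrite -opprB cE -mulrN opprB.
  have [|c /andP[c1 c2] cE] := @mvt F F1 z y zy.
    by move=> t tb; apply: Fd; apply: conv; rewrite tb orbT.
  by exists c => //; rewrite (ltW c1) (ltW c2) orbT.
have -> : F y - F z - (y - z) * F1 z = (F1 c - F1 z) * (y - z) by rewrite cE; ring.
rewrite normrM -(real_normK (num_real (y - z))) expr2 mulrA ler_wpM2r //.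
apply: le_trans (F1lip c (conv c cb)) _.
apply: ler_pM => //; first by rewrite /L lerDr.
move: cb => /orP[/andP[c1 c2]|/andP[c1 c2]].
  by rewrite !ler0_norm; lra.
by rewrite !ger0_norm; lra.
Qed.

End smoothing.

(** * Open intervals with extended real ends *)

Section intervals.
Variables (R : realType) (a b : \bar R).
Local Notation I := (ointerval a b).

Lemma ointerval_below y : I y -> exists2 u, I u & u < y.
Proof.
move=> /andP[ay yb].
suff [u uy au] : exists2 u, u < y & (a < u%:E)%E.
  by exists u => //; apply/andP; split=> //; apply: lt_trans yb; rewrite lte_fin.
case: a ay => [r| |] /=; first 2 last.
- by move=> _; exists (y - 1); [rewrite ltrBlDr ltrDl|exact: ltNyr].
- rewrite lte_fin => ry; exists ((r + y) / 2); rewrite ?lte_fin; lra.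
- by rewrite ltNge leey.
Qed.

Lemma ointerval_above y : I y -> exists2 w, I w & y < w.
Proof.
move=> /andP[ay yb].
suff [u uy au] : exists2 u, y < u & (u%:E < b)%E.
  by exists u => //; apply/andP; split=> //; apply: lt_trans ay _; rewrite lte_fin.
case: b yb => [r| |] /=; first 2 last.
- by rewrite ltNge leNye.
- rewrite lte_fin => ry; exists ((r + y) / 2); rewrite ?lte_fin; lra.
- by move=> _; exists (y + 1); [rewrite ltrDl|exact: ltry].
Qed.

Lemma ointerval_ex : (a < b)%E -> exists y, I y.
Proof.
rewrite /ointerval /=; case: a b => [r| |] [s| |] //= ab.
- by exists ((r + s) / 2); move: ab; rewrite !lte_fin => ab; apply/andP; split; lra.
- by exists (r + 1); rewrite lte_fin ltry andbT; lra.
- by exists (s - 1); rewrite lte_fin ltNyr /=; lra.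
- by exists 0; rewrite ltNyr ltry.
Qed.

Lemma ointerval_convex u w y : I u -> I w -> u <= y <= w -> I y.
Proof.
move=> /andP[au _] /andP[_ wb] /andP[uy yw]; apply/andP; split.
  by apply: lt_le_trans au _; rewrite lee_fin.
by apply: le_lt_trans wb; rewrite lee_fin.
Qed.

Lemma seq_inside (E : seq R) : (a < b)%E -> (forall y, y \in E -> I y) ->
  exists A B, [/\ I A, I B, A < B & forall y, y \in E -> A < y < B].
Proof.
move=> ab; elim: E => [_|e E IH HE].
  have [y Iy] := ointerval_ex ab; have [u Iu uy] := ointerval_below Iy.
  by exists u, y.
have [y yE|A [B [IA IB AB ABE]]] := IH; first by apply: HE; rewrite inE yE orbT.
have Ie : I e by apply: HE; rewrite mem_head.
have [u Iu ue] := ointerval_below Ie; have [w Iw ew] := ointerval_above Ie.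
exists (Num.min u A), (Num.max w B); split.
- by rewrite /Num.min; case: ifP.
- by rewrite /Num.max; case: ifP.
- by rewrite gt_min lt_max (lt_trans ue ew).
move=> y; rewrite inE => /orP[/eqP ->|/ABE /andP[h1 h2]].
  by rewrite gt_min ue lt_max ew.
by rewrite gt_min h1 orbT lt_max h2 orbT.
Qed.

End intervals.

(** * Passage from smooth to continuous functions, and back to continuity *)

Section limits.
Variable R : realType.
Local Notation C := R[i].

Section limits.
Variables (T : Type) (F : set_system T).
Context {FF : Filter F}.

Lemma dd_cvg k (t : nat -> R) (g : T -> nat -> R) (g0 : nat -> R) :
  (forall l, (l <= k)%N -> g x l @[x --> F] --> g0 l) ->
  dd k t (g x) @[x --> F] --> dd k t g0.
Proof.
elim: k t g g0 => [|k IH] t g g0 H; first exact: H.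
apply: cvgMr; apply: cvgB; first by apply: IH => l lk; apply: H; exact: leqW.
by apply: (IH (shift t) (fun x => shift (g x))) => l lk; exact: H.
Qed.

Lemma sum_cvg (J : Type) (r : seq J) (g : J -> T -> R) (g0 : J -> R) :
  (forall i, g i x @[x --> F] --> g0 i) ->
  (\sum_(i <- r) g i x) @[x --> F] --> \sum_(i <- r) g0 i.
Proof.
move=> H; elim: r => [|i r IH].
  by rewrite big_nil; under eq_fun do rewrite big_nil; exact: cvg_cst.
by rewrite big_cons; under eq_fun do rewrite big_cons; apply: cvgD.
Qed.

Lemma qf_cvg n (G : T -> R -> R) f (U : 'M[C]_n) d v :
  (forall i, G x (d i) @[x --> F] --> f (d i)) ->
  qf (G x) U d v @[x --> F] --> qf f U d v.
Proof. by move=> H; apply: sum_cvg => i; apply: cvgMl. Qed.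

Lemma remainder_cvg k s (G : T -> R -> R) f y :
  (forall j, (j <= k)%N -> G x (s j) @[x --> F] --> f (s j)) ->
  G x y @[x --> F] --> f y ->
  remainder k s (G x) y @[x --> F] --> remainder k s f y.
Proof.
by move=> Hs Hy; apply: dd_cvg => j jk; apply: cvgMl; apply: cvgB => //; exact: Hs.
Qed.

End limits.

Lemma cvg_ge0 (g : nat -> R) l : g n @[n --> \oo] --> l -> (forall n, 0 <= g n) -> 0 <= l.
Proof.
move=> gl g0; rewrite -(cvg_lim _ gl) //; apply: limr_ge; first by apply/cvg_ex; exists l.
exact: nearW.
Qed.

Lemma smooth_approx k (f : R -> R) (A B u w : R) : A < u -> u < w -> w < B ->
  (forall x, A < x < B -> {for x, continuous f}) ->
  mtone k f [set x | A < x < B] ->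
  exists F : nat -> R -> R, (forall n, exists F1 L,
     smooth_on (F n) F1 u w L /\ mtone k (F n) [set x | u < x < w]) /\
   forall y, u < y < w -> F n y @[n --> \oo] --> f y.
Proof.
move=> Au uw wB fc ft.
(* [smoothing] loses 4 del at each end; this makes the loss fit into the gaps between [u, w] and
   [A, B]. *)
pose e0 := Num.min (u - A) (B - w) / 4.
have e00 : 0 < e0 by rewrite divr_gt0 // lt_min !subr_gt0 Au wB.
have e01 : 4 * e0 <= u - A by rewrite /e0 mulrCA divff ?mulr1 // ge_min lexx.
have e02 : 4 * e0 <= B - w by rewrite /e0 mulrCA divff ?mulr1 // ge_min lexx orbT.
pose de n : R := e0 / n.+1%:R.
have de0 n : 0 < de n by rewrite divr_gt0 // ltr0n.
have dee n : de n <= e0 by rewrite ler_pdivrMr ?ltr0n // ler_peMr ?ler1n // ltW.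
have /choice[F FE] n : exists F, exists F1 L, [/\ smooth_on F F1 u w L,
     mtone k F [set x | u < x < w] &
     forall x, u < x < w -> exists2 z, `|z - x| < 2 * de n & F x = f z].
  have h := dee n.
  have [|F [F1 [L [Fs Ft Ff]]]] := smoothing (de0 n) _ fc ft; first by lra.
  have sub y : u < y < w -> A + 4 * de n < y < B - 4 * de n.
    by move=> /andP[h1 h2]; apply/andP; split; lra.
  exists F, F1, L; split.
  - by move=> y z yb zb; apply: Fs; exact: sub.
  - by apply: mtoneS Ft => y; exact: sub.
  - by move=> x xb; apply: Ff; exact: sub.
exists F; split.
  by move=> n; have [F1 [L [h1 h2 _]]] := FE n; exists F1, L.
move=> y /andP[uy yw]; apply/cvgrPdist_le => eps eps0.
have yb : A < y < B by rewrite (lt_trans Au uy) (lt_trans yw wB).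
have /cvgrPdist_le/(_ _ eps0)/nbhs_ballP[r /= r0 rE] := fc y yb.
have dcv : de n @[n --> \oo] --> (0 : R).
  by rewrite -(mulr0 e0); apply: cvgMr; exact: cvg_harmonic.
have r2 : 0 < r / 2 by rewrite divr_gt0.
move/cvgrPdist_lt/(_ _ r2): dcv => dcv.
near=> n; have [F1 [L [_ _ Ff]]] := FE n.
have [|z zy ->] := Ff y; first by rewrite uy yw.
apply: rE; rewrite /ball /= distrC; apply: lt_trans zy _.
have : `|0 - de n| < r / 2 by near: n.
by rewrite sub0r normrN (gtr0_norm (de0 n)); lra.
Unshelve. all: by end_near.
Qed.

Variables a b : \bar R.
Hypothesis ab : (a < b)%E.
Local Notation I := (ointerval a b).

(** Each instance of either conclusion is a weak linear inequality between finitely many values of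
    f, so it passes to the limit from the smooth approximations. *)
Lemma continuous_mtone_harnack k (f : R -> R) :
  (forall x, I x -> {for x, continuous f}) -> mtone k.+1 f I ->
  mtone k.+3 f I /\ harnack k f I.
Proof.
move=> fc ft.
have fAB A B : I A -> I B -> (forall x, A < x < B -> {for x, continuous f}) /\
    mtone k.+1 f [set x | A < x < B].
  move=> IA IB; have sub x : A < x < B -> I x.
    by move=> /andP[h1 h2]; apply: (ointerval_convex IA IB); rewrite !ltW.
  by split=> [x /sub /fc //|]; apply: mtoneS ft => x; exact: sub.
split.
  move=> n M D U d v t Dp tS Xd dI.
  pose E := [seq d (val l) i | l <- enum 'I_k.+4, i <- enum 'I_n].
  have inE l i : (l <= k.+3)%N -> d l i \in E.
    move=> lk; apply/allpairsP.
    by exists (Ordinal (lk : (l < k.+4)%N), i); rewrite !mem_enum.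
  have EI y : y \in E -> I y.
    by move=> /allpairsP [[l i] [_ _ ->]] /=; apply: dI; rewrite -ltnS ltn_ord.
  have [u [w [Iu Iw uw uwE]]] := seq_inside ab EI.
  have [A IA Au] := ointerval_below Iu; have [B IB wB] := ointerval_above Iw.
  have [fcAB ftAB] := fAB A B IA IB.
  have [F [Fs Ff]] := smooth_approx Au uw wB fcAB ftAB.
  apply: cvg_ge0 (_ : dd k.+3 t (fun l => qf (F m) (U l) (d l) v) @[m --> \oo] --> _) _.
    apply: (@dd_cvg _ _ _ _ _ (fun m l => qf (F m) (U l) (d l) v)) => l lk.
    by apply: qf_cvg => i; apply: Ff; apply: uwE; exact: inE.
  move=> m; have [F1 [L [Fsm Ftm]]] := Fs m.
  apply: (smooth_mtone Fsm Ftm v Dp tS Xd) => l i lk.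
  by apply: uwE; exact: inE.
move=> lo hi s y z Ilo Ihi sb sS yb zb yz ys zs.
have [u Iu ulo] := ointerval_below Ilo; have [w Iw hiw] := ointerval_above Ihi.
have [A IA Au] := ointerval_below Iu; have [B IB wB] := ointerval_above Iw.
have lohi : lo < hi by case/andP: yb => h1 h2; exact: lt_trans h2.
have uw : u < w by apply: lt_trans ulo (lt_trans lohi hiw).
have [fcAB ftAB] := fAB A B IA IB.
have [F [Fs Ff]] := smooth_approx Au uw wB fcAB ftAB.
have sub x : lo < x < hi -> u < x < w.
  by move=> /andP[h1 h2]; rewrite (lt_trans ulo h1) (lt_trans h2 hiw).
have rc x : lo < x < hi -> remainder k s (F m) x @[m --> \oo] --> remainder k s f x.
  by move=> xb; apply: remainder_cvg => [j jk|]; apply: Ff; apply: sub => //; exact: sb.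
have FH m : 0 <= remainder k s (F m) y <=
    ((hi - z) / (hi - y) + (z - lo) / (y - lo)) * remainder k s (F m) z.
  have [F1 [L [Fsm Ftm]]] := Fs m.
  apply: (smooth_harnack Fsm Ftm) => //=.
    by rewrite ulo (lt_trans lohi hiw).
  by rewrite hiw (lt_trans ulo lohi).
apply/andP; split.
  by apply: (cvg_ge0 (rc y yb)) => m; case/andP: (FH m).
rewrite -subr_ge0; move: FH; set Q := (_ / _ + _) => FH.
apply: (@cvg_ge0 (fun m => Q * remainder k s (F m) z - remainder k s (F m) y)).
  by apply: cvgB; [apply: cvgMr; exact: rc|exact: rc].
by move=> m; rewrite subr_ge0; case/andP: (FH m).
Qed.

(** Take x as the first node. Newton's formula gives f(y) - f(x) = p(y) - p(x) + nodal(y)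
    remainder(y); Harnack bounds remainder(y) by a locally bounded multiple of its value at a fixed
    z, and nodal(y) tends to nodal(x) = 0. *)
Lemma harnack_continuous k (f : R -> R) x : harnack k f I -> I x ->
  {for x, continuous f}.
Proof.
move=> fH Ix; have [lo Ilo lox] := ointerval_below Ix.
have [hi Ihi xhi] := ointerval_above Ix.
pose h := (hi - x) / k.+3%:R.
have k3 : 0 < k.+3%:R :> R by rewrite ltr0n.
have h0 : 0 < h by rewrite divr_gt0 // subr_gt0.
have hE : h * k.+3%:R = hi - x by rewrite divfK // gt_eqF.
pose s j := x + h * j%:R; pose z := x + h * k.+1%:R.
have sh j : (j < k.+3)%N -> lo < x + h * j%:R < hi.
  move=> jk; have hj : 0 <= h * j%:R by rewrite mulr_ge0 // ltW.
  rewrite (lt_le_trans lox) ?lerDl //=.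
  by rewrite -ltrBrDl -hE ltr_pM2l // ltr_nat.
have sb : forall j, (j <= k)%N -> lo < s j < hi.
  by move=> j jk; apply: sh; exact: leq_trans jk (leqW (leqnSn k)).
have zb : lo < z < hi by apply: sh; exact: leqnSn.
have sS j : (j < k)%N -> s j < s j.+1.
  by move=> jk; rewrite ltrD2l ltr_pM2l // ltr_nat.
have zs j : (j <= k)%N -> z != s j.
  by move=> jk; rewrite gt_eqF // ltrD2l ltr_pM2l // ltr_nat ltnS.
have [p [_ pi pE]] := remainderE f (incr_distinct sS).
have s0 : s 0%N = x by rewrite /s mulr0 addr0.
have px : p.[x] = f x by rewrite -s0 pi.
have wx : (nodal k.+1 s).[x] = 0.
  by rewrite nodalE big_ord_recl s0 subrr mul0r.
pose Q y := (hi - z) / (hi - y) + (z - lo) / (y - lo).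
pose r := remainder k s f z.
pose Bd y := `|p.[y] - p.[x]| + `|(nodal k.+1 s).[y]| * (Q y * r).
have pc (q : {poly R}) : q.[y] @[y --> x] --> q.[x] by exact: continuous_horner.
have Bc : Bd y @[y --> x] --> (0 : R).
  have -> : 0 = `|p.[x] - p.[x]| + `|(nodal k.+1 s).[x]| * (Q x * r).
    by rewrite wx subrr normr0 mul0r addr0.
  apply: cvgD; first by apply: cvg_norm; apply: cvgB => //; exact: cvg_cst.
  apply: cvgM; first exact: cvg_norm.
  apply: cvgMl; apply: cvgD; apply: cvgMr; apply: cvgV.
  - by rewrite subr_eq0 gt_eqF.
  - by apply: cvgB; [exact: cvg_cst|exact: cvg_id].
  - by rewrite subr_eq0 gt_eqF.
  - by apply: cvgB; [exact: cvg_id|exact: cvg_cst].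
apply/cvgrPdist_le => eps eps0.
move/cvgrPdist_le/(_ _ eps0) : Bc => Bc.
near=> y.
(* Within the step h of x, the point y meets neither z nor a node other than x. *)
have yx : `|x - y| < h.
  by near: y; apply: cvgr_dist_lt h0; exact: cvg_id.
have yb : lo < y < hi.
  apply/andP; split; near: y.
    by apply: cvgr_gt lox; exact: cvg_id.
  by apply: cvgr_lt xhi; exact: cvg_id.
have By : `|0 - Bd y| <= eps by near: y.
have [->|ynx] := eqVneq y x; first by rewrite subrr normr0 ltW.
have ys j : (j <= k.+1)%N -> y != x + h * j%:R.
  case: j => [|j] jk; first by rewrite mulr0 addr0.
  rewrite lt_eqF // (lt_le_trans (_ : y < x + h)) //.
    by move: yx; rewrite distrC ltr_norml => /andP[_]; lra.
  by rewrite lerD2l ler_peMr ?ler1n // ltW.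
have /andP[r0 r1] := fH lo hi s y z Ilo Ihi sb sS yb zb (ys k.+1 (leqnn _))
  (fun j jk => ys j (leqW jk)) zs.
have {}By : Bd y <= eps by apply: le_trans By; rewrite sub0r normrN ler_norm.
apply: le_trans By; rewrite distrC -px (pE y (fun j jk => ys j (leqW jk))).
rewrite addrAC /Bd; apply: le_trans (ler_normD _ _) _.
by rewrite lerD2l normrM ler_wpM2l // (ger0_norm r0).
Unshelve. all: by end_near.
Qed.

End limits.

(** * Operators on a Hilbert space *)

Section hilbert.
Variables (R : realType) (H : completeNormedModType R[i])
  (dot : {dot H for (@Num.conj R[i])}).
Hypothesis Hdot : norm_of_dot dot.
Local Notation C := R[i].
Implicit Types (x y : H) (X Y T E : H -> H) (c : C).

Lemma conjR (r : R) : Num.conj (r%:C : C) = r%:C.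
Proof. by apply: (CrealP _); rewrite complex_real. Qed.

Lemma ipDl x y z : dot (x + y) z = dot x z + dot y z.
Proof. exact: linearDl. Qed.

Lemma ipBl x y z : dot (x - y) z = dot x z - dot y z.
Proof. exact: linearBl. Qed.

Lemma ipDr x y z : dot z (x + y) = dot z x + dot z y.
Proof. exact: linearDr. Qed.

Lemma ipBr x y z : dot z (x - y) = dot z x - dot z y.
Proof. exact: linearBr. Qed.

Lemma ipZl c x y : dot (c *: x) y = c * dot x y.
Proof. exact: linearZl_LR. Qed.

Lemma ipZr c x y : dot y (c *: x) = Num.conj c * dot y x.
Proof. exact: linearZr_LR. Qed.

Lemma ip0l x : dot 0 x = 0. Proof. exact: linear0l. Qed.
Lemma ip0r x : dot x 0 = 0. Proof. exact: linear0r. Qed.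

Lemma ipC x y : dot x y = Num.conj (dot y x).
Proof. by rewrite hermC expr0 mul1r. Qed.

Lemma ip_suml (I : Type) (r : seq I) (F : I -> H) y :
  dot (\sum_(i <- r) F i) y = \sum_(i <- r) dot (F i) y.
Proof. exact: linear_sumlz. Qed.

Lemma ip_sumr (I : Type) (r : seq I) (F : I -> H) y :
  dot y (\sum_(i <- r) F i) = \sum_(i <- r) dot y (F i).
Proof. exact: linear_sumr. Qed.

Lemma ip_ge0 x : 0 <= dot x x.
Proof. by rewrite -Hdot exprn_ge0. Qed.

Definition n2 x : R := complex.Re (dot x x).

Lemma n2E x : (n2 x)%:C = dot x x. Proof. exact/Re_nonneg/ip_ge0. Qed.

Lemma n2_ge0 x : 0 <= n2 x. Proof. by rewrite -ler0c n2E ip_ge0. Qed.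

Lemma normE x : `|x| = (Num.sqrt (n2 x))%:C.
Proof.
apply/eqP; rewrite -(@eqrXn2 _ 2) // ?ler0c ?sqrtr_ge0 //.
by rewrite Hdot -rmorphXn /= sqr_sqrtr ?n2_ge0 // n2E.
Qed.

Lemma n2_eq0 x : n2 x = 0 -> x = 0.
Proof. by move=> x0; apply/normr0_eq0; rewrite normE x0 sqrtr0. Qed.

Lemma n2_0 : n2 0 = 0. Proof. by rewrite /n2 ip0l. Qed.

Lemma normr_le_n2 (e : R) x y : 0 <= e ->
  (`|x| <= e%:C * `|y|) <-> n2 x <= e ^+ 2 * n2 y.
Proof.
move=> e0; rewrite !normE -rmorphM lecR.
have -> : e * Num.sqrt (n2 y) = Num.sqrt (e ^+ 2 * n2 y).
  by rewrite sqrtrM ?sqr_ge0 // sqrtr_sqr ger0_norm.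
by split=> [|h]; [rewrite ler_psqrt ?nnegrE ?n2_ge0 // mulr_ge0 ?sqr_ge0 ?n2_ge0|
  exact: ler_wsqrtr].
Qed.

Section linear_maps.
Variable T : H -> H.
Hypothesis Tl : linear T.

Lemma linD x y : T (x + y) = T x + T y.
Proof. by rewrite -[x in LHS]scale1r Tl scale1r. Qed.

Lemma lin0 : T 0 = 0.
Proof.
have := linD 0 0; rewrite addr0 => /eqP.
by rewrite -subr_eq0 opprD addrA subrr sub0r oppr_eq0 => /eqP.
Qed.

Lemma linZ c x : T (c *: x) = c *: T x.
Proof. by rewrite -[c *: x]addr0 Tl lin0 addr0. Qed.

Lemma linN x : T (- x) = - T x.
Proof. by rewrite -scaleN1r linZ scaleN1r. Qed.

Lemma linB x y : T (x - y) = T x - T y.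
Proof. by rewrite linD linN. Qed.

Lemma lin_sum (I : Type) (r : seq I) (F : I -> H) :
  T (\sum_(i <- r) F i) = \sum_(i <- r) T (F i).
Proof.
by elim: r => [|i r IH]; rewrite ?big_nil ?lin0 // !big_cons linD IH.
Qed.
End linear_maps.

Definition sa T := linear T /\ selfadjoint dot T.

Definition qd T x : R := complex.Re (dot (T x) x).

Lemma qdE T x : sa T -> (qd T x)%:C = dot (T x) x.
Proof.
move=> [Tl Ts]; apply: RRe_real; apply/CrealP.
by rewrite -ipC -Ts.
Qed.

Lemma qd0 T : linear T -> qd T 0 = 0.
Proof. by move=> Tl; rewrite /qd ip0r. Qed.

(** Positivity of the form at a x + c y, with c a negative real multiple of <E x, y>. The form may
    be degenerate, so the choice of a and c depends on which of its values at x and y vanish. *)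
Lemma psd_cauchy_schwarz E x y : sa E -> (forall x, 0 <= qd E x) ->
  `|dot (E x) y| ^+ 2 <= (qd E x * qd E y)%:C.
Proof.
move=> [El Es] Ep; set m := dot (E x) y.
have key (a : R) (c : C) : 0 <= a ^+ 2 * qd E x + qd E y * complex.Re (`|c| ^+ 2)
   + 2 * a * complex.Re (Num.conj c * m).
  have h := Ep (a%:C *: x + c *: y).
  apply: le_trans h _; rewrite le_eqVlt; apply/orP; left; apply/eqP.
  rewrite /qd (linD El) !(linZ El) ipDl !ipDr !ipZl !ipZr conjR.
  have -> : dot (E y) x = Num.conj m by rewrite /m ipC -Es.
  rewrite -!(qdE _ (conj El Es)) -/m normCK.
  have -> : c * (a%:C * Num.conj m) = Num.conj (a%:C * (Num.conj c * m)).
    by rewrite !rmorphM /= conjCK conjR; ring.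
  have Rc (z : C) : complex.Re (Num.conj z) = complex.Re z.
    by rewrite conj_conjc; case: z.
  rewrite !raddfD /= -!/(complex.Re _) Rc !Re_mul_real.
  have -> : c * (Num.conj c * (qd E y)%:C) = (qd E y)%:C * (c * Num.conj c) by ring.
  rewrite Re_mul_real /=; ring.
have n0 (z : C) : complex.Re (`|z| ^+ 2) = 0 -> z = 0.
  rewrite -add_Re2_Im2 /= => /eqP; rewrite paddr_eq0 ?sqr_ge0 // !sqrf_eq0.
  by case: z => u v /= /andP[/eqP -> /eqP ->].
have mm (r : R) : complex.Re (Num.conj (- (r%:C * m)) * m) = - (r * complex.Re (`|m| ^+ 2)).
  rewrite rmorphN rmorphM /= conjR mulNr -mulrA [Num.conj m * m]mulrC -normCK.
  have -> (z : C) : complex.Re (- z) = - complex.Re z by case: z.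
  by rewrite Re_mul_real.
have mr (r : R) : complex.Re (`|- (r%:C * m)| ^+ 2) = r ^+ 2 * complex.Re (`|m| ^+ 2).
  rewrite normrN normrM exprMn.
  have -> : `|r%:C : C| ^+ 2 = (r ^+ 2)%:C by rewrite normCK conjR -rmorphM expr2.
  exact: Re_mul_real.
have Em : `|m| ^+ 2 = (complex.Re (`|m| ^+ 2))%:C by rewrite -add_Re2_Im2.
rewrite Em lecR; set M := complex.Re _ in mm mr *.
have M0 : 0 <= M by rewrite -lecR -Em exprn_ge0.
have [y0|y0] := eqVneq (qd E y) 0; last first.
  have yp : 0 < qd E y by rewrite lt0r y0 Ep.
  have := key (qd E y) (- (1%:C * m)); rewrite mr mm.
  by rewrite expr1n => h; rewrite -(ler_pM2l yp); nra.
have [x0|x0] := eqVneq (qd E x) 0.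
  by have := key 1 (- (1%:C * m)); rewrite mr mm x0 y0 !mul0r !mulr0 !add0r mul1r mulr1 mulrN oppr_ge0 pmulr_rle0.
have xp : 0 < qd E x by rewrite lt0r x0 Ep.
rewrite y0 mulr0 leNgt; apply/negP => Mp.
have := key 1 (- ((qd E x / M)%:C * m)); rewrite mr mm y0 mul0r addr0.
rewrite divfK ?gt_eqF // expr1n !mul1r mulr1 mulrN; apply/negP; rewrite -ltNge.
by move: xp; clear; lra.
Qed.

(** Cauchy-Schwarz for the form of E at x and E x bounds |E x|^4 by <E x, x> <E E x, E x>, whose
    last factor is at most g |E x|^2. *)
Lemma psd_norm E g : sa E -> (forall x, 0 <= qd E x <= g * n2 x) ->
  forall x, n2 (E x) <= g * qd E x.
Proof.
move=> Es Ep x.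
have := @psd_cauchy_schwarz E x (E x) Es (fun x => proj1 (andP (Ep x))).
rewrite -n2E; have -> : `|(n2 (E x))%:C : C| ^+ 2 = (n2 (E x) ^+ 2)%:C.
  by rewrite ger0_norm ?ler0c ?n2_ge0 // rmorphXn.
rewrite lecR => h; have [q0 q1] := andP (Ep x); have [q2 q3] := andP (Ep (E x)).
have := n2_ge0 (E x); rewrite le_eqVlt => /orP[/eqP z|zp].
  rewrite -z; have [g0|g0] := leP 0 g; first by rewrite mulr_ge0.
  have := n2_ge0 x => nx; have : qd E x = 0 by nra.
  by move=> ->; rewrite mulr0.
rewrite -(ler_pM2l zp) -expr2; apply: le_trans h _.
have -> : n2 (E x) * (g * qd E x) = qd E x * (g * n2 (E x)) by ring.
by rewrite ler_wpM2l.
Qed.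

End hilbert.

(** * Coercive operators and completeness *)

Section inverse.
Variables (R : realType) (H : completeNormedModType R[i])
  (dot : {dot H for (@Num.conj R[i])}).
Hypothesis Hdot : norm_of_dot dot.
Local Notation C := R[i].
Local Notation n2 := (n2 dot).
Local Notation qd := (qd dot).
Local Notation sa := (sa dot).
Implicit Types (x y : H) (X Y T E : H -> H) (c : C).

Lemma complex_gt0 (z : C) : 0 < z -> exists2 r : R, 0 < r & z = r%:C.
Proof.
move=> z0; exists (complex.Re z); last by rewrite Re_nonneg // ltW.
by rewrite -ltcR Re_nonneg // ltW.
Qed.

Lemma bounded_operator_n2 T : bounded_operator T ->
  exists2 K : R, 0 <= K & forall x, n2 (T x) <= K ^+ 2 * n2 x.
Proof.
move=> [Tl Tc].
pose f : {linear H -> H} := HB.pack T (GRing.isLinear.Build _ _ _ _ T Tl).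
have /linear_boundedP/pinfty_ex_gt0[r r0 rE] : bounded_near f (nbhs 0).
  by apply: continuous_linear_bounded; exact: Tc.
have [K K0 KE] := complex_gt0 r0; exists K; first exact: ltW.
by move=> x; apply/(normr_le_n2 Hdot _ _ (ltW K0)); rewrite -KE; exact: rE.
Qed.

Lemma n2_bounded_operator T (K : R) : linear T -> 0 <= K ->
  (forall x, n2 (T x) <= K ^+ 2 * n2 x) -> bounded_operator T.
Proof.
move=> Tl K0 KE; split=> //.
pose f : {linear H -> H} := HB.pack T (GRing.isLinear.Build _ _ _ _ T Tl).
suff : continuous f by [].
apply: bounded_linear_continuous; apply/linear_boundedP.
exists K%:C; split; first by rewrite complex_real.
move=> r Kr x; apply: le_trans (_ : K%:C * `|x| <= _).
  exact/(normr_le_n2 Hdot _ _ K0).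
by rewrite ler_wpM2r // ltW.
Qed.

(** Completeness of [H] enters here, for both the inversion of coercive operators and the functional
    calculus. *)
Lemma geometric_cvg (u : nat -> H) (c q : R) : 0 <= c -> 0 <= q < 1 ->
  (forall n, `|u n.+1 - u n| <= (c * q ^+ n)%:C) ->
  exists l, forall n, `|l - u n| <= (c * q ^+ n / (1 - q))%:C.
Proof.
move=> c0 /andP[q0 q1] uE; have q1' : 0 < 1 - q by rewrite subr_gt0.
have um n m : `|u (n + m)%N - u n| <= (c * q ^+ n * (1 - q ^+ m) / (1 - q))%:C.
  elim: m => [|m IH]; first by rewrite addn0 subrr normr0 expr0 subrr mulr0 mul0r.
  have -> : u (n + m.+1)%N - u n = (u (n + m).+1 - u (n + m)%N) + (u (n + m)%N - u n).
    by rewrite addnS addrA subrK.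
  apply: le_trans (ler_normD _ _) _; apply: le_trans (lerD (uE _) IH) _.
  rewrite -rmorphD lecR le_eqVlt; apply/orP; left; apply/eqP.
  by rewrite exprD exprS; field; rewrite gt_eqF.
have ub n m : `|u (n + m)%N - u n| <= (c * q ^+ n / (1 - q))%:C.
  apply: le_trans (um n m) _; rewrite lecR ler_wpM2r ?invr_ge0 ?(ltW q1') //.
  by rewrite ler_piMr ?mulr_ge0 ?exprn_ge0 // gerBl exprn_ge0.
have small (e : R) : 0 < e -> exists n, c * q ^+ n / (1 - q) < e.
  move=> e0; have : c / (1 - q) * q ^+ n @[n --> \oo] --> (0 : R).
    by rewrite -(mulr0 (c / (1 - q))); apply: cvgMr; apply: cvg_expr; rewrite ger0_norm.
  move/cvgrPdist_lt/(_ _ e0) => [N _ NE]; exists N.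
  have := NE N (leqnn N); rewrite /= sub0r normrN => /(le_lt_trans (ler_norm _)).
  by rewrite mulrAC.
have uc : cvg (u n @[n --> \oo]).
  apply/cauchy_cvgP; apply: cauchy_exP => e e0.
  have [r r0 rE] := complex_gt0 e0; have [n nE] := small r r0.
  exists (u n); exists n => // m /= nm; rewrite -ball_normE /= distrC.
  rewrite -(subnKC nm) rE; apply: le_lt_trans (ub _ _) _; by rewrite ltcR.
exists (lim (u n @[n --> \oo])) => n.
apply/ler_addgt0Pr => e e0; set l := lim _.
have := uc => /cvgrPdist_lt/(_ _ e0)[N _ NE].
have -> : l - u n = (l - u (n + N)%N) + (u (n + N)%N - u n) by rewrite addrA subrK.
apply: le_trans (ler_normD _ _) _; rewrite addrC; apply: lerD; first exact: ub.
by apply/ltW/NE; rewrite /= leq_addl.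
Qed.

Lemma sa_id : sa id. Proof. by split=> // x y. Qed.

Lemma qd_id x : qd id x = n2 x. Proof. by []. Qed.

Lemma cauchy_schwarz_n2 x y : (complex.Re (dot x y)) ^+ 2 <= n2 x * n2 y.
Proof.
have := @psd_cauchy_schwarz _ _ dot id x y sa_id (n2_ge0 Hdot).
rewrite -lecR !qd_id; apply: le_trans.
by rewrite -add_Re2_Im2 lecR lerDl sqr_ge0.
Qed.

Lemma coercive_lower E (a : R) : 0 < a -> (forall x, a * n2 x <= qd E x) ->
  forall x, a ^+ 2 * n2 x <= n2 (E x).
Proof.
move=> a0 Ea x; have := cauchy_schwarz_n2 (E x) x; rewrite -/(qd E x) => h.
have nx := n2_ge0 Hdot x; have nE := n2_ge0 Hdot (E x).
move: nx; rewrite le_eqVlt => /orP[/eqP z|zp]; first by rewrite -z mulr0.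
rewrite -(ler_pM2r zp); apply: le_trans h.
rewrite -mulrA -expr2 -exprMn ler_pXn2r ?nnegrE ?mulr_ge0 ?(ltW zp) ?(ltW a0) //.
by apply: le_trans (Ea x); rewrite mulr_ge0 ?(ltW zp) ?(ltW a0).
Qed.

(** Richardson iteration: T = 1 - E/b' satisfies 0 <= T <= q with q < 1, so [psd_norm] makes it a
    contraction, and a fixed point of x -> T x + y/b' solves E x = y. *)
Lemma coercive_surj E (a b : R) : sa E -> 0 < a ->
  (forall x, a * n2 x <= qd E x <= b * n2 x) -> forall y, exists x, E x = y.
Proof.
move=> Es a0 Eab y; have [El Esa] := Es.
(* The maximum covers H = 0, where nothing forces a <= b. *)
pose b' := Num.max a b; have b'0 : 0 < b' by rewrite lt_max a0.
have Eb' x : qd E x <= b' * n2 x.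
  case/andP: (Eab x) => _ /le_trans; apply; rewrite ler_wpM2r ?n2_ge0 //.
  by rewrite le_max lexx orbT.
pose q := 1 - a / b'.
have q01 : 0 <= q < 1.
  rewrite subr_ge0 ler_pdivrMr // mul1r le_max lexx /=.
  by rewrite gtrBl divr_gt0.
pose T x := x - (b'^-1)%:C *: E x.
have Tl : linear T.
  move=> c u v; rewrite /T El scalerBr.
  rewrite [_ *: (c *: E u + E v)]scalerDr opprD addrACA !scalerA.
  by rewrite [c * _]mulrC.
have Ts : sa T.
  split=> // u v; rewrite /T ipBl ipBr ipZl ipZr conjR Esa //.
have qT x : qd T x = n2 x - qd E x / b'.
  apply: (@complexI R); rewrite (qdE _ Ts) /T ipBl ipZl -(n2E Hdot) -(qdE _ Es).
  by rewrite -rmorphM -rmorphB mulrC.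
have T01 x : 0 <= qd T x <= q * n2 x.
  rewrite qT; have /andP[h1 _] := Eab x; have h2 := Eb' x; apply/andP; split.
    by rewrite subr_ge0 ler_pdivrMr // mulrC.
  by rewrite /q mulrBl mul1r lerD2l lerN2 mulrAC ler_pdivlMr // divfK ?gt_eqF.
have Tn x : n2 (T x) <= q ^+ 2 * n2 x.
  apply: le_trans (psd_norm Hdot Ts T01 x) _; rewrite expr2 -mulrA ler_wpM2l //.
    by case/andP: q01.
  by case/andP: (T01 x).
have q0 : 0 <= q by case/andP: q01.
have TN x : `|T x| <= q%:C * `|x| by apply/(normr_le_n2 Hdot _ _ q0).
pose z := (b'^-1)%:C *: y.
pose u := fix u n := if n is n'.+1 then T (u n') + z else 0.
pose K := Num.sqrt (n2 (u 1%N)).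
have uS n : u n.+1 = T (u n) + z by [].
have [l lE] : exists l, forall n, `|l - u n| <= (K * q ^+ n / (1 - q))%:C.
  apply: geometric_cvg => //; first exact: sqrtr_ge0.
  elim=> [|n IH]; first by rewrite subr0 expr0 mulr1 (normE Hdot).
  rewrite !uS opprD addrACA subrr addr0 -(linB Tl).
  apply: le_trans (TN _) _; rewrite exprS mulrCA rmorphM ler_wpM2l // ler0c //.
have Tfix : l = T l + z.
  apply/eqP; rewrite -subr_eq0 -normr_eq0 eq_le normr_ge0 andbT.
  apply/ler_addgt0Pr => e /complex_gt0[r r0 ->]; rewrite add0r.
  have [N NE] : exists n, K * q ^+ n / (1 - q) < r / 2.
    have r2 : 0 < r / 2 by rewrite divr_gt0.
    have : K / (1 - q) * q ^+ n @[n --> \oo] --> (0 : R).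
      rewrite -(mulr0 (K / (1 - q))); apply: cvgMr; apply: cvg_expr.
      by rewrite ger0_norm //; case/andP: q01.
    move/cvgrPdist_lt/(_ _ r2) => [N _ NE]; exists N.
    have := NE N (leqnn N); rewrite /= sub0r normrN => /(le_lt_trans (ler_norm _)).
    by rewrite mulrAC.
  have -> : l - (T l + z) = (l - u N.+1) + T (u N - l).
    rewrite uS (linB Tl); move: (T l) (T (u N)) => p p2.
    by rewrite !opprD !addrA [l - _ - z + _]addrAC subrK addrAC.
  apply: le_trans (ler_normD _ _) _.
  have h1 : `|l - u N.+1| <= (r / 2)%:C.
    apply: le_trans (lE _) _; rewrite lecR; apply: le_trans (ltW NE).
    have /andP[_ q1] := q01.
    rewrite ler_wpM2r ?invr_ge0 ?subr_ge0 ?(ltW q1) // ler_wpM2l ?sqrtr_ge0 //.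
    by rewrite exprS ler_piMl ?exprn_ge0 // ltW.
  have h2 : `|T (u N - l)| <= (r / 2)%:C.
    apply: le_trans (TN _) _; rewrite distrC; apply: le_trans (_ : 1 * `|l - u N| <= _).
      by rewrite ler_wpM2r // -[1](rmorph1 (real_complex R)) lecR ltW //; case/andP: q01.
    by rewrite mul1r; apply: le_trans (lE _) _; rewrite lecR ltW.
  apply: le_trans (lerD h1 h2) _; rewrite -rmorphD lecR.
  by rewrite -splitr.
exists l; have : (b'^-1)%:C *: E l = z.
  apply/eqP; rewrite -subr_eq0 -oppr_eq0 opprB.
  have -> : z - (b'^-1)%:C *: E l = (T l + z) - l 
    by rewrite /T addrAC [l - _ - l]addrAC subrr add0r addrC.
  by rewrite -Tfix subrr.
rewrite /z => /eqP; rewrite -subr_eq0 -scalerBr scaler_eq0 subr_eq0.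
case/orP => /eqP // /complexI/eqP; by rewrite invr_eq0 gt_eqF.
Qed.

End inverse.

(** * Spectrum and numerical range of self-adjoint operators *)

Section spectrum.
Variables (R : realType) (H : completeNormedModType R[i])
  (dot : {dot H for (@Num.conj R[i])}).
Hypothesis Hdot : norm_of_dot dot.
Local Notation C := R[i].
Local Notation n2 := (n2 dot).
Local Notation qd := (qd dot).
Local Notation sa := (sa dot).
Implicit Types (x y : H) (X Y T E : H -> H) (c : C).

Lemma ipNl x y : dot (- x) y = - dot x y.
Proof. by rewrite -scaleN1r ipZl mulN1r. Qed.

Lemma ipNr x y : dot y (- x) = - dot y x.
Proof. by rewrite -scaleN1r ipZr rmorphN1 mulN1r. Qed.

Lemma coercive_invertible E (a b : R) : sa E -> 0 < a ->
  (forall x, a * n2 x <= qd E x <= b * n2 x) -> invertible_operator E.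
Proof.
move=> Es a0 Eab; have [El _] := Es.
have /choice[S SE] := coercive_surj Hdot Es a0 Eab.
have Elow : forall x, a ^+ 2 * n2 x <= n2 (E x).
  by apply: coercive_lower => // x; case/andP: (Eab x).
have a2 : 0 < a ^+ 2 by rewrite exprn_gt0.
have Einj : injective E.
  move=> x y xy; apply/eqP; rewrite -subr_eq0; apply/eqP/(n2_eq0 Hdot)/eqP.
  rewrite eq_le n2_ge0 // andbT -(ler_pM2l a2) mulr0; apply: le_trans (Elow _) _.
  by rewrite (linB El) xy subrr n2_0.
have SK : cancel E S by move=> x; apply: Einj; rewrite SE.
exists S; split=> //.
apply: (n2_bounded_operator Hdot (K := a^-1)); last 2 first.
- by rewrite invr_ge0 ltW.
- by move=> x; rewrite exprVn -ler_pdivrMl ?invr_gt0 // invrK -{2}(SE x).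
by move=> c x y; apply: Einj; rewrite El !SE.
Qed.

(** Boundedness of the inverse bounds |x|^2 by a multiple of |E x|^2, which [psd_norm] bounds by a
    multiple of <E x, x>. *)
Lemma invertible_coercive E (g : R) : sa E -> (forall x, 0 <= qd E x <= g * n2 x) ->
  invertible_operator E -> exists2 a : R, 0 < a & forall x, a * n2 x <= qd E x.
Proof.
move=> Es Eg [S [Sb SK _]]; have [K K0 KE] := bounded_operator_n2 Hdot Sb.
pose Q := K ^+ 2 * `|g| + 1.
have Q0 : 0 < Q by rewrite ltr_wpDl // mulr_ge0 ?sqr_ge0.
exists Q^-1; first by rewrite invr_gt0.
move=> x; rewrite ler_pdivrMl //; have /andP[q0 _] := Eg x.
rewrite -{1}(SK x); apply: le_trans (KE _) _.
rewrite /Q mulrDl mul1r -[leLHS]addr0; apply: lerD => //.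
have h : n2 (E x) <= `|g| * qd E x.
  by apply: le_trans (psd_norm Hdot Es Eg x) _; rewrite ler_wpM2r // ler_norm.
by apply: le_trans (ler_wpM2l (sqr_ge0 K) h) _; rewrite mulrA.
Qed.

Lemma bounded_opp T : bounded_operator T -> bounded_operator (fun x => - T x).
Proof.
move=> Tb; have [Tl _] := Tb; have [K K0 KE] := bounded_operator_n2 Hdot Tb.
apply: (n2_bounded_operator Hdot _ K0).
  by move=> c x y; rewrite Tl opprD scalerN.
move=> x; rewrite (_ : n2 (- T x) = n2 (T x)) //.
by rewrite /n2 ipNl ipNr opprK.
Qed.

Lemma invertible_opp T : invertible_operator (fun x => - T x) -> invertible_operator T.
Proof.
move=> [S [Sb SK KS]]; have [Sl _] := Sb.
exists (fun x => - S x); split; first exact: bounded_opp.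
- by move=> x; rewrite -(linN Sl) SK.
- by move=> x; rewrite -[RHS]opprK -[in RHS](KS (- x)) opprK -(linN Sl).
Qed.

Lemma invertible_lr T L' R' : bounded_operator L' -> cancel T L' ->
  cancel R' T -> invertible_operator T.
Proof.
move=> Lb LT TR; exists L'; split=> // x.
by rewrite -{1}(TR x) LT TR.
Qed.

Lemma bounded_comp S T : bounded_operator S -> bounded_operator T ->
  bounded_operator (S \o T).
Proof.
move=> [Sl Sc] [Tl Tc]; split.
  by move=> c x y /=; rewrite Tl Sl.
by move=> x; apply: continuous_comp; [exact: Tc|exact: Sc].
Qed.

Lemma bounded_shift X c : bounded_operator X -> bounded_operator (fun x => X x - c *: x).
Proof.
move=> [Xl Xc]; split.
  move=> d x y; rewrite Xl scalerDr scalerBr !scalerA [d * _]mulrC.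
  by rewrite opprD addrACA.
move=> x; apply: cvgB; first exact: Xc.
by apply: cvgZr; exact: cvg_id.
Qed.

Lemma sa_shift X (r : R) : sa X -> sa (fun x => X x - r%:C *: x).
Proof.
move=> [Xl Xs]; split.
  move=> d x y; rewrite Xl scalerDr scalerBr !scalerA [d * _]mulrC.
  by rewrite opprD addrACA.
by move=> x y; rewrite ipBl ipBr ipZl ipZr conjR Xs.
Qed.

Lemma sa_opp X : sa X -> sa (fun x => - X x).
Proof.
move=> [Xl Xs]; split; first by move=> c x y; rewrite Xl opprD scalerN.
by move=> x y; rewrite ipNl ipNr Xs.
Qed.

Lemma qd_shift X (r : R) x : sa X ->
  qd (fun x => X x - r%:C *: x) x = qd X x - r * n2 x.
Proof.
move=> Xs; apply: (@complexI R); rewrite qdE; last exact: sa_shift.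
by rewrite ipBl ipZl -(qdE _ Xs) -(n2E Hdot) -rmorphM -rmorphB.
Qed.

Lemma qd_opp X x : qd (fun x => - X x) x = - qd X x.
Proof. by rewrite /qd ipNl; case: (dot _ _). Qed.

Lemma qd_bound X : bounded_operator X ->
  exists2 K, 0 <= K & forall x, `|qd X x| <= K * n2 x.
Proof.
move=> Xb; have [K K0 KE] := bounded_operator_n2 Hdot Xb; exists K => // x.
have nx := n2_ge0 Hdot x.
rewrite -(@ler_pXn2r _ 2) ?nnegrE ?mulr_ge0 // real_normK ?num_real //.
apply: le_trans (cauchy_schwarz_n2 Hdot _ _) _.
by rewrite exprMn [n2 x ^+ 2]expr2 mulrA ler_wpM2r.
Qed.

(** For z = u + i v with v nonzero, X - z and X - conj z commute and their product (X - u)^2 + v^2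
    is coercive. For real r outside [m, M], X - r or its opposite is coercive. *)
Lemma spectrum_bounds X (m M : R) : bounded_operator X -> selfadjoint dot X ->
  (forall x, m * n2 x <= qd X x <= M * n2 x) ->
  forall z, spectrum X z -> exists2 r : R, z = r%:C & m <= r <= M.
Proof.
move=> Xb Xs XmM z zX; have [Xl _] := Xb.
have Xsa : sa X by [].
have [v0|v0] := eqVneq (complex.Im z) 0; last first.
  exfalso; apply: zX; pose u := complex.Re z; pose v := complex.Im z.
  pose X' x := X x - u%:C *: x.
  have X's : sa X' by exact: sa_shift.
  pose E x := X' (X' x) + (v ^+ 2)%:C *: x.
  have Es : sa E.
    split.
      move=> c x y; rewrite /E X's.1 X's.1 !scalerDr !scalerA [c * _]mulrC.
      by rewrite addrACA.
    by move=> x y; rewrite /E ipDl ipDr ipZl ipZr conjR !X's.2.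
  have qE x : qd E x = n2 (X' x) + v ^+ 2 * n2 x.
    apply: (@complexI R); rewrite (qdE _ Es) /E ipDl ipZl X's.2 -!(n2E Hdot).
    by rewrite -rmorphM -rmorphD.
  have v2 : 0 < v ^+ 2 by rewrite exprn_even_gt0.
  have X'b : bounded_operator X' by exact: bounded_shift.
  have [K K0 KE] := bounded_operator_n2 Hdot X'b.
  have [S [Sb SK KS]] : invertible_operator E.
    apply: (coercive_invertible Es v2 (b := K ^+ 2 + v ^+ 2)) => x.
    by rewrite qE lerDr n2_ge0 //= mulrDl lerD2r.
  pose T x := X x - z *: x; pose T' x := X x - Num.conj z *: x.
  have zE : z = u%:C + 'i%C * v%:C by exact: complexE.
  have zcE : Num.conj z = u%:C - 'i%C * v%:C.
    by rewrite zE rmorphD rmorphM /= !conjR conjCi mulNr.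
  have TE x : T x = X' x - ('i%C * v%:C) *: x.
    by rewrite /T /X' {1}zE scalerDl opprD addrA.
  have T'E x : T' x = X' x + ('i%C * v%:C) *: x.
    by rewrite /T' /X' zcE scalerBl opprD opprK addrA.
  have iv : ('i%C * v%:C) * ('i%C * v%:C) = - (v ^+ 2)%:C :> C.
    by rewrite mulrACA -!expr2 sqr_i mulN1r rmorphXn.
  have TT' x : T (T' x) = E x.
    rewrite /E TE T'E (linD X's.1) (linZ X's.1).
    move: (X' (X' x)) (X' x) => p p'; rewrite scalerDr scalerA iv scaleNr.
    by rewrite opprD opprK addrA addrK.
  have T'T x : T' (T x) = E x.
    rewrite /E T'E TE (linB X's.1) (linZ X's.1).
    move: (X' (X' x)) (X' x) => p p'; rewrite scalerBr scalerA iv scaleNr opprK.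
    by rewrite addrA subrK.
  apply: (@invertible_lr _ (S \o T') (T' \o S)).
  - by apply: bounded_comp => //; exact: bounded_shift.
  - by move=> x; rewrite -[LHS]/(S (T' (T x))) T'T SK.
  - by move=> x; rewrite -[LHS]/(T (T' (S x))) TT' KS.
exists (complex.Re z); first by rewrite [LHS]complexE v0 mulr0 addr0.
set r := complex.Re z; have zr : z = r%:C by rewrite [LHS]complexE v0 mulr0 addr0.
rewrite zr in zX; rewrite !leNgt; apply/andP; split; apply/negP => rm; apply: zX.
  apply: (coercive_invertible (sa_shift r Xsa) (a := m - r) (b := M - r)).
    by rewrite subr_gt0.
  by move=> x; rewrite qd_shift // !mulrBl !lerD2r.
apply: invertible_opp.
apply: (coercive_invertible (sa_opp (sa_shift r Xsa)) (a := r - M) (b := r - m)).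
  by rewrite subr_gt0.
move=> x; rewrite qd_opp qd_shift // opprB !mulrBl !lerD2l !lerN2.
by rewrite andbC.
Qed.

Hypothesis Hnz : exists x : H, x != 0.

(** M is the supremum of the Rayleigh quotients. If M - X were invertible it would be coercive, and
    the quotients would stay below M - a for some a > 0. *)
Lemma spectrum_top X : bounded_operator X -> selfadjoint dot X ->
  exists2 M, spectrum X M%:C & forall x, qd X x <= M * n2 x.
Proof.
move=> Xb Xs; have [Xl _] := Xb; have Xsa : sa X by [].
have [K K0 KE] := qd_bound Xb.
pose A := [set qd X x / n2 x | x in [set x | x != 0]].
have npos x : x != 0 -> 0 < n2 x.
  by move=> x0; rewrite lt0r n2_ge0 // andbT; apply: contra_neq x0; exact: n2_eq0.
have [x0 x00] := Hnz.
have A0 : A !=set0 by exists (qd X x0 / n2 x0), x0.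
have Aub : ubound A K.
  move=> _ [x /= xn0 <-]; rewrite ler_pdivrMr ?npos //.
  by apply: le_trans (ler_norm _) (KE x).
have As : has_sup A by split=> //; exists K.
have XM x : qd X x <= sup A * n2 x.
  have [->|xn0] := eqVneq x 0; first by rewrite (qd0 _ Xl) n2_0 mulr0.
  by rewrite -ler_pdivrMr ?npos //; apply: sup_upper_bound => //; exists x.
exists (sup A) => // Minv.
have Es := sa_opp (sa_shift (sup A) Xsa).
have qE x : qd (fun x => - (X x - (sup A)%:C *: x)) x = sup A * n2 x - qd X x.
  by rewrite qd_opp qd_shift // opprB.
have [a a0 aE] : exists2 a : R, 0 < a & forall x, a * n2 x <= sup A * n2 x - qd X x.
  have [||a a0 aE] := @invertible_coercive _ (sup A + K) Es.
  - move=> x; rewrite qE subr_ge0 XM /= mulrDl lerD2l.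
    by apply: le_trans (ler_norm _) _; rewrite normrN.
  - apply: invertible_opp.
    by have -> : (fun x => - - (X x - (sup A)%:C *: x)) = (fun x => X x - (sup A)%:C *: x)
      by apply/funext => x; rewrite opprK.
  by exists a => // x; rewrite -qE.
have : sup A <= sup A - a.
  apply: ge_sup => // _ [x /= xn0 <-]; rewrite ler_pdivrMr ?npos //.
  by have := aE x; lra.
by move: a0; clear; lra.
Qed.

Lemma spectrum_bottom X : bounded_operator X -> selfadjoint dot X ->
  exists2 m, spectrum X m%:C & forall x, m * n2 x <= qd X x.
Proof.
move=> Xb Xs; have [Xl _] := Xb; have Xsa : sa X by [].
have [||M MX Mq] := @spectrum_top (fun x => - X x); first exact: bounded_opp.
  exact: (sa_opp Xsa).2.
exists (- M); last by move=> x; have := Mq x; rewrite qd_opp; lra.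
move=> inv; apply: MX.
have -> : (fun x => - X x - M%:C *: x) = (fun x => - (X x - (- M)%:C *: x)).
  by apply/funext => x; rewrite rmorphN scaleNr opprK opprD.
apply: invertible_opp.
by have -> : (fun x => - - (X x - (- M)%:C *: x)) = (fun x => X x - (- M)%:C *: x)
  by apply/funext => x; rewrite opprK.
Qed.

(** Both extremes of the numerical range lie in the spectrum. The spectral condition thus becomes an
    inequality between forms, which is stable under segments and compressions. *)
Lemma Bsa_bounds (a b : \bar R) X : Bsa dot a b X -> exists m M : R,
  [/\ ointerval a b m, ointerval a b M & forall x, m * n2 x <= qd X x <= M * n2 x].
Proof.
move=> [Xb Xs Xsp]; have [m mX mq] := spectrum_bottom Xb Xs.
have [M MX Mq] := spectrum_top Xb Xs; exists m, M; split.
- by have [r rI /(@complexI R) <-] := Xsp _ mX.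
- by have [r rI /(@complexI R) <-] := Xsp _ MX.
- by move=> x; rewrite mq Mq.
Qed.

End spectrum.

Section bounds_Bsa.
Variables (R : realType) (H : completeNormedModType R[i])
  (dot : {dot H for (@Num.conj R[i])}).
Hypothesis Hdot : norm_of_dot dot.

Lemma bounds_Bsa (a b : \bar R) (X : H -> H) (m M : R) :
  bounded_operator X -> selfadjoint dot X ->
  (forall r, m <= r <= M -> ointerval a b r) ->
  (forall x, m * n2 dot x <= qd dot X x <= M * n2 dot x) -> Bsa dot a b X.
Proof.
move=> Xb Xs mM XmM; split=> // z zX.
by have [r -> rmM] := spectrum_bounds Hdot Xb Xs XmM zX; exists r => //; exact: mM.
Qed.

End bounds_Bsa.

(** * Functional calculus *)

Section polynomial_calculus.
Variables (R : realType) (H : completeNormedModType R[i]).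
Local Notation C := R[i].
Implicit Types (x y : H) (X Y T E : H -> H) (c : C) (p q : {poly C}).

(** Complex coefficients allow the factorization into linear factors in [cop_invertible]. *)
Definition cop q X x : H := \sum_(i < size q) q`_i *: iter i X x.

Lemma cop_widen n q X x : (size q <= n)%N ->
  cop q X x = \sum_(i < n) q`_i *: iter i X x.
Proof.
move=> qn; rewrite /cop (big_ord_widen n (fun i => q`_i *: iter i X x)) //.
rewrite big_mkcond /=; apply: eq_bigr => i _; case: ltnP => // h.
by rewrite nth_default // scale0r.
Qed.

Lemma copD p q X x : cop (p + q) X x = cop p X x + cop q X x.
Proof.
rewrite (@cop_widen (maxn (size p) (size q)) (p + q)) ?size_polyD //.
rewrite (@cop_widen _ p _ _ (leq_maxl _ (size q))).
rewrite (@cop_widen _ q _ _ (leq_maxr (size p) _)) -big_split.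
by apply: eq_bigr => i _; rewrite coefD scalerDl.
Qed.

Lemma copZ c q X x : cop (c *: q) X x = c *: cop q X x.
Proof.
rewrite (@cop_widen (size q) (c *: q)) ?size_scale_leq // scaler_sumr.
by apply: eq_bigr => i _; rewrite coefZ scalerA.
Qed.

Lemma copC c X x : cop c%:P X x = c *: x.
Proof. by rewrite (@cop_widen 1) ?size_polyC_leq1 // big_ord1 coefC. Qed.

Lemma copMX q X x : cop (q * 'X) X x = cop q X (X x).
Proof.
have [->|q0] := eqVneq q 0; first by rewrite mul0r /cop size_poly0 !big_ord0.
rewrite (@cop_widen (size q).+1) ?size_mulX //.
rewrite big_ord_recl coefMX scale0r add0r.
by apply: eq_bigr => i _; rewrite coefMX /= -iterSr.
Qed.

Variable X : H -> H.
Hypothesis Xl : linear X.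

Lemma iter_linear i : linear (iter i X).
Proof. by elim: i => [|i IH] c x y //=; rewrite IH Xl. Qed.

Lemma cop_linear q : linear (cop q X).
Proof.
move=> c x y; rewrite /cop scaler_sumr -big_split; apply: eq_bigr => i _.
by rewrite iter_linear scalerDr !scalerA mulrC.
Qed.

Lemma cop_comm q x : cop q X (X x) = X (cop q X x).
Proof.
rewrite /cop (lin_sum Xl); apply: eq_bigr => i _.
by rewrite (linZ Xl) -iterS -iterSr.
Qed.

Lemma copM p q x : cop (p * q) X x = cop p X (cop q X x).
Proof.
elim/poly_ind: p q x => [|p c IH] q x.
  by rewrite mul0r /cop size_poly0 !big_ord0.
rewrite mulrDl !copD -mulrA copMX mul_polyC copZ copC; congr (_ + _).
by rewrite ['X * q]mulrC IH copMX cop_comm.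
Qed.

Definition realpoly (p : {poly R}) : {poly C} := map_poly (real_complex R) p.

Lemma op_hornerE (p : {poly R}) x : op_horner p X x = cop (realpoly p) X x.
Proof.
rewrite /op_horner /cop size_map_poly; apply: eq_bigr => i _.
by rewrite coef_map.
Qed.

Lemma realpoly_horner (p : {poly R}) (r : R) : (realpoly p).[r%:C] = (p.[r])%:C.
Proof. by rewrite horner_map. Qed.

Lemma op_hornerD (p q : {poly R}) x :
  op_horner (p + q) X x = op_horner p X x + op_horner q X x.
Proof. by rewrite !op_hornerE /realpoly rmorphD copD. Qed.

Lemma op_hornerZ (a : R) (p : {poly R}) x :
  op_horner (a *: p) X x = a%:C *: op_horner p X x.
Proof. by rewrite !op_hornerE /realpoly map_polyZ copZ. Qed.

Lemma op_hornerB (p q : {poly R}) x :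
  op_horner (p - q) X x = op_horner p X x - op_horner q X x.
Proof. by rewrite op_hornerD -scaleN1r op_hornerZ rmorphN1 scaleN1r. Qed.

Lemma op_horner_linear (p : {poly R}) : linear (op_horner p X).
Proof. by move=> c x y; rewrite !op_hornerE cop_linear. Qed.

End polynomial_calculus.

(** * Norm of a polynomial in a self-adjoint operator *)

Section spectral_norm.
Variables (R : realType) (H : completeNormedModType R[i])
  (dot : {dot H for (@Num.conj R[i])}).
Hypothesis Hdot : norm_of_dot dot.
Hypothesis Hnz : exists x : H, x != 0.
Local Notation C := R[i].
Local Notation n2 := (n2 dot).
Local Notation qd := (qd dot).
Variable X : H -> H.
Hypotheses (Xb : bounded_operator X) (Xs : selfadjoint dot X).
Let Xl : linear X := Xb.1.

Lemma bounded_iter i : bounded_operator (iter i X).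
Proof.
elim: i => [|i IH]; first by split=> // x; exact: cvg_id.
exact: (bounded_comp Xb IH).
Qed.

Lemma continuous_sum (I : Type) (r : seq I) (F : I -> H -> H) :
  (forall i, continuous (F i)) -> continuous (fun x => \sum_(i <- r) F i x).
Proof.
move=> Fc; elim: r => [|i r IH] x.
  rewrite (_ : (fun x => _) = cst 0); first exact: cvg_cst.
  by apply/funext => y; rewrite big_nil.
rewrite (_ : (fun x => _) = (fun x => F i x + \sum_(j <- r) F j x)).
  by apply: cvgD; [exact: Fc|exact: IH].
by apply/funext => y; rewrite big_cons.
Qed.

Lemma bounded_op_horner (p : {poly R}) : bounded_operator (op_horner p X).
Proof.
split; first exact: op_horner_linear.
apply: (@continuous_sum _ _ (fun i x => (p`_(nat_of_ord i))%:C *: iter i X x)).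
by move=> i x; apply: cvgZr; exact: (bounded_iter i).2.
Qed.

Lemma sa_iter i : selfadjoint dot (iter i X).
Proof. by elim: i => [|i IH] x y //; rewrite iterS Xs IH -iterSr. Qed.

Lemma sa_op_horner (p : {poly R}) : selfadjoint dot (op_horner p X).
Proof.
move=> x y; rewrite /op_horner ip_suml ip_sumr; apply: eq_bigr => i _.
by rewrite ipZl ipZr conjR sa_iter.
Qed.

Lemma invertible_comp (S T : H -> H) : invertible_operator S -> invertible_operator T ->
  invertible_operator (S \o T).
Proof.
move=> [S' [S'b SK KS]] [T' [T'b TK KT]]; exists (T' \o S'); split.
- exact: bounded_comp.
- by move=> x /=; rewrite SK TK.
- by move=> x /=; rewrite KT KS.
Qed.

Lemma invertible_scale c : c != 0 -> invertible_operator (fun x : H => c *: x).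
Proof.
move=> c0; exists (fun x => c^-1 *: x); split.
- split; first by move=> d x y; rewrite scalerDr !scalerA mulrC.
  by move=> x; apply: cvgZr; exact: cvg_id.
- by move=> x; rewrite scalerA mulVf // scale1r.
- by move=> x; rewrite scalerA divff // scale1r.
Qed.

Lemma cop_invertible (q : {poly C}) : q != 0 ->
  (forall z, root q z -> ~ spectrum X z) -> invertible_operator (cop q X).
Proof.
move=> q0 qX; have [r qE] := closed_field_poly_normal q.
have lc0 : lead_coef q != 0 by rewrite lead_coef_eq0.
have rX z : z \in r -> ~ spectrum X z.
  move=> zr; apply: qX; rewrite qE rootZ // /root.
  by rewrite horner_prod prodf_seq_eq0; apply/hasP; exists z => //=; rewrite hornerXsubC subrr.
have rinv : invertible_operator (cop (\prod_(z <- r) ('X - z%:P)) X).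
  elim: r rX {qE} => [|z r IH] rX.
    rewrite big_nil (_ : cop 1 X = id).
      by exists id; split=> //; split=> // x; exact: cvg_id.
    by apply/funext => x; rewrite -polyC1 copC scale1r.
  rewrite big_cons (_ : cop _ X =
    (fun x => X x - z *: x) \o cop (\prod_(z <- r) ('X - z%:P)) X).
    apply: invertible_comp; last by apply: IH => w wr; apply: rX; rewrite inE wr orbT.
    by apply: contrapT; apply: rX; rewrite mem_head.
  apply/funext => x; rewrite copM // copD -polyCN copC -['X]mul1r copMX -polyC1 copC.
  by rewrite scale1r scaleNr.
rewrite qE (_ : cop _ X = (fun x => lead_coef q *: x) \o
   cop (\prod_(z <- r) ('X - z%:P)) X); last by apply/funext => x; rewrite copZ.
by apply: invertible_comp => //; exact: invertible_scale.
Qed.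

(** Let s be the top of the spectrum of p(X)^2, which bounds |p(X) x|^2 / |x|^2. If s > e^2, the
    polynomial s - p^2 has no root in the spectrum of X, so s - p(X)^2 is invertible, a
    contradiction. *)
Lemma spectral_bound (p : {poly R}) (e : R) : 0 <= e ->
  (forall z, spectrum X z -> exists r : R, z = r%:C) ->
  (forall r : R, spectrum X r%:C -> `|p.[r]| <= e) ->
  forall x, n2 (op_horner p X x) <= e ^+ 2 * n2 x.
Proof.
move=> e0 Xr pe x; pose P := op_horner p X.
have Pl : linear P by exact: op_horner_linear.
have Psa : selfadjoint dot P by exact: sa_op_horner.
have Pb : bounded_operator P by exact: bounded_op_horner.
have [s sE sq] := spectrum_top Hdot Hnz (bounded_comp Pb Pb)
  (fun u v => etrans (Psa (P u) v) (Psa u (P v))).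
have qE y : qd (P \o P) y = n2 (P y) by rewrite /qd /= Psa.
rewrite -/(P x) -qE; apply: le_trans (sq x) _; rewrite ler_wpM2r ?n2_ge0 //.
rewrite leNgt; apply/negP => es; apply: sE.
pose g : {poly C} := realpoly (s%:P - p * p).
have groot z : spectrum X z -> ~~ root g z.
  move=> zX; have [r zr] := Xr z zX; rewrite zr /root realpoly_horner.
  rewrite zr in zX; have := pe r zX; rewrite !hornerE => pr.
  apply/eqP => /complexI /eqP; rewrite subr_eq0 => /eqP sp.
  have : p.[r] * p.[r] <= e ^+ 2.
    by rewrite -expr2 -(real_normK (num_real p.[r])) ler_pXn2r ?nnegrE.
  by rewrite -sp leNgt es.
(* The spectrum is nonempty, so a polynomial without root in it is nonzero. *)
have [m0 m0X _] := spectrum_top Hdot Hnz Xb Xs.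
have g0 : g != 0.
  by apply: contraNneq (groot _ m0X) => ->; exact: root0.
have ginv : invertible_operator (cop g X).
  by apply: cop_invertible => // z zg zX; move: (groot z zX); rewrite zg.
have gE y : cop g X y = s%:C *: y - P (P y).
  by rewrite /g -op_hornerE op_hornerB // /P !op_hornerE /realpoly rmorphM /= copM // map_polyC copC.
apply: invertible_opp => //.
have -> : (fun y => - ((P \o P) y - s%:C *: y)) = cop g X.
  by apply/funext => y; rewrite gE opprB.
exact: ginv.
Qed.

End spectral_norm.

(** * Weierstrass approximation by Bernstein polynomials *)

Section weierstrass.
Variable R : realType.
Implicit Types (f : R -> R) (x y e : R).

Lemma uniform_continuity f (m M e : R) : continuous f -> 0 < e ->
  exists2 d, 0 < d & forall x y, m <= x <= M -> `|y - x| < d -> `|f y - f x| <= e.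
Proof.
move=> fc e0.
have /compact_near_coveringP cov := @segment_compact R m M.
have := cov R (0^'+) (fun d x => forall y, `|y - x| < d -> `|f y - f x| <= e) _.
case.
  move=> x0 _; have e2 : 0 < e / 2 by rewrite divr_gt0.
  have /cvgrPdist_lt/(_ _ e2) := fc x0.
  move/nbhs_ballP => [r /= r0 rE]; have r2 : 0 < r / 2 by rewrite divr_gt0.
  exists (ball x0 (r / 2), [set d | d < r / 2]) => /=.
    split; first exact: nbhsx_ballx.
    exact: nbhs_right_lt.
  move=> [x d] /= [xx0 dr] y yx; rewrite -ball_normE /= in xx0.
  have -> : f y - f x = - (f x0 - f y) + (f x0 - f x) by ring.
  apply: le_trans (ler_normD _ _) _; rewrite normrN [leRHS]splitr.
  apply: lerD; apply/ltW/rE; rewrite -ball_normE /=.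
    have -> : x0 - y = (x0 - x) - (y - x) by ring.
    apply: le_lt_trans (ler_normB _ _) _; rewrite [ltRHS]splitr.
    by apply: ltrD => //; exact: lt_trans dr.
  by apply: lt_trans xx0 _; rewrite ltr_pdivrMr // ltr_pMr // ltr1n.
move=> d /= d0 dE; exists (d / 2); first by rewrite divr_gt0.
move=> x y xmM; apply: (dE (d / 2)).
- by rewrite /= sub0r normrN gtr0_norm ?divr_gt0 // ltr_pdivrMr // ltr_pMr // ltr1n.
- by rewrite divr_gt0.
- by rewrite /= in_itv.
Qed.

(** Uniform continuity in a form that needs only second moments: beyond distance d, the oscillation
    of f is absorbed by the quadratic term. *)
Lemma quadratic_modulus f (m M e : R) : m <= M -> continuous f -> 0 < e ->
  exists2 C, 0 <= C & forall x y, m <= x <= M -> m <= y <= M ->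
    `|f y - f x| <= e + C * (y - x) ^+ 2.
Proof.
move=> mM fc e0; have [d d0 dE] := uniform_continuity m M fc e0.
have fw : {within `[m, M], continuous f} by exact: continuous_subspaceT.
have [u uI uE] := EVT_max mM fw; have [w _ wE] := EVT_min mM fw.
have wu : 0 <= f u - f w.
  by rewrite subr_ge0; exact: wE.
exists ((f u - f w) / d ^+ 2); first by rewrite divr_ge0 ?sqr_ge0.
move=> x y xm ym; have [xy|xy] := ltP `|y - x| d.
  by apply: le_trans (dE x y xm xy) _; rewrite lerDl mulr_ge0 ?sqr_ge0 // divr_ge0 ?sqr_ge0.
apply: le_trans (_ : f u - f w <= _).
  have := uE x; have := uE y; have := wE x; have := wE y; rewrite !in_itv /=.
  move=> /(_ ym) h1 /(_ xm) h2 /(_ ym) h3 /(_ xm) h4.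
  by rewrite ler_norml; apply/andP; split; lra.
rewrite -[leLHS]add0r; apply: lerD; first exact: ltW.
rewrite mulrAC -mulrA ler_peMr // ler_pdivlMr ?exprn_gt0 // mul1r.
by rewrite -[(y - x) ^+ 2]real_normK ?num_real // ler_pXn2r ?nnegrE // ltW.
Qed.

(** At x, the expectation of g(S) for S binomial with parameters n and Y(x); the recursion
    conditions on one trial. *)
Fixpoint bernstein (Y : {poly R}) n (g : nat -> R) : {poly R} :=
  if n is n'.+1 then
    Y * bernstein Y n' (fun k => g k.+1) + (1 - Y) * bernstein Y n' g
  else (g 0%N)%:P.

Section bernstein_eval.
Variables (Y : {poly R}) (x : R).
Hypothesis Yx : 0 <= Y.[x] <= 1.
Local Notation y := Y.[x].

Lemma bernsteinS n g : (bernstein Y n.+1 g).[x] =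
  y * (bernstein Y n (fun k => g k.+1)).[x] + (1 - y) * (bernstein Y n g).[x].
Proof. by rewrite /= !hornerE. Qed.

Lemma bernstein_lin n (a b : R) g h :
  (bernstein Y n (fun k => a * g k + b * h k)).[x] =
  a * (bernstein Y n g).[x] + b * (bernstein Y n h).[x].
Proof.
elim: n g h => [|n IH] g h; first by rewrite /= !hornerE.
by rewrite !bernsteinS !IH; ring.
Qed.

Lemma bernstein_cst n (c : R) : (bernstein Y n (fun=> c)).[x] = c.
Proof.
elim: n => [|n IH]; first by rewrite /= !hornerE.
by rewrite bernsteinS !IH; ring.
Qed.

Lemma bernstein_id n : (bernstein Y n (fun k => k%:R)).[x] = n%:R * y.
Proof.
elim: n => [|n IH]; first by rewrite /= hornerC mulr0n mul0r.
rewrite bernsteinS (_ : (fun k => _) = (fun k => 1 * k%:R + 1 * 1)); last first.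
  by apply/funext => k; rewrite -natr1 !mul1r.
by rewrite bernstein_lin bernstein_cst IH -natr1; ring.
Qed.

Lemma bernstein_sqr n : (bernstein Y n (fun k => k%:R ^+ 2)).[x] =
  n%:R * y * (1 - y) + (n%:R * y) ^+ 2.
Proof.
elim: n => [|n IH]; first by rewrite /= hornerC mulr0n; ring.
rewrite bernsteinS (_ : (fun k => _) =
    (fun k => 1 * k%:R ^+ 2 + 1 * (2 * k%:R + 1 * 1))); last first.
  by apply/funext => k; rewrite -natr1; ring.
by rewrite !bernstein_lin bernstein_cst bernstein_id IH -natr1; ring.
Qed.

Lemma bernstein_le n g h : (forall k, (k <= n)%N -> g k <= h k) ->
  (bernstein Y n g).[x] <= (bernstein Y n h).[x].
Proof.
have [y0 y1] := andP Yx.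
elim: n g h => [|n IH] g h gh; first by rewrite /= !hornerE gh.
rewrite !bernsteinS; apply: lerD; apply: ler_wpM2l => //.
- by apply: IH => k kn; exact: gh.
- by rewrite subr_ge0.
- by apply: IH => k kn; apply: gh; exact: leqW.
Qed.

End bernstein_eval.

Theorem weierstrass f (m M e : R) : m <= M -> continuous f -> 0 < e ->
  exists p : {poly R}, forall x, m <= x <= M -> `|f x - p.[x]| <= e.
Proof.
(* The added 1 keeps L positive when m = M. *)
move=> mM fc e0; pose L := M - m + 1.
have L0 : 0 < L by rewrite /L; move: mM; clear; lra.
have e2 : 0 < e / 2 by rewrite divr_gt0.
have mL : m <= m + L by rewrite lerDl ltW.
have [C C0 CE] := quadratic_modulus mL fc e2.
(* The variance term will be at most C L^2 / n, which this n makes at most e/2. *)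
pose n := (Num.truncn (2 * C * L ^+ 2 / e)).+1.
have n0 : 0 < n%:R :> R by rewrite ltr0n.
have nC : C * L ^+ 2 / n%:R <= e / 2.
  rewrite ler_pdivrMr // -ler_pdivrMl // -(invrK 2) -[X in X^-1 * _]invrK.
  have : 2 * C * L ^+ 2 / e < n%:R by rewrite truncnS_gt // mulr_ge0 ?invr_ge0 ?(ltW e0) // !mulr_ge0 ?sqr_ge0.
  move=> /ltW; apply: le_trans; rewrite le_eqVlt; apply/orP; left; apply/eqP.
  by field; rewrite gt_eqF.
pose Y : {poly R} := (L^-1)%:P * ('X - m%:P).
pose g k := f (m + L * (k%:R / n%:R)).
exists (bernstein Y n g) => x /andP[mx xM].
have YE : Y.[x] = (x - m) / L by rewrite /Y !hornerE mulrC.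
have Y01 : 0 <= Y.[x] <= 1.
  rewrite YE divr_ge0 ?subr_ge0 ?(ltW L0) //= ler_pdivrMr // mul1r /L.
  by move: xM; clear; lra.
have xE : x = m + L * Y.[x] by rewrite YE; field; rewrite gt_eqF.
pose s := L ^+ 2 / n%:R ^+ 2.
(* The bound e/2 + C (L (k/n - Y(x)))^2, expanded in k in the shape that [bernstein_lin]
   rewrites. *)
pose q k : R := C * s * k%:R ^+ 2 + 1 * ((- 2 * C * s * (n%:R * Y.[x])) * k%:R +
  (e / 2 + C * s * (n%:R * Y.[x]) ^+ 2) * 1).
have gq k : (k <= n)%N -> `|g k - f x| <= q k.
  move=> kn; apply: le_trans (CE x _ _ _) _.
  - by rewrite mx /=; apply: le_trans xM _; rewrite /L; lra.
  - rewrite lerDl mulr_ge0 ?(ltW L0) ?divr_ge0 //= lerD2l ger_pMr //.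
    by rewrite ler_pdivrMr // mul1r ler_nat.
  - rewrite {1}xE /q /s le_eqVlt; apply/orP; left; apply/eqP.
    by field; rewrite gt_eqF.
have Bq : (bernstein Y n q).[x] <= e.
  rewrite /q !bernstein_lin bernstein_sqr bernstein_id bernstein_cst.
  rewrite [leRHS]splitr [leLHS](_ : _ = e / 2 + C * L ^+ 2 / n%:R * (Y.[x] * (1 - Y.[x]))).
    rewrite lerD2l; apply: le_trans nC; apply: ler_piMr.
      by rewrite divr_ge0 ?(ltW n0) // mulr_ge0 ?sqr_ge0.
    have [y0 y1] := andP Y01; apply: le_trans (_ : 1 * 1 <= _); last by rewrite mulr1.
    by apply: ler_pM => //; rewrite ?subr_ge0 // gerBl.
  by rewrite /s; field; rewrite gt_eqF.
have up : (bernstein Y n g).[x] <= f x + e.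
  apply: le_trans (_ : (bernstein Y n (fun k => 1 * q k + f x * 1)).[x] <= _).
    apply: bernstein_le => // k kn; rewrite mul1r mulr1 -lerBlDr.
    by apply: le_trans (gq k kn); rewrite ler_norm.
  by rewrite bernstein_lin bernstein_cst mul1r mulr1 addrC lerD2l.
have lo : f x - e <= (bernstein Y n g).[x].
  apply: le_trans (_ : (bernstein Y n (fun k => -1 * q k + f x * 1)).[x] <= _).
    by rewrite bernstein_lin bernstein_cst mulN1r mulr1 addrC lerD2r lerN2.
  apply: bernstein_le => // k kn; rewrite mulN1r mulr1.
  have := gq k kn; rewrite ler_norml => /andP[+ _].
  by move: (q k) (g k) => ? ?; lra.
rewrite ler_norml; apply/andP; split; lra.
Qed.

End weierstrass.

Section extension.
Variables (R : realType) (a b : \bar R).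
Local Notation I := (ointerval a b).
Implicit Types (f : ointerval a b -> R) (x y : R).

(** Matrix tests and polynomials use total functions. The interval is open, so continuity of f
    amounts to continuity of [ext f] at its points ([ext_continuous]), and the value 0 outside does
    not interfere. *)
Definition ext f x : R :=
  if pselect (I x) is left h then f (exist _ x (mem_set h)) else 0.

Lemma ext_val f (s : ointerval a b) : ext f (set_val s) = f s.
Proof.
rewrite /ext; case: pselect => [h|]; first by congr f; exact: val_inj.
by case; exact: set_mem (valP s).
Qed.

Lemma ext_lin f g (c : R) x : ext (fun s => c * f s + g s) x = c * ext f x + ext g x.
Proof. by rewrite /ext; case: pselect => // _; rewrite mulr0 addr0. Qed.

Lemma in_ext f x : I x -> exists2 s : ointerval a b, set_val s = x & ext f x = f s.
Proof.
move=> Ix; have xE : x = set_val (exist _ x (mem_set Ix) : ointerval a b) by [].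
by exists (exist _ x (mem_set Ix)) => //; rewrite {1}xE ext_val.
Qed.

End extension.

(** * Continuous functional calculus *)

Section functional_calculus.
Variables (R : realType) (H : completeNormedModType R[i])
  (dot : {dot H for (@Num.conj R[i])}).
Hypothesis Hdot : norm_of_dot dot.
Hypothesis Hnz : exists x : H, x != 0.
Variables (a b : \bar R).
Local Notation C := R[i].
Local Notation n2 := (n2 dot).
Local Notation qd := (qd dot).
Local Notation I := (ointerval a b).
Implicit Types (f : ointerval a b -> R).

Lemma geometric_small (K e : R) : 0 < e -> exists n, K * 2^-1 ^+ n <= e.
Proof.
move=> e0; have : K * 2^-1 ^+ n @[n --> \oo] --> (0 : R).
  rewrite -(mulr0 K); apply: cvgMr; apply: cvg_expr.
  by rewrite ger0_norm ?invr_ge0 // invf_lt1 ?ltr1n.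
move/cvgrPdist_lt/(_ _ e0) => [N _ NE]; exists N.
by have := NE N (leqnn N); rewrite /= sub0r normrN => /ltW /(le_trans (ler_norm _)).
Qed.

Lemma geometric_null (z : H) (K : R) :
  (forall n, `|z| <= (K * 2^-1 ^+ n)%:C) -> z = 0.
Proof.
move=> zK; apply/eqP; rewrite -normr_eq0 (normE Hdot); apply/eqP; congr (_%:C).
apply/le_anti; rewrite sqrtr_ge0 andbT; apply/ler_addgt0Pr => e /(geometric_small K)[n nE].
by rewrite add0r; apply: le_trans nE; rewrite -lecR -(normE Hdot).
Qed.

Section fixed.
Variables (X : H -> H) (m M : R).
Hypotheses (Xb : bounded_operator X) (Xs : selfadjoint dot X).
Hypotheses (Im : I m) (IM : I M).
Hypothesis XmM : forall x, m * n2 x <= qd X x <= M * n2 x.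
Let Xl : linear X := Xb.1.

Lemma bounds_le : m <= M.
Proof.
have [x x0] := Hnz; have /andP[h1 h2] := XmM x; have := le_trans h1 h2.
by rewrite ler_pM2r // lt0r n2_ge0 // andbT; apply: contra_neq x0; exact: n2_eq0.
Qed.

Lemma op_horner_bound (p : {poly R}) (e : R) : 0 <= e ->
  (forall r, m <= r <= M -> spectrum X r%:C -> `|p.[r]| <= e) ->
  forall x, `|op_horner p X x| <= e%:C * `|x|.
Proof.
move=> e0 pe x; apply/(normr_le_n2 Hdot _ _ e0); apply: spectral_bound => //.
- by move=> z /(spectrum_bounds Hdot Xb Xs XmM)[r -> _]; exists r.
- move=> r rX; apply: pe => //.
  by have [r' /complexI -> ] := spectrum_bounds Hdot Xb Xs XmM rX.
Qed.

Variable f : ointerval a b -> R.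
Hypothesis fc : forall x, I x -> {for x, continuous (ext f)}.

Lemma spectrum_approx (e : R) : 0 < e -> exists p : {poly R},
  forall r, m <= r <= M -> `|ext f r - p.[r]| <= e.
Proof.
move=> e0; have mM := bounds_le.
have gc : continuous (ext f \o clamp m M).
  move=> x; apply: continuous_comp; first exact: continuous_clamp.
  by apply: fc; apply: ointerval_convex Im IM _; exact: clamp_in.
have [p pE] := weierstrass mM gc e0; exists p => r rmM.
by have := pE r rmM; rewrite /= clamp_id.
Qed.

(** Polynomials within 2^-n of f on [m, M] give, by the spectral bound, a Cauchy sequence at each
    vector. The error is proportional to |x|, which transfers linearity and boundedness to the
    limit. *)
Lemma fun_calculus_ex : exists Y, is_fun_calculus f X Y.
Proof.
have h0 n : 0 < 2^-1 ^+ n :> R by rewrite exprn_gt0 // invr_gt0.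
have /choice[p pE] n := spectrum_approx (h0 n).
pose s x := Num.sqrt (n2 x).
have step x n : `|op_horner (p n.+1) X x - op_horner (p n) X x| <=
    (2 * s x * 2^-1 ^+ n)%:C.
  rewrite -op_hornerB //.
  have -> : (2 * s x * 2^-1 ^+ n)%:C = (2 * 2^-1 ^+ n)%:C * `|x|.
    by rewrite (normE Hdot) -rmorphM mulrAC.
  apply: op_horner_bound; first by rewrite mulr_ge0 // ltW.
  move=> r rmM _; rewrite hornerD hornerN.
  have -> : (p n.+1).[r] - (p n).[r] =
      (ext f r - (p n).[r]) - (ext f r - (p n.+1).[r]) by ring.
  apply: le_trans (ler_normB _ _) _.
  have -> : 2 * 2^-1 ^+ n = 2^-1 ^+ n + 2^-1 ^+ n :> R by ring.
  apply: lerD; first exact: pE.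
  by apply: le_trans (pE n.+1 r rmM) _; rewrite exprS ler_piMl ?(ltW (h0 n)) // invf_le1 ?ler1n.
have /choice[Y YE'] x : exists l, forall n, `|l - op_horner (p n) X x| <=
    (2 * s x * 2^-1 ^+ n / (1 - 2^-1))%:C.
  apply: geometric_cvg => //; first by rewrite mulr_ge0 ?sqrtr_ge0.
  by rewrite invr_ge0 ler0n /= invf_lt1 ?ltr1n.
have YE x n : `|Y x - op_horner (p n) X x| <= (4 * 2^-1 ^+ n)%:C * `|x|.
  apply: le_trans (YE' x n) _; rewrite (normE Hdot) -rmorphM lecR -/(s x).
  by rewrite le_eqVlt; apply/orP; left; apply/eqP; field; rewrite ?pnatr_eq0.
have Yl : linear Y.
  move=> c x y; apply/eqP; rewrite -subr_eq0; apply/eqP.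
  pose K := `|c *: x + y| + (`|c| * `|x| + `|y|).
  have K0 : 0 <= K by rewrite !addr_ge0 ?mulr_ge0.
  apply: (@geometric_null _ (4 * complex.Re K)) => n.
  rewrite [X in X%:C](_ : _ = (4 * 2^-1 ^+ n) * complex.Re K); last by ring.
  rewrite rmorphM /= Re_nonneg //.
  have -> : Y (c *: x + y) - (c *: Y x + Y y) =
    (Y (c *: x + y) - op_horner (p n) X (c *: x + y)) +
    (c *: (op_horner (p n) X x - Y x) + (op_horner (p n) X y - Y y)).
    rewrite (op_horner_linear Xl); move: (op_horner _ _ x) (op_horner _ _ y) => u v.
    rewrite scalerBr; move: (c *: u) (c *: Y x) => u' w.
    by rewrite [u' - w + _]addrACA -opprD addrA subrK.
  apply: le_trans (ler_normD _ _) _; rewrite /K mulrDr; apply: lerD; first exact: YE.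
  apply: le_trans (ler_normD _ _) _; rewrite mulrDr; apply: lerD.
    by rewrite normrZ mulrCA distrC ler_wpM2l.
  by rewrite distrC.
exists Y; split.
  have [K K0 KE] := bounded_operator_n2 Hdot (bounded_op_horner Xb (p 0%N)).
  apply: (n2_bounded_operator Hdot (K := 4 + K)) => //; first by rewrite addr_ge0.
  move=> x; apply/(normr_le_n2 Hdot); first by rewrite addr_ge0.
  rewrite -[Y x](subrK (op_horner (p 0%N) X x)) rmorphD mulrDl.
  apply: le_trans (ler_normD _ _) _; apply: lerD.
    by apply: le_trans (YE x 0%N) _; rewrite expr0 mulr1.
  exact/(normr_le_n2 Hdot).
move=> e e0; have [n nE] := geometric_small 4 e0; exists (p n); split.
  move=> t /(spectrum_bounds Hdot Xb Xs XmM)[r /complexI <- rmM].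
  rewrite -ext_val; apply: le_trans (pE n _ rmM) (le_trans _ nE).
  by rewrite ler_peMl ?(ltW (h0 n)) // ler1n.
move=> x; apply: le_trans (YE x n) _; rewrite ler_wpM2r // lecR //.
Qed.

Lemma fun_calculusP : is_fun_calculus f X (fun_calculus f X).
Proof. rewrite /fun_calculus; case: xgetP => [Y _ //|h].
by have [Y YE] := fun_calculus_ex; case: (h Y). Qed.

Local Notation Y := (fun_calculus f X).

(** The definition supplies polynomials of its own, close to f on the spectrum only;
    [op_horner_bound] compares them with any q close to f on [m, M]. This does the work of
    uniqueness. *)
Lemma fun_calculus_near (q : {poly R}) (e : R) : 0 <= e ->
  (forall r, m <= r <= M -> `|ext f r - q.[r]| <= e) ->
  forall x, `|Y x - op_horner q X x| <= e%:C * `|x|.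
Proof.
move=> e0 qE x; have [_ Yp] := fun_calculusP.
suff h (d : R) : 0 < d -> `|Y x - op_horner q X x| <= (2 * d + e)%:C * `|x|.
  apply/ler_addgt0Pr => d' /complex_gt0[d d0 ->].
  have s0 : 0 <= Num.sqrt (n2 x) by exact: sqrtr_ge0.
  have s1 : 0 < Num.sqrt (n2 x) + 1 by rewrite ltr_wpDl.
  apply: le_trans (h (d / (2 * (Num.sqrt (n2 x) + 1))) _) _.
    by rewrite divr_gt0 // mulr_gt0.
  rewrite (normE Hdot) -!rmorphM -rmorphD lecR /= mulrDl addrC lerD2l.
  set u := Num.sqrt _ in s0 s1 *.
  have -> : 2 * (d / (2 * (u + 1))) * u = d * (u / (u + 1)) by field; rewrite gt_eqF.
  by rewrite ler_piMr ?(ltW d0) // ler_pdivrMr // mul1r lerDl.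
move=> d0; have [p [pE pX]] := Yp d d0.
rewrite -[Y x](subrK (op_horner p X x)) -addrA -op_hornerB //.
apply: le_trans (ler_normD _ _) _.
have -> : (2 * d + e)%:C * `|x| = d%:C * `|x| + (d + e)%:C * `|x|.
  by rewrite -mulrDl -rmorphD; congr (_%:C * _); ring.
apply: lerD; first exact: pX.
apply: op_horner_bound; first by rewrite addr_ge0 // ltW.
move=> r rmM rX; have [s sr sE] := in_ext f (ointerval_convex Im IM rmM).
have := pE s; rewrite sr -sE => /(_ rX) h; rewrite hornerD hornerN.
have -> : p.[r] - q.[r] = - (ext f r - p.[r]) + (ext f r - q.[r]) by ring.
by apply: le_trans (ler_normD _ _) _; rewrite normrN; apply: lerD => //; exact: qE.
Qed.

Lemma fun_calculus_form (q : {poly R}) (e : R) : 0 <= e ->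
  (forall r, m <= r <= M -> `|ext f r - q.[r]| <= e) ->
  forall x, `|complex.Re (dot (Y x) x) - qd (op_horner q X) x| <= e * n2 x /\
    `|complex.Im (dot (Y x) x)| <= e * n2 x.
Proof.
move=> e0 qE x; have Ps : sa dot (op_horner q X).
  by split; [exact: op_horner_linear|exact: sa_op_horner].
have zE : dot (Y x - op_horner q X x) x = dot (Y x) x - (qd (op_horner q X) x)%:C.
  by rewrite ipBl qdE.
have -> : complex.Im (dot (Y x) x) = complex.Im (dot (Y x - op_horner q X x) x).
  by rewrite zE; case: (dot (Y x) x) => u v /=; rewrite subr0.
have -> : complex.Re (dot (Y x) x) - qd (op_horner q X) x =
    complex.Re (dot (Y x - op_horner q X x) x).
  by rewrite zE; case: (dot (Y x) x) => u v.
apply: nsq_le_norm; move: (fun_calculus_near e0 qE x) => /(normr_le_n2 Hdot _ _ e0).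
move: (_ - _) => w wx; have n0 := n2_ge0 Hdot x.
have en0 : 0 <= e * n2 x by rewrite mulr_ge0.
have en1 : 0 <= (e * n2 x)%:C by rewrite ler0c.
rewrite -(ler_pXn2r (n := 2) isT (normr_ge0 (dot w x)) en1).
apply: le_trans (psd_cauchy_schwarz w x (sa_id dot) (n2_ge0 Hdot)) _.
rewrite -rmorphXn lecR !qd_id exprMn [n2 x ^+ 2]expr2 mulrA.
by rewrite ler_wpM2r.
Qed.

(** The form is a limit of forms of self-adjoint operators q(X); self-adjointness of f(X) itself is
    bypassed. *)
Lemma fun_calculus_real x : dot (Y x) x = (complex.Re (dot (Y x) x))%:C.
Proof.
suff Im0 : complex.Im (dot (Y x) x) = 0.
  by move: Im0; case: (dot (Y x) x) => u v /= ->.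
apply/eqP; rewrite -normr_eq0 eq_le normr_ge0 andbT; apply/ler_addgt0Pr => d d0.
have n0 := n2_ge0 Hdot x; have n1 : 0 < n2 x + 1 by rewrite ltr_wpDl.
have e0 : 0 < d / (n2 x + 1) by rewrite divr_gt0.
have [q qE] := spectrum_approx e0.
have [_ h] := fun_calculus_form (ltW e0) qE x; rewrite add0r; apply: le_trans h _.
by rewrite mulrAC ler_pdivrMr // ler_wpM2l ?(ltW d0) // lerDl.
Qed.

End fixed.

End functional_calculus.

(** * Compressions to finite-dimensional subspaces *)

Section matrix_forms.
Variable C : numClosedFieldType.

Lemma pencil_shift n (A D : 'M[C]_n) (c s : C) (v : 'cV[C]_n) :
  (A + s *: D - c%:M) *m v = (A - c%:M) *m v + s *: (D *m v).
Proof. by rewrite addrAC mulmxDl -scalemxAl. Qed.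

Lemma segment_mx n (A D : 'M[C]_n) (c s t u : C) (v : 'cV[C]_n) :
  (1 - t) *: ((A + s *: D - c%:M) *m v) + t *: ((A + u *: D - c%:M) *m v) =
  (A + (s + t * (u - s)) *: D - c%:M) *m v.
Proof.
rewrite !pencil_shift; move: (_ *m v) (D *m v) => p q.
by apply/matrixP => i j; rewrite !mxE; ring.
Qed.

Lemma form_shift n (X U : 'M[C]_n) (d : 'I_n -> C) (c : C) (w : 'cV[C]_n) :
  spec_dec X U d -> w^t* *m ((X - c%:M) *m w) =
  w^t* *m (U^t* *m dC (fun i => d i - c) *m U) *m w.
Proof.
move=> /(spec_dec_affine (- c) 1); rewrite scale1r addrC raddfN => ->.
have -> : (fun i => d i - c) = (fun i => - c + 1 * d i).
  by apply/funext => i; rewrite mul1r addrC.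
by rewrite mulmxA.
Qed.

Lemma form_adjoint n (A : 'M[C]_n) (c : C) (u v : 'cV[C]_n) : A^t* = A ->
  c \is Num.real ->
  v^t* *m ((A - c%:M) *m u) = ((A - c%:M) *m v)^t* *m u.
Proof.
move=> Ah cr; have ch : (c%:M)^t* = c%:M :> 'M[C]_n.
  apply/matrixP => i j; rewrite !mxE /= rmorphMn /=.
  by rewrite eq_sym; congr (_ *+ _); exact/CrealP.
by rewrite adjM linearB /= map_mxB Ah ch mulmxA.
Qed.

Lemma form_unitary n (U : 'M[C]_n) (w : 'cV[C]_n) : U \is unitarymx ->
  w^t* *m (U^t* *m dC (fun=> 1) *m U) *m w = w^t* *m w.
Proof. by move=> Uu; rewrite dC1 mulmx1 unitary_tK // mulmx1. Qed.

Lemma form_iter n (X U : 'M[C]_n) (d : 'I_n -> C) (w : 'cV[C]_n) j :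
  spec_dec X U d -> w^t* *m iter j (mulmx X) w =
  w^t* *m (U^t* *m dC (fun i => d i ^+ j) *m U) *m w.
Proof. by move=> /spec_dec_iter ->; rewrite !mulmxA. Qed.

Lemma spec_dec_herm n (X U : 'M[C]_n) (d : 'I_n -> C) : spec_dec X U d ->
  (forall i, d i \is Num.real) -> X^t* = X.
Proof. by move=> [_ ->] dr; rewrite !adjM trmxCK dC_adj // mulmxA. Qed.

Lemma form_pencil n (A D : 'M[C]_n) (c s u : C) (w : 'cV[C]_n) :
  (w^t* *m ((A + u *: D - c%:M) *m w)) 0 0 -
  (w^t* *m ((A + s *: D - c%:M) *m w)) 0 0 = (u - s) * (w^t* *m D *m w) 0 0.
Proof.
rewrite !pencil_shift !mulmxDr -!scalemxAr [w^t* *m (D *m w)]mulmxA.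
move: (w^t* *m D *m w) (w^t* *m _) => q p.
by rewrite !mxE; ring.
Qed.

End matrix_forms.

(** * Orthonormal families *)

Section frames.
Variables (R : realType) (H : completeNormedModType R[i])
  (dot : {dot H for (@Num.conj R[i])}).
Hypothesis Hdot : norm_of_dot dot.
Local Notation C := R[i].
Local Notation n2 := (n2 dot).

Definition frame n (e : 'I_n -> H) := forall i j, dot (e i) (e j) = (i == j)%:R.

Definition coords n (e : 'I_n -> H) (x : H) : 'cV[C]_n := \col_i dot x (e i).

Definition comb n (e : 'I_n -> H) (v : 'cV[C]_n) : H := \sum_i v i 0 *: e i.

Section fixed.
Variables (n : nat) (e : 'I_n -> H).

Lemma coords_linear c x y : coords e (c *: x + y) = c *: coords e x + coords e y.
Proof. by apply/matrixP => i j; rewrite !mxE ipDl ipZl. Qed.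

Lemma combD v w : comb e (v + w) = comb e v + comb e w.
Proof. by rewrite /comb -big_split; apply: eq_bigr => i _; rewrite mxE scalerDl. Qed.

Lemma combZ c v : comb e (c *: v) = c *: comb e v.
Proof. by rewrite /comb scaler_sumr; apply: eq_bigr => i _; rewrite mxE scalerA. Qed.

Lemma dot_comb v x : dot (comb e v) x = ((coords e x)^t* *m v) 0 0.
Proof.
rewrite /comb ip_suml mxE; apply: eq_bigr => i _.
by rewrite ipZl ipC !mxE mulrC.
Qed.

Lemma dot_combr v x : dot x (comb e v) = (v^t* *m coords e x) 0 0.
Proof.
rewrite /comb ip_sumr mxE; apply: eq_bigr => i _.
by rewrite ipZr !mxE.
Qed.

Hypothesis ef : frame e.

Lemma coords_comb v : coords e (comb e v) = v.
Proof.
apply/matrixP => i j; rewrite !mxE /comb ip_suml (bigD1 i) //= big1.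
  by rewrite ipZl ef eqxx mulr1 addr0 [j]ord1.
by move=> l /negPf li; rewrite ipZl ef li mulr0.
Qed.

Lemma comb_residual x v : dot (x - comb e (coords e x)) (comb e v) = 0.
Proof. by rewrite ipBl !dot_combr coords_comb // subrr. Qed.

Lemma n2_comb v : n2 (comb e v) = \sum_i nsq (v i 0).
Proof.
apply: (@complexI R); rewrite n2E // dot_comb coords_comb mxE rmorph_sum.
by apply: eq_bigr => i _; rewrite !mxE /= nsqE normCK mulrC.
Qed.

Lemma bessel x : \sum_i nsq (coords e x i 0) <= n2 x.
Proof.
rewrite -n2_comb; have := comb_residual x (coords e x).
set k := comb e _; have -> : n2 x = n2 ((x - k) + k) by rewrite subrK.
move: (x - k) => r rk; rewrite -lecR !n2E // ipDl !ipDr rk.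
by rewrite [dot k r]ipC rk rmorph0 addr0 add0r lerDr ip_ge0.
Qed.

End fixed.

Definition inspan n (e : 'I_n -> H) x := exists v, x = comb e v.

Lemma comb_ext0 n (e : 'I_n -> H) u (v : 'cV[C]_n.+1) :
  comb (ext0 u e) v = v ord0 0 *: u + comb e (\col_i v (lift ord0 i) 0).
Proof.
rewrite /comb big_ord_recl ext0_0; congr (_ + _); apply: eq_bigr => i _.
by rewrite ext0_S !mxE.
Qed.

Lemma inspan_ext0 n (e : 'I_n -> H) u x : inspan e x -> inspan (ext0 u e) x.
Proof.
move=> [v ->]; exists (\col_i (ext0 0 (fun i => v i 0) i)).
rewrite comb_ext0 !mxE ext0_0 scale0r add0r; congr comb.
by apply/matrixP => i j; rewrite !mxE ext0_S [j]ord1.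
Qed.

(** One Gram-Schmidt step: the new vector is the normalized residual of y. *)
Lemma frame_extend n (e : 'I_n -> H) y : frame e -> ~ inspan e y ->
  exists u, frame (ext0 u e) /\ inspan (ext0 u e) y.
Proof.
move=> ef yN; pose r := y - comb e (coords e y).
have r0 : n2 r != 0.
  apply/eqP => /(n2_eq0 Hdot)/eqP; rewrite subr_eq0 => /eqP h.
  by apply: yN; exists (coords e y).
have rp : 0 < n2 r by rewrite lt0r r0 n2_ge0.
pose s := Num.sqrt (n2 r); have s0 : s != 0 by rewrite gt_eqF // sqrtr_gt0.
have re i : dot r (e i) = 0.
  have -> : e i = comb e (delta_mx i 0).
    rewrite /comb (bigD1 i) //= big1 ?addr0 ?mxE ?eqxx ?scale1r // => j /negPf ji.
    by rewrite mxE ji scale0r.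
  exact: comb_residual.
exists ((s^-1)%:C *: r); split; last first.
  exists (\col_i (ext0 s%:C (fun i => coords e y i 0) i)).
  rewrite comb_ext0 !mxE ext0_0 scalerA -rmorphM divff // scale1r.
  rewrite [X in comb e X](_ : _ = coords e y) ?subrK //.
  by apply/matrixP => i j; rewrite !mxE ext0_S mxE.
have ue i : dot ((s^-1)%:C *: r) (e i) = 0 by rewrite ipZl re mulr0.
move=> i j; case: (unliftP ord0 i) => [i'|] ->; case: (unliftP ord0 j) => [j'|] ->;
  rewrite ?ext0_0 ?ext0_S.
- by rewrite ef (inj_eq lift_inj).
- by rewrite ipC ue rmorph0 eq_sym (negPf (neq_lift _ _)).
- by rewrite ue (negPf (neq_lift _ _)).
- rewrite eqxx ipZl ipZr conjR -(n2E Hdot) -!rmorphM mulrA -expr2 exprVn /s.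
  by rewrite sqr_sqrtr ?ltW // mulVf.
Qed.

Lemma frame_ex : ~ finite_dimensional H -> forall n, exists e : 'I_n -> H, frame e.
Proof.
move=> Hinf; elim=> [|n [e ef]]; first by exists (fun=> 0) => -[].
have [y yN] : exists y, ~ inspan e y.
  apply: contrapT => h; apply: Hinf; exists n, e => x.
  have [v ->] : inspan e x by apply: contrapT => hx; apply: h; exists x.
  by exists (fun i => v i 0).
by have [u [uf _]] := frame_extend ef yN; exists (ext0 u e).
Qed.

Lemma frame_span (s : seq H) : exists n, exists2 e : 'I_n -> H, frame e &
  forall y, y \in s -> inspan e y.
Proof.
elim: s => [|y s [n [e ef es]]]; first by exists 0%N, (fun=> 0) => // -[].
have [ye|yN] := pselect (inspan e y).
  by exists n, e => // z; rewrite inE => /orP[/eqP ->|/es].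
have [u [uf yu]] := frame_extend ef yN; exists n.+1, (ext0 u e) => // z.
by rewrite inE => /orP[/eqP ->|/es/inspan_ext0].
Qed.

End frames.

Section tools.
Variable R : realType.

Lemma ointerval_open (a b : \bar R) : open (ointerval a b).
Proof.
rewrite openE => x Ix; rewrite /interior.
have [u Iu ux] := ointerval_below Ix; have [w Iw xw] := ointerval_above Ix.
have : \forall z \near x, z \in `]u, w[ by apply: near_in_itvoo; rewrite in_itv /= ux.
apply: filterS => z; rewrite in_itv /= => /andP[uz zw].
by apply: ointerval_convex Iu Iw _; rewrite !ltW.
Qed.

Lemma ext_continuous (a b : \bar R) (f : ointerval a b -> R) :
  continuous f <-> forall x, ointerval a b x -> {for x, continuous (ext f)}.
Proof.
have -> : f = sigL (ointerval a b) (ext f).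
  by apply/funext => s; rewrite /sigL /= -ext_val.
have -> : ext (sigL (ointerval a b) (ext f)) = ext f.
  by congr ext; apply/funext => s; rewrite /sigL /= ext_val.
rewrite -subspace_sigL_continuousP (continuous_open_subspace _ (@ointerval_open a b)).
by split => h x Ix; apply: h; [exact: mem_set|exact: set_mem].
Qed.

Variables (H : completeNormedModType R[i]) (dot : {dot H for (@Num.conj R[i])}).
Hypothesis Hdot : norm_of_dot dot.
Local Notation C := R[i].
Local Notation n2 := (n2 dot).
Local Notation qd := (qd dot).
Local Notation sa := (sa dot).

Lemma op_divdiff_form (a b : \bar R) (f : ointerval a b -> R) (A B : H -> H) k
    (t g : nat -> R) x :
  (forall i, (i <= k)%N ->
     dot (fun_calculus f (segment_operator A B (t i)) x) x = (g i)%:C) ->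
  dot (op_divdiff f A B k t x) x = (dd k t g)%:C.
Proof.
elim: k t g => [|k IH] t g tg; first exact: (tg 0%N).
rewrite /= ipZl ipBl (IH t g) ?(IH (shift t) (shift g)) -?rmorphB -?rmorphM //.
  by move=> i ik; exact: (tg i.+1).
by move=> i ik; apply: tg; exact: leqW.
Qed.

(** X - m is positive with bounded form, hence bounded by [psd_norm]. *)
Lemma bounded_of_bounds X (m M : R) : sa X ->
  (forall x, m * n2 x <= qd X x <= M * n2 x) -> bounded_operator X.
Proof.
move=> Xs XmM; pose g := `|M - m|; have g0 : 0 <= g by exact: normr_ge0.
have Es := sa_shift m Xs.
have Eg x : 0 <= qd (fun x => X x - m%:C *: x) x <= g * n2 x.
  have /andP[h1 h2] := XmM x; rewrite (qd_shift Hdot) // subr_ge0 h1 /=.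
  apply: le_trans (_ : (M - m) * n2 x <= _); first by rewrite mulrBl lerD2r.
  by rewrite ler_wpM2r ?n2_ge0 // ler_norm.
have Eb : bounded_operator (fun x => X x - m%:C *: x).
  apply: (n2_bounded_operator Hdot (K := g)) => //; first exact: Es.1.
  move=> x; apply: le_trans (psd_norm Hdot Es Eg x) _.
  by rewrite expr2 -mulrA ler_wpM2l //; case/andP: (Eg x).
have -> : X = (fun x => X x - m%:C *: x - (- m%:C) *: x).
  by apply/funext => x; rewrite scaleNr opprK subrK.
exact: bounded_shift.
Qed.

Lemma qd_op_horner X (p : {poly R}) x (g : nat -> R) :
  (forall i, (i < size p)%N -> dot (iter i X x) x = (g i)%:C) ->
  qd (op_horner p X) x = \sum_(i < size p) p`_i * g i.
Proof.
move=> gE; apply: (@complexI R); rewrite /qd /op_horner ip_suml rmorph_sum.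
rewrite (_ : \sum_(i < size p) _ = \sum_(i < size p) (p`_i * g i)%:C).
  by rewrite -rmorph_sum.
by apply: eq_bigr => i _; rewrite ipZl gE // -rmorphM.
Qed.

Lemma qf_horner_sum n (p : {poly R}) (U : 'M[C]_n) d v :
  qf (horner p) U d v = \sum_(i < size p) p`_i * qf (fun y => y ^+ i) U d v.
Proof.
rewrite -(@eq_qf _ _ (fun y => \sum_(i < size p) p`_i * y ^+ i)); last first.
  by move=> i; rewrite horner_coef.
rewrite (@qf_sum _ _ _ n (fun (i : 'I_(size p)) y => p`_i * y ^+ i)).
by apply: eq_bigr => i _; rewrite (@qfZ _ n (p`_i) (fun y => y ^+ i)).
Qed.

Lemma sum_nsq_unitary n (X U : 'M[C]_n) d (w : 'cV[C]_n) : sdec X U d ->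
  \sum_i nsq ((U *m w) i 0) = \sum_i nsq (w i 0).
Proof.
move=> [Uu _]; apply: (@complexI R).
transitivity ((w^t* *m w) 0 0).
  have := qfE (fun=> 1) U d w; rewrite /qf.
  under eq_bigr do rewrite mul1r.
  by move=> ->; rewrite form_unitary.
rewrite mxE rmorph_sum; apply: eq_bigr => i _.
by rewrite !mxE /= nsqE normCK mulrC.
Qed.

Section lift.
Variables (n : nat) (e : 'I_n -> H) (c : R).
Hypothesis ef : frame dot e.
Implicit Types (X U : 'M[C]_n) (d : 'I_n -> R) (v w : 'cV[C]_n).

(** Acts as X on the span of the frame and as the scalar c on its orthogonal complement; taking c in
    the interval keeps the spectrum there. *)
Definition lift X (x : H) : H :=
  c%:C *: x + comb e ((X - c%:C%:M) *m coords dot e x).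

Lemma lift_linear X : linear (lift X).
Proof.
move=> z x y; rewrite /lift coords_linear mulmxDr -scalemxAr combD combZ !scalerDr.
by rewrite !scalerA [z * _]mulrC addrACA.
Qed.

Lemma lift_selfadjoint X : X^t* = X -> selfadjoint dot (lift X).
Proof.
move=> Xh x y; rewrite /lift ipDl ipDr ipZl ipZr conjR; congr (_ + _).
by rewrite dot_comb dot_combr form_adjoint // complex_real.
Qed.

Lemma lift_iter X v i : iter i (lift X) (comb e v) = comb e (iter i (mulmx X) v).
Proof.
elim: i => [|i IH] //; rewrite !iterS IH /lift coords_comb // -combZ -combD.
by rewrite mulmxBl mul_scalar_mx addrC subrK.
Qed.

Section spectral.
Variables (X U : 'M[C]_n) (d : 'I_n -> R).
Hypothesis Xd : sdec X U d.

Lemma sdec_herm : X^t* = X.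
Proof.
by apply: spec_dec_herm Xd _ => i; rewrite complex_real.
Qed.

Lemma lift_sa : sa (lift X).
Proof. by split; [exact: lift_linear|apply: lift_selfadjoint; exact: sdec_herm]. Qed.

Lemma qd_lift x : qd (lift X) x =
  c * n2 x + qf (fun y => y - c) U d (coords dot e x).
Proof.
apply: (@complexI R); rewrite (qdE _ lift_sa) /lift ipDl ipZl rmorphD rmorphM /= n2E //.
congr (_ + _); rewrite dot_comb qfE (form_shift _ _ Xd).
have -> : (fun i => (d i)%:C - c%:C) = (fun i => (d i - c)%:C) :> ('I_n -> C).
  by apply/funext => i; rewrite rmorphB.
by [].
Qed.

(** The spectral masses of the coordinates sum to S <= |x|^2 by Bessel, and the remaining mass |x|^2
    - S sits at c. *)
Lemma lift_bounds (m M : R) : m <= c <= M -> (forall i, m <= d i <= M) ->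
  forall x, m * n2 x <= qd (lift X) x <= M * n2 x.
Proof.
move=> /andP[mc cM] dmM x; rewrite qd_lift; set w := coords dot e x.
have := bessel Hdot ef x; rewrite -/w -(sum_nsq_unitary w Xd).
set S := \sum_i _ => S0.
have lo : (m - c) * S <= qf (fun y => y - c) U d w.
  rewrite /S mulr_sumr; apply: ler_sum => i _; rewrite ler_wpM2r ?nsq_ge0 //.
  by rewrite lerD2r; case/andP: (dmM i).
have hi : qf (fun y => y - c) U d w <= (M - c) * S.
  rewrite /S mulr_sumr; apply: ler_sum => i _; rewrite ler_wpM2r ?nsq_ge0 //.
  by rewrite lerD2r; case/andP: (dmM i).
have h1 : 0 <= (c - m) * (n2 x - S) by rewrite mulr_ge0 ?subr_ge0.
have h2 : 0 <= (M - c) * (n2 x - S) by rewrite mulr_ge0 ?subr_ge0.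
apply/andP; split.
  by apply: le_trans (lerD (lexx _) lo); rewrite -subr_ge0; apply: le_trans h1 _; rewrite le_eqVlt; apply/orP; left; apply/eqP; ring.
by apply: le_trans (lerD (lexx _) hi) _; rewrite -subr_ge0; apply: le_trans h2 _; rewrite le_eqVlt; apply/orP; left; apply/eqP; ring.
Qed.

Lemma lift_bounded : bounded_operator (lift X).
Proof.
pose m := c - \sum_i `|d i - c|; pose M := c + \sum_i `|d i - c|.
have S0 : 0 <= \sum_i `|d i - c| by rewrite sumr_ge0.
apply: (bounded_of_bounds (m := m) (M := M)); first exact: lift_sa.
apply: lift_bounds; first by rewrite /m /M gerBl S0 lerDl S0.
move=> i; have : `|d i - c| <= \sum_i `|d i - c|.
  by rewrite [leRHS](bigD1 i) //= lerDl sumr_ge0.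
by rewrite ler_norml /m /M => /andP[h1 h2]; apply/andP; split; lra.
Qed.

Lemma qd_lift_horner (p : {poly R}) v :
  qd (op_horner p (lift X)) (comb e v) = qf (horner p) U d v.
Proof.
rewrite qf_horner_sum; apply: (@qd_op_horner _ _ _ (fun i => qf (fun y => y ^+ i) U d v)) => i _.
rewrite lift_iter dot_comb coords_comb // (form_iter _ _ Xd) qfE.
have -> : (fun j => (d j)%:C ^+ i) = (fun j => (d j ^+ i)%:C) :> ('I_n -> C).
  by apply/funext => j; rewrite rmorphXn.
by [].
Qed.

End spectral.

Lemma lift_segment (A D : 'M[C]_n) (s u t : R) x :
  segment_operator (lift (A + s%:C *: D)) (lift (A + u%:C *: D)) t x =
  lift (A + (s + t * (u - s))%:C *: D) x.
Proof.
rewrite /segment_operator /lift !scalerDr addrACA -combZ -combZ -combD; congr (_ + comb e _).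
  by rewrite -scalerDl scalerA -rmorphD -rmorphM; congr (_%:C *: _); ring.
by rewrite rmorphB rmorph1 segment_mx rmorphD rmorphM rmorphB.
Qed.

Lemma lift_loewner (A D : 'M[C]_n) (s u : R) : psd D -> s <= u ->
  loewner_le dot (lift (A + s%:C *: D)) (lift (A + u%:C *: D)).
Proof.
move=> [_ Dp] su x.
change (0 <= dot (lift (A + u%:C *: D) x - lift (A + s%:C *: D) x) x); rewrite /lift.
have E (h p q : H) : (h + p) - (h + q) = p - q by rewrite opprD addrACA subrr add0r.
have DB p q : dot (comb e p - comb e q) x =
    ((coords dot e x)^t* *m p) 0 0 - ((coords dot e x)^t* *m q) 0 0.
  by rewrite ipBl !dot_comb.
rewrite E DB (form_pencil A D c%:C s%:C u%:C).
by rewrite mulr_ge0 // -rmorphB ler0c subr_ge0.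
Qed.

End lift.
End tools.

Section abstract_compression.
Variable C : numClosedFieldType.

Lemma form_spec_col n (X U : 'M[C]_n) (d : 'I_n -> C) i : spec_dec X U d ->
  U *m (U^t* *m delta_mx i 0) = delta_mx i 0 :> 'cV_n.
Proof. by move=> [Uu _]; rewrite mulmxA unitary_Kt // mul1mx. Qed.

End abstract_compression.

(** * Equivalence of operator and matrix tonicity *)

Section embedding.
Variables (R : realType) (H : completeNormedModType R[i])
  (dot : {dot H for (@Num.conj R[i])}).
Hypothesis Hdot : norm_of_dot dot.
Hypothesis Hnz : exists x : H, x != 0.
Variables (a b : \bar R).
Local Notation C := R[i].
Local Notation n2 := (n2 dot).
Local Notation qd := (qd dot).
Local Notation I := (ointerval a b).

Lemma qf_near n (f g : R -> R) (e : R) (U : 'M[C]_n) d v :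
  (forall i, `|f (d i) - g (d i)| <= e) ->
  `|qf f U d v - qf g U d v| <= e * \sum_i nsq ((U *m v) i 0).
Proof.
move=> fg; rewrite -sumrB mulr_sumr; apply: le_trans (ler_norm_sum _ _ _) _.
apply: ler_sum => i _; rewrite -mulrBl normrM ler_pM //.
by rewrite ger0_norm // nsq_ge0.
Qed.

Lemma eq_of_close (u v S : R) : 0 <= S ->
  (forall e, 0 < e -> `|u - v| <= e * S) -> u = v.
Proof.
move=> S0 h; apply/eqP; rewrite -subr_eq0 -normr_eq0 eq_le normr_ge0 andbT.
have S1 : 0 < S + 1 by rewrite ltr_wpDl.
apply/ler_addgt0Pr => d d0; rewrite add0r.
apply: le_trans (h (d / (S + 1)) _) _; first by rewrite divr_gt0.
by rewrite mulrAC ler_pdivrMr // ler_wpM2l ?(ltW d0) // lerDl.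
Qed.

(* [X] will be a lift of the matrix with spectral data [(U, d)], or an operator
   whose compression is that matrix: only the moments of [x] matter. *)
Lemma fun_calculus_moments (f : ointerval a b -> R) (X : H -> H) (m M : R) x n
    (U : 'M[C]_n) (d : 'I_n -> R) v (q : {poly R}) (e : R) :
  (forall x, I x -> {for x, continuous (ext f)}) ->
  bounded_operator X -> selfadjoint dot X -> I m -> I M ->
  (forall y, m * n2 y <= qd X y <= M * n2 y) ->
  (forall i, m <= d i <= M) -> \sum_i nsq ((U *m v) i 0) = n2 x ->
  0 <= e -> (forall r, m <= r <= M -> `|ext f r - q.[r]| <= e) ->
  qd (op_horner q X) x = qf (horner q) U d v ->
  `|complex.Re (dot (fun_calculus f X x) x) - qf (ext f) U d v| <= e * (2 * n2 x).
Proof.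
move=> fc Xb Xs Im IM XmM dmM vx e0 qE qX.
have [h _] := fun_calculus_form Hdot Hnz Xb Xs Im IM XmM fc e0 qE x.
have := @qf_near _ (ext f) (horner q) e U d v (fun i => qE _ (dmM i)).
rewrite vx distrC -qX => h'.
rewrite -[X in X - _](subrK (qd (op_horner q X) x)) -addrA.
apply: le_trans (ler_normD _ _) _; rewrite mulr_natl mulr2n mulrDr.
exact: lerD.
Qed.

Lemma fun_calculus_lift (f : ointerval a b -> R) n (e : 'I_n -> H) c
    (X U : 'M[C]_n) d v :
  (a < b)%E -> (forall x, I x -> {for x, continuous (ext f)}) -> frame dot e ->
  I c -> sdec X U d -> (forall i, I (d i)) ->
  dot (fun_calculus f (lift dot e c X) (comb e v)) (comb e v) =
    (qf (ext f) U d v)%:C /\ Bsa dot a b (lift dot e c X).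
Proof.
move=> ab fc ef Ic Xd dI; pose L := lift dot e c X; pose x := comb e v.
have [|m [M [Im IM mM mME]]] := @seq_inside R a b (c :: codom d) ab.
  by move=> y; rewrite inE => /orP[/eqP -> //|/codomP[i ->]].
have cmM : m <= c <= M by have /andP[h1 h2] := mME c (mem_head _ _); rewrite !ltW.
have dmM i : m <= d i <= M.
  by have /andP[] := mME (d i) (mem_behead (s := c :: codom d) (codom_f d i)); move=> h1 h2; rewrite !ltW.
have Lb := lift_bounded Hdot c ef Xd; have Ls := (lift_sa dot e c Xd).2.
have LmM := lift_bounds Hdot ef Xd cmM dmM.
split; last first.
  apply: (bounds_Bsa Hdot Lb Ls _ LmM) => r; exact: ointerval_convex Im IM.
have vx : \sum_i nsq ((U *m v) i 0) = n2 (comb e v).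
  by rewrite (sum_nsq_unitary v Xd) n2_comb.
rewrite (fun_calculus_real Hdot Hnz Lb Ls Im IM LmM fc); congr (_%:C).
apply: (@eq_of_close _ _ (2 * n2 x)); first by rewrite mulr_ge0 ?n2_ge0.
move=> eta eta0; have [q qE] := spectrum_approx Hdot Hnz Im IM LmM fc eta0.
apply: (fun_calculus_moments fc Lb Ls Im IM LmM dmM vx (ltW eta0) qE).
exact: qd_lift_horner.
Qed.

(** The lifts of the pencil at its first and last nodes serve as A and B. Nodes are rescaled
    affinely to [0, 1], and [dd_affine] restores them at the cost of a positive factor. *)
Lemma tone_mtone k (f : ointerval a b -> R) : (a < b)%E -> ~ finite_dimensional H ->
  operator_tone dot k.+1 f -> mtone k.+1 (ext f) I.
Proof.
move=> ab Hinf [/ext_continuous fc ft] n A D U d v t Dp tS Xd dI.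
have [e ef] := frame_ex Hdot Hinf n; have [c Ic] := ointerval_ex ab.
pose b0 := t k.+1 - t 0%N.
have b0p : 0 < b0 by rewrite subr_gt0 (incr_lt tS) //= leqnn.
have b00 : b0 != 0 by rewrite gt_eqF.
pose s i := (t i - t 0%N) / b0.
have sE i : t i = t 0%N + b0 * s i by rewrite /s; field.
have s0 : s 0%N = 0 by rewrite /s subrr mul0r.
have s1 : s k.+1 = 1 by rewrite /s divff.
have sS i : (i < k.+1)%N -> s i < s i.+1.
  by move=> ik; rewrite ltr_pM2r ?invr_gt0 // ltrD2r tS.
pose L i := lift dot e c (A + (t i)%:C *: D).
have LE i (ik : (i <= k.+1)%N) := fun_calculus_lift v ab fc ef Ic (Xd i ik) (fun j => dI i j ik).
have seg i : segment_operator (L 0%N) (L k.+1) (s i) = L i.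
  apply/funext => y; rewrite lift_segment /L.
  by rewrite [X in lift _ _ _ (A + X%:C *: D)](_ : _ = t i) // mulrC -/b0 -sE.
have LL : loewner_le dot (L 0%N) (L k.+1).
  by apply: lift_loewner => //; rewrite -subr_ge0 ltW.
have := ft _ _ (LE 0%N isT).2 (LE k.+1 (leqnn _)).2 LL s s0 s1 sS (comb e v).
rewrite (@op_divdiff_form _ _ _ _ _ _ _ _ _ _ (fun l => qf (ext f) (U l) (d l) v)).
  rewrite ler0c => h; rewrite (@eq_dd _ _ t (fun i => t 0%N + b0 * s i) _ (fun l => qf (ext f) (U l) (d l) v)) //.
  by rewrite dd_affine // mulr_ge0 // invr_ge0 exprn_ge0 // ltW.
by move=> i ik; rewrite seg; exact: (LE i ik).1.
Qed.

Section compression.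
Variables (n : nat) (e : 'I_n -> H).
Hypothesis ef : frame dot e.
Implicit Types (X : H -> H).

Definition compress X : 'M[C]_n := \matrix_(i, j) dot (X (e j)) (e i).

Lemma coords_compress X v : linear X ->
  coords dot e (X (comb e v)) = compress X *m v.
Proof.
move=> Xl; apply/matrixP => i j; rewrite !mxE /comb (lin_sum Xl) ip_suml.
by apply: eq_bigr => l _; rewrite (linZ Xl) ipZl !mxE mulrC [j]ord1.
Qed.

Lemma compress_form X v : linear X ->
  (v^t* *m compress X *m v) 0 0 = dot (X (comb e v)) (comb e v).
Proof. by move=> Xl; rewrite dot_combr coords_compress // mulmxA. Qed.

Lemma compress_herm X : selfadjoint dot X -> (compress X)^t* = compress X.
Proof. by move=> Xs; apply/matrixP => i j; rewrite !mxE -ipC Xs. Qed.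

Lemma compress_segment (A B : H -> H) (t : R) :
  compress (segment_operator A B t) = compress A + t%:C *: compress (B - A).
Proof.
apply/matrixP => i j; rewrite !mxE /segment_operator -[(B - A) (e j)]/(B (e j) - A (e j)).
by rewrite [dot (B _ - A _) _]ipBl ipDl !ipZl rmorphB rmorph1; ring.
Qed.

Lemma compress_bounds X (m M : R) U d : linear X ->
  (forall y, m * n2 y <= qd X y <= M * n2 y) -> sdec (compress X) U d ->
  forall i, m <= d i <= M.
Proof.
move=> Xl XmM Xd i; pose v : 'cV[C]_n := U^t* *m delta_mx i 0.
have Uv : U *m v = delta_mx i 0 by exact: form_spec_col Xd.
have q1 (g : R -> R) : qf g U d v = g (d i).
  rewrite /qf Uv (bigD1 i) //= big1 ?addr0; last first.
    by move=> j /negPf ji; rewrite mxE ji nsq0 mulr0.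
  by rewrite mxE !eqxx (nsq_real 1) expr1n mulr1.
have nv : n2 (comb e v) = 1.
  by rewrite n2_comb // -(sum_nsq_unitary v Xd) -(q1 (fun=> 1)); apply: eq_bigr => j _; rewrite mul1r.
have := XmM (comb e v); rewrite nv !mulr1 /qd -compress_form //.
have [_ XE] := Xd; rewrite {1 2}XE -(@qfE R n id) /=.
by rewrite (q1 id).
Qed.

(** While the vectors X^i x stay in the span, the compression acts on them as X does, so the moments
    at x agree. *)
Lemma compress_moments X x U d N : linear X ->
  (forall i, (i <= N)%N -> inspan e (iter i X x)) -> sdec (compress X) U d ->
  forall q : {poly R}, (size q <= N.+1)%N ->
  qd (op_horner q X) x = qf (horner q) U d (coords dot e x).
Proof.
move=> Xl sp Xd q qN; rewrite qf_horner_sum.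
have fix_ y : inspan e y -> comb e (coords dot e y) = y.
  by move=> [w ->]; rewrite coords_comb.
have it i : (i <= N)%N -> coords dot e (iter i X x) = iter i (mulmx (compress X)) (coords dot e x).
  elim: i => [|i IH] // iN; rewrite !iterS -IH ?(ltnW iN) // -coords_compress //.
  by rewrite fix_ //; apply: sp; exact: ltnW.
apply: (@qd_op_horner _ _ _ _ _ _ (fun i => qf (fun y => y ^+ i) U d (coords dot e x))) => i iq.
have iN : (i <= N)%N by rewrite -ltnS; exact: leq_trans qN.
rewrite -[X in dot _ X](fix_ x (sp 0%N isT)) dot_combr it // (form_iter _ _ Xd) qfE.
have -> : (fun j => (d j)%:C ^+ i) = (fun j => (d j ^+ i)%:C) :> ('I_n -> C).
  by apply/funext => j; rewrite rmorphXn.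
by [].
Qed.

End compression.

Lemma segment_bounded (A B : H -> H) t : bounded_operator A -> bounded_operator B ->
  bounded_operator (segment_operator A B t).
Proof.
move=> [Al Ac] [Bl Bc]; split.
  move=> c x y; rewrite /segment_operator Al Bl !scalerDr !scalerA addrACA.
  by rewrite ![c * _]mulrC.
move=> x; apply: cvgD; apply: cvgZr; [exact: Ac|exact: Bc].
Qed.

Lemma segment_selfadjoint (A B : H -> H) t : selfadjoint dot A -> selfadjoint dot B ->
  selfadjoint dot (segment_operator A B t).
Proof.
move=> As Bs x y; rewrite /segment_operator ipDl ipDr !ipZl !ipZr !conjR.
by rewrite As Bs.
Qed.

Lemma segment_qd (A B : H -> H) t x :
  qd (segment_operator A B t) x = (1 - t) * qd A x + t * qd B x.
Proof.
by rewrite /qd /segment_operator ipDl !ipZl raddfD /= -!Re_mul_real.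
Qed.

(** Fix x and a polynomial q close to f. On the span of the vectors X_i^j x with j <= size q, the
    compressions form a matrix pencil for which q has the same forms at x as for the X_i. The scalar
    divided difference is then within eta of a nonnegative one. *)
Lemma mtone_tone k (f : ointerval a b -> R) : (a < b)%E ->
  (forall x, I x -> {for x, continuous (ext f)}) -> mtone k (ext f) I ->
  operator_tone dot k f.
Proof.
move=> ab fc ft; split; first exact/ext_continuous.
move=> A B [+ + +] [+ + +] AB t t0 t1 tS.
move=> Ab As Asp Bb Bs Bsp x.
have [mA [MA [ImA IMA AmM]]] := Bsa_bounds Hdot Hnz (And3 Ab As Asp).
have [mB [MB [ImB IMB BmM]]] := Bsa_bounds Hdot Hnz (And3 Bb Bs Bsp).
pose m := Num.min mA mB; pose M := Num.max MA MB.
have Im : I m by rewrite /m; case: leP.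
have IM : I M by rewrite /M; case: leP.
have t01 i : (i <= k)%N -> 0 <= t i <= 1.
  move=> ik; rewrite -t0 -t1; apply/andP; split.
    by case: i ik => // i ik; rewrite ltW // (incr_lt tS).
  move: ik; rewrite leq_eqVlt => /orP[/eqP -> //|ik].
  by rewrite ltW // (incr_lt tS) // ik leqnn.
pose X i := segment_operator A B (t i).
have Xb i : bounded_operator (X i) by exact: segment_bounded.
have Xs i : selfadjoint dot (X i) by exact: segment_selfadjoint.
have XmM i (ik : (i <= k)%N) y : m * n2 y <= qd (X i) y <= M * n2 y.
  have /andP[u0 u1] := t01 i ik; rewrite segment_qd.
  have ny := n2_ge0 Hdot y.
  have /andP[a1 a2] := AmM y; have /andP[b1 b2] := BmM y.
  have am : m * n2 y <= mA * n2 y by rewrite ler_wpM2r // /m ge_min lexx.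
  have bm : m * n2 y <= mB * n2 y by rewrite ler_wpM2r // /m ge_min lexx orbT.
  have aM : MA * n2 y <= M * n2 y by rewrite ler_wpM2r // /M le_max lexx.
  have bM : MB * n2 y <= M * n2 y by rewrite ler_wpM2r // /M le_max lexx orbT.
  have E z : z = (1 - t i) * z + t i * z by ring.
  rewrite [m * _]E [M * _]E; apply/andP; split; apply: lerD; apply: ler_wpM2l => //;
    rewrite ?subr_ge0 //.
  - exact: le_trans a1.
  - exact: le_trans b1.
  - exact: le_trans aM.
  - exact: le_trans bM.
have fr i (ik : (i <= k)%N) :=
  fun_calculus_real Hdot Hnz (Xb i) (Xs i) Im IM (XmM i ik) fc x.
rewrite (op_divdiff_form (g := fun i => complex.Re (dot (fun_calculus f (X i) x) x))) //.
rewrite ler0c; set g := fun i => _.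
have [K K0 KE] := dd_bound k t.
have nx := n2_ge0 Hdot x.
(* Each form is off by at most 2 e0 |x|^2 and the divided difference multiplies errors by at most K;
   the 1 avoids a zero denominator. *)
apply/ler_addgt0Pl => eta eta0; pose e0 := eta / (K * (2 * n2 x) + 1).
have Kn : 0 <= K * (2 * n2 x) by rewrite !mulr_ge0.
have e0p : 0 < e0 by rewrite divr_gt0 // ltr_wpDl.
have [q qE] := spectrum_approx Hdot Hnz Im IM (XmM 0%N isT) fc e0p.
have [n [e ef esp]] := frame_span Hdot [seq iter j (X i) x | i <- iota 0 k.+1, j <- iota 0 (size q).+1].
have sp i j : (i <= k)%N -> (j <= size q)%N -> inspan e (iter j (X i) x).
  move=> ik jq; apply: esp; apply/allpairsP; exists (i, j).
  by rewrite !mem_iota /= !add0n !ltnS.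
pose D := compress e (B - A); pose A' := compress e A.
have Dl : linear (B - A).
  move=> c y z; rewrite -[(B - A) _]/(B (c *: y + z) - A (c *: y + z)).
  rewrite -[(B - A) y]/(B y - A y) -[(B - A) z]/(B z - A z) Ab.1 Bb.1.
  by rewrite opprD addrACA scalerBr.
have Dsa : selfadjoint dot (B - A).
  move=> y z; rewrite -[(B - A) z]/(B z - A z) -[(B - A) y]/(B y - A y).
  by rewrite ipBl ipBr As Bs.
have Dp : psd D.
  split; first exact: compress_herm.
  by move=> v; rewrite compress_form //; exact: AB.
have XE i : compress e (X i) = A' + (t i)%:C *: D by exact: compress_segment.
have [U [d Ud]] := sdec_exf (fun i => compress_herm e (Xs i)).
pose xi := coords dot e x.
have dmM i j : (i <= k)%N -> m <= d i j <= M.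
  by move=> ik; apply: (compress_bounds ef (Xb i).1 (XmM i ik) (Ud i)).
have h0 : 0 <= dd k t (fun i => qf (ext f) (U i) (d i) xi).
  apply: (ft n A' D) => //.
  - by move=> l lk; rewrite -XE.
  - by move=> l i lk; apply: ointerval_convex Im IM _; exact: dmM.
have hx i : \sum_j nsq ((U i *m xi) j 0) = n2 x.
  rewrite (sum_nsq_unitary _ (Ud i)) /xi -(n2_comb Hdot ef).
  by have [w] := sp 0%N 0%N isT isT; rewrite /= => ->; rewrite coords_comb.
have near i : (i <= k)%N -> `|g i - qf (ext f) (U i) (d i) xi| <= e0 * (2 * n2 x).
  move=> ik; apply: (fun_calculus_moments fc (Xb i) (Xs i) Im IM (XmM i ik)
    (fun j => dmM i j ik) (hx i) (ltW e0p) qE).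
  apply: (compress_moments ef (Xb i).1 (fun j => sp i j ik) (Ud i)).
  exact: leqnSn.
have := KE _ _ near; rewrite ddB ler_norml => /andP[+ _].
have : K * (e0 * (2 * n2 x)) <= eta.
  rewrite mulrCA /e0 mulrAC ler_pdivrMr ?ltr_wpDl // ler_wpM2l ?(ltW eta0) //.
  by rewrite lerDl.
by move: h0; clear; lra.
Qed.

End embedding.

(** * The cones of tone functions *)

Section abstract_scalar.
Variable C : numClosedFieldType.

Lemma spec_dec_scalar n (c : C) :
  spec_dec (0 + c *: 1%:M : 'M[C]_n) 1%:M (fun=> c).
Proof.
split.
  apply/unitarymxP; rewrite mul1mx; apply/matrixP => i j.
  by rewrite !mxE eq_sym /=; case: eqP; rewrite ?rmorph1 ?rmorph0.
have -> : (1%:M : 'M[C]_n)^t* = 1%:M.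
  by apply/matrixP => i j; rewrite !mxE eq_sym /=; case: eqP; rewrite ?rmorph1 ?rmorph0.
rewrite mul1mx mulmx1 add0r; apply/matrixP => i j.
by rewrite dCE !mxE mulr_natr.
Qed.

End abstract_scalar.

Lemma cvg_scaleB (R : realType) (T : Type) (F : set_system T) {FF : Filter F}
    (u v : T -> R) (Q u0 v0 : R) : u x @[x --> F] --> u0 -> v x @[x --> F] --> v0 ->
  Q * u x - v x @[x --> F] --> Q * u0 - v0.
Proof. by move=> uc vc; apply: cvgB => //; exact: cvgMr. Qed.

Section cone.
Variables (R : realType) (a b : \bar R).
Local Notation I := (ointerval a b).
Implicit Types (f g : ointerval a b -> R).

(** The pencil t -> t of matrices of size 1 gives ordinary divided differences of F. *)
Lemma scalar_pencil k (F : R -> R) (y : nat -> R) : mtone k F I ->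
  (forall l, (l <= k)%N -> I (y l)) -> (forall l, (l < k)%N -> y l < y l.+1) ->
  0 <= dd k y (fun l => F (y l)).
Proof.
move=> Fk yI yS.
have := Fk 1%N 0 1%:M (fun=> 1%:M) (fun l _ => y l) (const_mx 1) y (@psd1 _ _) yS
  (fun l _ => spec_dec_scalar _ _) (fun l _ lk => yI l lk).
rewrite (@eq_dd _ k y y _ (fun l => F (y l))) // => l _.
by rewrite /qf big_ord1 mul1mx mxE (nsq_real 1) expr1n mulr1.
Qed.

(** Describes tonicity of order k.+1 with continuity, which pointwise limits need not preserve,
    replaced by the Harnack inequality for remainders at nodes s_0, ..., s_k. *)
Definition tone_data k f := mtone k.+1 (ext f) I /\ harnack k (ext f) I.

Lemma eval_cvg (f : {ptws ointerval a b -> R}) x :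
  ext h x @[h --> f] --> ext f x.
Proof.
rewrite /ext; case: pselect => [Ix|nI]; last by apply: cvg_cst; exact: (nbhs_filter f).
exact: (@proj_continuous _ (fun=> R) (exist _ x (mem_set Ix)) f).
Qed.

Lemma closure_ge0 (S : set {ptws ointerval a b -> R})
    (L : {ptws ointerval a b -> R} -> R) f : continuous L ->
  (forall h, S h -> 0 <= L h) -> closure S f -> 0 <= L f.
Proof.
move=> Lc LS; have cl : closed (L @^-1` [set x | 0 <= x]).
  by apply: closed_comp => [x _|]; [exact: Lc|exact: closed_ge].
move=> Sf; have : closure (L @^-1` [set x | 0 <= x]) f.
  by apply: closureS Sf => h /LS.
by move=> /cl.
Qed.

(** Each clause asserts nonnegativity of a functional of finitely many values, which is continuous
    for pointwise convergence. *)
Lemma tone_data_closed k : closed [set f : {ptws ointerval a b -> R} | tone_data k f].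
Proof.
move=> f fS; split.
  move=> n A D U d v t Dp tS Xd dI.
  apply: (closure_ge0 (L := fun h => dd k.+1 t (fun l => qf (ext h) (U l) (d l) v)) _ _ fS).
    move=> h; have FF : Filter (nbhs h) := nbhs_filter h.
    apply: (@dd_cvg _ _ _ FF _ _ (fun g l => qf (ext g) (U l) (d l) v)) => l _.
    by apply: (@qf_cvg _ _ _ FF) => i; exact: eval_cvg.
  by move=> h [hk _]; exact: hk Dp tS Xd dI.
move=> lo hi s y z Ilo Ihi sb sS yb zb yz ys zs; set Q := _ + _.
have rc x (h : {ptws ointerval a b -> R}) :
    remainder k s (ext g) x @[g --> h] --> remainder k s (ext h) x.
  have FF : Filter (nbhs h) := nbhs_filter h.
  by apply: (@remainder_cvg _ _ _ FF) => [j jk|]; exact: eval_cvg.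
apply/andP; split.
  apply: (closure_ge0 (L := fun h => remainder k s (ext h) y) _ _ fS) => [h|h [_ hk]].
    exact: rc.
  by have /andP[] := hk lo hi s y z Ilo Ihi sb sS yb zb yz ys zs.
rewrite -subr_ge0; apply: (closure_ge0
  (L := fun h => Q * remainder k s (ext h) z - remainder k s (ext h) y) _ _ fS) => [h|h [_ hk]].
  exact: (@cvg_scaleB _ _ _ (nbhs_filter h) _ _ Q _ _ (rc z h) (rc y h)).
by rewrite subr_ge0; have /andP[] := hk lo hi s y z Ilo Ihi sb sS yb zb yz ys zs.
Qed.

Lemma tone_data0 k : tone_data k (fun=> 0).
Proof.
have e0 : ext (fun _ : ointerval a b => 0) = (fun=> 0 : R).
  by apply/funext => x; rewrite /ext; case: pselect.
split; rewrite e0.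
  move=> n A D U d v t _ _ _ _.
  rewrite (@eq_dd _ _ t t _ (fun=> 0)) ?dd0 // => l _.
  by rewrite /qf big1 // => i _; rewrite mul0r.
move=> lo hi s y z *; suff rem0 x : remainder k s (fun=> 0) x = 0.
  by rewrite !rem0 mulr0 lexx.
by rewrite /remainder (@eq_dd _ _ s s _ (fun=> 0)) ?dd0 // => l _; rewrite subrr mul0r.
Qed.

Lemma tone_data_lin k f g (c : R) : 0 <= c -> tone_data k f -> tone_data k g ->
  tone_data k (fun s => c * f s + g s).
Proof.
move=> c0 [ft fh] [gt gh].
have eE : ext (fun s => c * f s + g s) = (fun x => c * ext f x + ext g x).
  by apply/funext => x; exact: ext_lin.
split; rewrite eE.
  move=> n A D U d v t Dp tS Xd dI.
  rewrite (@eq_dd _ _ t t _ (fun l => c * qf (ext f) (U l) (d l) v + qf (ext g) (U l) (d l) v)) //.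
    have fd := ft n A D U d v t Dp tS Xd dI; have gd := gt n A D U d v t Dp tS Xd dI.
    by rewrite ddD ddZ addr_ge0 // mulr_ge0.
  by move=> l _; rewrite (qfD (fun x => c * ext f x)) qfZ.
move=> lo hi s y z Ilo Ihi sb sS yb zb yz ys zs; set Q := _ + _.
have remE x : remainder k s (fun x => c * ext f x + ext g x) x =
    c * remainder k s (ext f) x + remainder k s (ext g) x.
  by rewrite /remainder -ddZ -ddD; apply: eq_dd => // l _; ring.
have /andP[f0 f1] := fh lo hi s y z Ilo Ihi sb sS yb zb yz ys zs.
have /andP[g0 g1] := gh lo hi s y z Ilo Ihi sb sS yb zb yz ys zs.
rewrite !remE addr_ge0 ?mulr_ge0 //= mulrDr; apply: lerD => //.
by rewrite mulrCA ler_wpM2l.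
Qed.

Lemma power_ext k x : I x -> ext (fun s : ointerval a b => - set_val s ^+ k) x = - x ^+ k.
Proof. by move=> Ix; have [s <-] := in_ext (fun s : ointerval a b => - set_val s ^+ k) Ix. Qed.

Lemma power_continuous k x : I x ->
  {for x, continuous (ext (fun s : ointerval a b => - set_val s ^+ k))}.
Proof.
move=> Ix; rewrite /prop_for /continuous_at power_ext //.
apply: cvg_trans (_ : (- z ^+ k) @[z --> x] --> _); last first.
  by apply: cvgN; exact: exprn_continuous.
apply: near_eq_cvg; have := @ointerval_open R a b; rewrite openE => /(_ x Ix).
by apply: filterS => z Iz; rewrite power_ext.
Qed.

Lemma power_mtone k j : (k < j)%N ->
  mtone j (ext (fun s : ointerval a b => - set_val s ^+ k)) I.
Proof.
move=> kj n A D U d v t Dp tS Xd dI.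
rewrite (@eq_dd _ _ t t _ (fun l => qf (horner (- 'X^k)) (U l) (d l) v)) //.
  rewrite (dd_qf_poly v (incr_distinct tS) Xd) //.
  by rewrite size_polyN size_polyXn.
move=> l lk; apply: eq_qf => i; rewrite power_ext; last exact: dI.
by rewrite !hornerE.
Qed.

Lemma power_not_mtone k : (a < b)%E ->
  ~ mtone k (ext (fun s : ointerval a b => - set_val s ^+ k)) I.
Proof.
move=> ab ft; have [x0 Ix0] := ointerval_ex ab; have [x1 Ix1 x01] := ointerval_above Ix0.
pose h := (x1 - x0) / k.+1%:R.
have k0 : 0 < k.+1%:R :> R by rewrite ltr0n.
have h0 : 0 < h by rewrite divr_gt0 // subr_gt0.
pose y l := x0 + l%:R * h.
have yI l : (l <= k)%N -> I (y l).
  move=> lk; apply: ointerval_convex Ix0 Ix1 _; rewrite /y lerDl mulr_ge0 ?(ltW h0) //=.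
  rewrite -lerBrDl /h mulrCA ler_piMr ?subr_ge0 ?(ltW x01) // ler_pdivrMr // mul1r ler_nat.
  exact: leqW.
have yS l : (l < k)%N -> y l < y l.+1.
  by move=> _; rewrite /y ltrD2l ltr_pM2r // ltr_nat.
have := scalar_pencil ft yI yS.
rewrite (@eq_dd _ _ y y _ (fun l => (- 'X^k : {poly R}).[y l])) //; last first.
  by move=> l lk; rewrite power_ext; [rewrite hornerN hornerXn|exact: yI].
rewrite dd_horner; first by rewrite coefN coefXn eqxx oppr_ge0 ler10.
  exact: incr_distinct.
by rewrite size_polyN size_polyXn.
Qed.

End cone.

(** * Closedness, convexity and strict inclusions *)

Section main.
Variables (R : realType) (H : completeNormedModType R[i])
  (dot : {dot H for (@Num.conj R[i])}).
Hypothesis Hdot : norm_of_dot dot.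
Hypothesis Hinf : ~ finite_dimensional H.
Variables (a b : \bar R).
Hypothesis ab : (a < b)%E.

Lemma nonzero_vector : exists x : H, x != 0.
Proof.
have [e ef] := frame_ex Hdot Hinf 1; exists (e ord0); apply/eqP => e0.
have := ef ord0 ord0; rewrite e0 ip0l eqxx => /eqP.
by rewrite eq_sym oner_eq0.
Qed.

Lemma tone_setE k : tone_set dot a b k.+1 = [set f | @tone_data R a b k f].
Proof.
apply/seteqP; split=> f.
  move=> ft; have fm := tone_mtone Hdot nonzero_vector ab Hinf ft.
  have fc := (ext_continuous f).1 ft.1.
  by have [_ fh] := continuous_mtone_harnack ab fc fm.
move=> [fm fh]; apply: (mtone_tone Hdot nonzero_vector ab _ fm) => x.
exact: harnack_continuous fh.
Qed.

Lemma tone_set_closed k : closed (tone_set dot a b k.+1).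
Proof. by rewrite tone_setE; exact: tone_data_closed. Qed.

Lemma tone_set_cone k :
  convex_cone (tone_set dot a b k.+1 : set (ointerval a b -> R^o)).
Proof.
rewrite tone_setE; split; first by exists (fun=> 0); exact: tone_data0.
  move=> f g l; rewrite !inE /= => fk gk.
  have h0 : 0 <= 1 - l%:num by rewrite subr_ge0 le1.
  have hg := tone_data_lin h0 gk (@tone_data0 R a b k).
  have -> : conv l f g = (fun s => l%:num * f s + ((1 - l%:num) * g s + 0)).
    by apply/funext => s; rewrite addr0.
  exact: tone_data_lin (ge0 l) fk hg.
move=> c f c0 fk.
have -> : c *: f = (fun s => c * f s + 0) by apply/funext => s; rewrite addr0.
exact: tone_data_lin c0 fk (@tone_data0 R a b k).
Qed.

Lemma tone_set_proper k : tone_set dot a b k.+1 `<` tone_set dot a b k.+3.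
Proof.
rewrite !tone_setE; split.
  move=> f [fm fh]; have fc x : ointerval a b x -> {for x, continuous (ext f)}.
    exact: harnack_continuous fh.
  (* Applied twice: first to reach order k + 3, then from that order to get the Harnack inequality
     with parameter k + 2. *)
  have [f3 _] := continuous_mtone_harnack ab fc fm; split=> //.
  by have [] := continuous_mtone_harnack ab fc f3.
pose p := fun s : ointerval a b => - set_val s ^+ k.+1.
move=> /(_ p) [|pm _]; last exact: power_not_mtone pm.
have pm : mtone k.+3 (ext p) (ointerval a b) by apply: power_mtone; exact: leqW.
split=> //; have := continuous_mtone_harnack ab _ pm; case=> // x.
exact: power_continuous.
Qed.

End main.

Theorem proposition3p9 (R : realType) (H : completeNormedModType R[i])
    (dot : {dot H for (@Num.conj R[i])})
    (Hdot : norm_of_dot dot)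
    (Hsep : separable_space H)
    (Hinf : ~ finite_dimensional H)
    (a b : \bar R) (hab : (a < b)%E) :
  (forall k : nat, (0 < k)%N ->
     closed (tone_set dot a b k) /\
     convex_cone (tone_set dot a b k : set (ointerval a b -> R^o))) /\
  (forall m : nat,
     tone_set dot a b (2 * m + 1)%N `<` tone_set dot a b (2 * m + 3)) /\
  (forall m : nat,
     tone_set dot a b (2 * m + 2)%N `<` tone_set dot a b (2 * m + 4)).
Proof.
split; [|split=> m].
- case=> // k _; split.
    exact: tone_set_closed Hdot Hinf _ _ hab k.
  exact: tone_set_cone Hdot Hinf _ _ hab k.
- by rewrite addn1 addn3; exact: tone_set_proper Hdot Hinf _ _ hab _.
- by rewrite addn2 addn4; exact: tone_set_proper Hdot Hinf _ _ hab _.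
Qed.
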